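(* Let $\bar\nu\ge0$ and consider the harmonic particle chain with zero exterior potential, interaction potential $v_{\mathrm{int}}(r)=\frac{r^2}2$ and mass-matrix penalization $M_{\nu_N}=\mathrm{Id}-\bar\nu^2\Delta_d$. Suppose the state variable $X=(p_{\nu_N},q)$ is a random variable distributed according to the canonical distribution, at inverse temperature $\beta_N=\beta/N$, associated with the mass-penalized Hamiltonian $$H_{\nu_N}(p,q)=\tfrac12p^TM_{\nu_N}^{-1}p+\sum_{i=1}^{N-1}v_{\mathrm{int}}(\nabla_i^dq).$$ Let $\beta_N\Delta H$ be the variation of $\beta_NH_{\nu_N}$ after one step of the leapfrog scheme with time step $\delta t_N>0$ started from $X$, with mean $m_N$ and variance $\sigma_N^2$. Then $\beta_N\Delta H$ converges in distribution, up to normalization and centering, to a Gaussian random variable: $$\frac{\beta_N\Delta H-m_N}{\sigma_N}\xrightarrow[N\to+\infty]{\mathrm{Law}}\mathcal{N}(0,1),$$ where the mean and variance satisfy, as $N\to+\infty$: for the penalized method $\bar\nu>0$ and $\delta t_N=o(1)$, $$m_N\sim\frac{N\,\delta t_N^6}{32\,\bar\nu^6},\qquad\sigma_N^2\sim\frac{N\,\delta t_N^6}{16\,\bar\nu^6},$$ and for the Verlet integration of the exact dynamics ($\bar\nu=0$) with $\delta t_N=o(1/N)$, $$m_N\sim\frac58N^7\delta t_N^6,\qquad\sigma_N^2\sim\frac54N^7\delta t_N^6 .$$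
   Context: $q,p\in\mathbb{R}^N$, $\beta>0$. The discrete gradient $\nabla^d:\mathbb{R}^N\to\mathbb{R}^{N-1}$ is $\nabla^d_iq=N(q_{i+1}-q_i)$, $i=1,\dots,N-1$, and $\Delta_d=-(\nabla^d)^T\nabla^d$ is the discrete Neumann Laplacian. The leapfrog scheme with time step $\delta t$ is $$p_{n+1/2}=p_n+\tfrac{\delta t}2\Delta_dq_n,\quad q_{n+1}=q_n+\delta t\,M_{\nu_N}^{-1}p_{n+1/2},\quad p_{n+1}=p_{n+1/2}+\tfrac{\delta t}2\Delta_dq_{n+1}.$$ The canonical distribution is the Gaussian measure proportional to $e^{-\beta_NH_{\nu_N}(p,q)}$; since $H_{\nu_N}$ is invariant under translations $q\mapsto q+c(1,\dots,1)$, it is understood for $q$ modulo translations (e.g. restricted to $\sum_iq_i=0$). The energy variation $\Delta H$ does not depend on the translation mode. *)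

(* Defs.v *)
From HB Require Import structures.
From mathcomp Require Import all_boot all_order all_algebra.
From mathcomp Require Import all_classical all_reals all_analysis.
Import Order.TTheory GRing.Theory Num.Theory.
Import numFieldNormedType.Exports.

Set Implicit Arguments.
Unset Strict Implicit.
Unset Printing Implicit Defensive.

Local Open Scope classical_set_scope.
Local Open Scope ring_scope.

Section chain.
Variable R : realType.
Implicit Types (N : nat) (nu h : R).

(* 'I_N is {0, ..., N-1}: row i encodes q |-> N (q_{i+1} - q_i). *)
Definition discrete_gradient N : 'M[R]_(N.-1, N) :=
  \matrix_(i, j) (N%:R * ((j == i.+1 :> nat)%:R - (j == i :> nat)%:R)).

Definition discrete_laplacian N : 'M[R]_N :=
  - ((discrete_gradient N)^T *m discrete_gradient N).

Definition mass_matrix nu N : 'M[R]_N :=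
  1%:M - nu ^+ 2 *: discrete_laplacian N.

Definition v_int (r : R) : R := r ^+ 2 / 2.

(* A state is a pair (p, q). *)
Definition hamiltonian nu N (x : 'cV[R]_N * 'cV[R]_N) : R :=
  2^-1 * (x.1^T *m invmx (mass_matrix nu N) *m x.1) 0 0
  + \sum_(i < N.-1) v_int ((discrete_gradient N *m x.2) i 0).

Definition leapfrog nu h N (x : 'cV[R]_N * 'cV[R]_N) : 'cV[R]_N * 'cV[R]_N :=
  let p_half := x.1 + (h / 2) *: (discrete_laplacian N *m x.2) in
  let q_next := x.2 + h *: (invmx (mass_matrix nu N) *m p_half) in
  let p_next := p_half + (h / 2) *: (discrete_laplacian N *m q_next) in
  (p_next, q_next).

Definition energy_variation nu h N (x : 'cV[R]_N * 'cV[R]_N) : R :=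
  hamiltonian nu (leapfrog nu h x) - hamiltonian nu x.

End chain.

Section lebesgue_tuple.
Variable R : realType.
Implicit Types n : nat.

(* The library's Lebesgue measure lives on measurableTypeR R, which is R with
   its Borel sigma-algebra; tuples carry the product sigma-algebra. *)
Local Notation mR := (measurableTypeR R).

Definition tuple_cons n (x : mR * n.-tuple mR) : n.+1.-tuple mR :=
  [tuple of x.1 :: x.2].

(* Lebesgue measure on R^n, as an iterated product. *)
Fixpoint lebesgue_tuple n : set (n.-tuple mR) -> \bar R :=
  if n is n'.+1 then
    pushforward (@lebesgue_measure R \x @lebesgue_tuple n')%E (@tuple_cons n')
  else \d_[tuple].

Lemma measurable_tuple_cons n : measurable_fun setT (@tuple_cons n).
Proof. exact: (measurable_cons measurable_fst measurable_snd). Qed.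

Let lebesgue_tuple_measure n :
  exists mu : {sigma_finite_measure set (n.-tuple mR) -> \bar R},
    @lebesgue_tuple n = mu :> (set _ -> _).
Proof.
elim: n => [|n [mu muE]]; first by exists \d_[tuple].
pose nu : {measure set _ -> \bar R} := (@lebesgue_measure R \x mu)%E.
pose f := @tuple_cons n.
have mf : measurable_fun setT f by exact: measurable_tuple_cons.
pose g (t : n.+1.-tuple mR) : mR * n.-tuple mR :=
  (thead t, [tuple of behead t]).
have mg : measurable_fun setT g.
  apply/measurable_fun_pairP; split => /=; last exact: measurable_behead.
  exact: measurable_tnth.
have gf : g \o f = id.
  apply/funext => -[x t]; rewrite /g /f /tuple_cons /=.
  by congr pair; exact/val_inj.
have psi_sf : sigma_finite setT (pushforward nu f).
  have /sigma_finiteP[F [FT ndF Foo]] := sigma_finiteT (@lebesgue_measure R).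
  have /sigma_finiteP[G [GT ndG Goo]] := sigma_finiteT mu.
  exists (fun k => g @^-1` (F k `*` G k)).
    rewrite -preimage_bigcup -[LHS](preimage_setT g); congr (_ @^-1` _).
    rewrite -setXTT FT GT predeqE => -[x y]; split.
      move=> [/= [i _ Fix] [k _ Gky]]; exists (maxn i k) => //; split.
      - by move: x Fix; exact/subsetPset/ndF/leq_maxl.
      - by move: y Gky; exact/subsetPset/ndG/leq_maxr.
    by move=> [k _ []/= ? ?]; split; exists k.
  move=> k; have [mF Fk] := Foo k; have [mG Gk] := Goo k; split.
    by rewrite -[X in measurable X]setTI; apply: mg => //; exact: measurableX.
  rewrite /pushforward -comp_preimage gf preimage_id /nu /=.
  by rewrite product_measure1E// lte_mul_pinfty// ge0_fin_numE.
pose psi_of : {measure set (n.+1.-tuple mR) -> \bar R} :=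
  pushforward nu f.
pose psi := psi_of mf.
pose S := Measure_isSigmaFinite.Build _ _ _ psi psi_sf.
pose phi : {sigma_finite_measure set (n.+1.-tuple mR) -> \bar R} :=
  HB.pack (pushforward nu f) psi S.
by exists (phi mf); rewrite /= muE.
Qed.

Let lebesgue_tuple0 n : @lebesgue_tuple n set0 = 0%E.
Proof. by have [mu ->] := lebesgue_tuple_measure n; exact: measure0. Qed.

Let lebesgue_tuple_ge0 n A : (0 <= @lebesgue_tuple n A)%E.
Proof. by have [mu ->] := lebesgue_tuple_measure n; exact: measure_ge0. Qed.

Let lebesgue_tuple_sigma_additive n : semi_sigma_additive (@lebesgue_tuple n).
Proof.
by have [mu ->] := lebesgue_tuple_measure n; exact: measure_semi_sigma_additive.
Qed.

HB.instance Definition _ n := isMeasure.Build _ _ _ (@lebesgue_tuple n)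
  (@lebesgue_tuple0 n) (@lebesgue_tuple_ge0 n) (@lebesgue_tuple_sigma_additive n).

Let lebesgue_tuple_sigma_finite n : sigma_finite setT (@lebesgue_tuple n).
Proof. by have [mu ->] := lebesgue_tuple_measure n; exact: sigma_finiteT. Qed.

HB.instance Definition _ n := Measure_isSigmaFinite.Build _ _ _
  (@lebesgue_tuple n) (@lebesgue_tuple_sigma_finite n).

End lebesgue_tuple.

Section canonical_distribution.
Variable R : realType.
Implicit Types (N : nat) (nu b : R).
Local Notation mR := (measurableTypeR R).

Definition vec N (t : N.-tuple mR) : 'cV[R]_N := \col_i (tnth t i : R).

Definition state N (x : N.-tuple mR * N.-tuple mR) : 'cV[R]_N * 'cV[R]_N :=
  (vec x.1, vec x.2).

(* The representative of q modulo translations that has zero sum. *)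
Definition center N (q : N.-tuple mR) : N.-tuple mR :=
  [tuple (tnth q i : R) - (\sum_(j < N) (tnth q j : R)) / N%:R | i < N].

(* Parametrization of the hyperplane {q | \sum_i q_i = 0} by R^{N-1}. Any other
   linear parametrization changes the image of the Lebesgue measure by a
   constant factor only, which the normalization below absorbs. *)
Definition zero_sum N (r : N.-1.-tuple mR) : N.-tuple mR :=
  [tuple if (i < N.-1)%N then (nth 0 (r : seq R) i : R)
         else - \sum_(j < N.-1) (tnth r j : R) | i < N].

(* mu is the probability on {(p, q) | \sum_i q_i = 0} proportional to
   exp (- b H). When mu is a probability, the constant c is the inverse of the
   partition function. *)
Definition canonical_distribution nu b N
    (mu : set (N.-tuple mR * N.-tuple mR) -> \bar R) : Prop :=
  exists c : R, forall A, measurable A ->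
    mu A = (c%:E * \int[@lebesgue_tuple R N \x @lebesgue_tuple R N.-1]_(x in
                     [set x | A (x.1, zero_sum x.2)])
               (expR (- (b * hamiltonian nu (state (x.1, zero_sum x.2)))))%:E)%E.

(* X = (p, q) follows the canonical distribution, where q matters only modulo
   translations. *)
Definition canonically_distributed nu b N d (T : measurableType d)
    (P : probability T R) (X : {RV P >-> (N.-tuple mR * N.-tuple mR)%type}) :=
  canonical_distribution nu b
    (pushforward P (fun w => ((X w).1, center (X w).2))).

End canonical_distribution.

Definition converges_in_law (R : realType) (d : nat -> measure_display)
    (T : forall N, measurableType (d N)) (P : forall N, probability (T N) R)
    (Y : forall N, T N -> R) (mu : probability (measurableTypeR R) R) : Prop :=
  forall f : R -> R, continuous f -> (exists C, forall x, `|f x| <= C) ->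
    (fun N => 'E_(P N)[f \o Y N]%E) @ \oo --> (\int[mu]_x (f x)%:E)%E.

(* Main.v *)
(* In the orthonormal cosine basis of the discrete Neumann Laplacian the chain is a
   family of independent oscillators, and the canonical distribution makes their
   coordinates independent centred Gaussian variables. With w_k^2 = lam_k /
   (1 + nu^2 lam_k), lam_k = 4 N^2 sin^2 (k pi / 2N) and a = h w_k, one leapfrog step
   changes beta_N H by the sum over k = 1 .. N-1 of independent quadratic forms in
   two standard normal variables, of mean t_k = a^6 / 32 and variance
   2 (t_k + t_k^2). A fixed proportion of the modes have comparable variances, so
   Lindeberg's theorem applies whatever the time step. When nu > 0 almost all
   nu^2 w_k^2 are close to 1, whence the sum of the t_k; when nu = 0 the sum is
   that of sin^6 and is computed exactly. *)

Require Import Defs.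
From HB Require Import structures.
From mathcomp Require Import all_boot all_order all_algebra.
From mathcomp Require Import all_classical all_reals all_analysis.
From mathcomp Require Import measurable_realfun.
From mathcomp Require Import ring lra zify.
Import Order.TTheory GRing.Theory Num.Theory.
Import numFieldNormedType.Exports.

Set Implicit Arguments.
Unset Strict Implicit.
Unset Printing Implicit Defensive.

Local Open Scope classical_set_scope.
Local Open Scope ring_scope.

(** * Triple averaging over boxes *)

(** Two obstacles shape the proof. The laws of the modes differ from one another and change with N
    and with the time step, so the central limit theorem is proved by Lindeberg replacement with
    constants uniform over all families. A centred quadratic form in two Gaussians has third
    absolute moment at most a universal constant times the cube of its standard deviation, so that
    only the largest share of the total variance remains to be controlled. No Jacobian is computed
    either: linear changes of variables hold up to an unknown factor, and these factors, together
    with the partition function, disappear because both sides are probabilities. The variance 2 (t +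
    t^2) of a mode is tied to its mean t by conservation of area, which gives E exp (- beta_N Delta
    H) = 1. The ratio of total variance to total mean thus tends to 2 as soon as the largest t_k
    tends to 0, and this is where the conditions on the time step enter. *)

Section antiderivative.
Variable R : realType.
Local Notation mu := (@lebesgue_measure R).
Implicit Types f : R -> R.

Lemma continuous_integrable_itv f (a b : R) : continuous f ->
  mu.-integrable `[a, b] (EFin \o f).
Proof.
move=> cf; apply: continuous_compact_integrable; first exact: segment_compact.
by apply: continuous_subspaceT.
Qed.

(** The signed integral from 0, as a difference of two integrals of which at most one is over a
    nondegenerate segment. The fundamental theorem is applied with a base point to the left of [x]:
    by [FE], moving the base point to some [a] below both 0 and [x] costs only a constant. *)
Lemma antiderivative f : continuous f ->
  exists F : R -> R, forall x : R, is_derive x 1 F (f x).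
Proof.
move=> cf.
pose F x := \int[mu]_(t in `[0, x]) f t - \int[mu]_(t in `[x, 0]) f t.
have FE (a x : R) : a < 0 -> a < x ->
    F x = \int[mu]_(t in `[a, x]) f t - \int[mu]_(t in `[a, 0]) f t.
  move=> a0 ax; rewrite /F.
  have B (u v : R) : a <= u -> u <= v -> \int[mu]_(t in `[a, v]) f t -
      \int[mu]_(t in `[a, u]) f t = \int[mu]_(t in `[u, v]) f t.
    move=> au uv; rewrite Rintegral_itvB ?bnd_simp//; last first.
      exact: continuous_integrable_itv.
    apply: Rintegral_itv_obnd_cbnd.
    apply: integrableS (continuous_integrable_itv u v cf) => //.
    exact: subset_itv_oc_cc.
  have [x0|x0] := leP 0 x.
    rewrite -(B 0 x (ltW a0) x0); set I := \int[mu]_(t in `[x, 0]) _.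
    suff -> : I = 0 by rewrite subr0.
    move: x0; rewrite le_eqVlt => /predU1P[x0|x0]; rewrite /I.
      by rewrite -x0 set_itv1 Rintegral_set1.
    by rewrite set_itv_ge ?bnd_simp -?ltNge// Rintegral_set0.
  rewrite -(B x 0 (ltW ax) (ltW x0)) set_itv_ge ?bnd_simp -?ltNge//.
  by rewrite Rintegral_set0 sub0r opprB.
exists F => x; pose a := Num.min 0 x - 1.
have a0 : a < 0 by rewrite ltrBlDr add0r gt_min ltr01.
have ax : a < x by rewrite ltrBlDr gt_min (ltrDl x) ltr01 orbT.
pose G y := \int[mu]_(t in `[a, y]) f t.
have [dG GE] : derivable G x 1 /\ G^`()%classic x = f x.
  apply: (@continuous_FTC1_closed _ f a x (x + 1)) => //.
  - by rewrite ltrDl.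
  - exact: continuous_integrable_itv.
  - exact: cf.
have iG : is_derive x 1 (G \- cst (G 0)) (f x).
  rewrite -[f x]subr0; apply: is_deriveB.
  by apply: (DeriveDef dG); rewrite -derive1E.
apply: (@near_eq_is_derive _ _ _ (G \- cst (G 0))) => //.
near=> y; rewrite (FE a)//.
near: y; exact: lt_nbhsr.
Unshelve. all: by end_near. Qed.

Lemma is_derive1_shift f (h x d : R) : is_derive (x + h) 1 f d ->
  is_derive x 1 (fun y => f (y + h)) d.
Proof.
move=> df; have dh : is_derive x 1 (fun y : R => y + h) 1.
  by rewrite -[X in is_derive _ _ _ X]addr0; apply: is_deriveD.
by have := @is_derive1_comp _ f (fun y => y + h) x d 1 df dh; rewrite mulr1.
Qed.

Lemma is_derive_continuous f (f' : R -> R) :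
  (forall x : R, is_derive x 1 f (f' x)) -> continuous f.
Proof.
by move=> df x; apply/differentiable_continuous/derivable1_diffP; case: (df x).
Qed.

(** [g x] is the mean of [f] over [[x, x + h]]. It gains one derivative, which is a difference
    quotient of [f] and hence bounded when [f] is. *)
Lemma box_average f h : continuous f -> 0 < h -> exists2 g : R -> R,
  forall x : R, is_derive x 1 g (h^-1 * (f (x + h) - f x)) &
  forall x, exists2 c, x <= c <= x + h & g x = f c.
Proof.
move=> cf h0; have [F dF] := antiderivative cf.
exists (fun x => h^-1 * (F (x + h) - F x)) => x.
  apply: is_deriveZ; apply: is_deriveB.
  exact: is_derive1_shift.
have xh : x < x + h by rewrite ltrDl.
have [c] := MVT xh (fun y _ => dF y) (continuous_subspaceT (is_derive_continuous dF)).
rewrite in_itv/= => /andP[xc cx] ->; exists c; first by rewrite !ltW.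
by rewrite addrAC subrr add0r mulrCA mulVf ?mulr1// gt_eqF.
Qed.

(** The mean value theorem replaces an integration, which would give the better constant
    [M / (n + 1)]; the Taylor bound built from this requires no sharp constant. *)
Lemma derive_norm_le (h h' : R -> R) M n y :
  (forall x : R, is_derive x 1 h (h' x)) -> h 0 = 0 ->
  (forall t, `|h' t| <= M * `|t| ^+ n) -> `|h y| <= M * `|y| ^+ n.+1.
Proof.
move=> dh h0 hM.
have ch : continuous h := is_derive_continuous dh.
have M0 : 0 <= M by have := le_trans (normr_ge0 _) (hM 1); rewrite normr1 expr1n mulr1.
have [c cy ->] : exists2 c, `|c| <= `|y| & h y = h' c * y.
  have [y0|y0] := leP 0 y.
    have [c] := MVT_segment y0 (fun y _ => dh y) (continuous_subspaceT ch).
    rewrite in_itv/= h0 !subr0 => /andP[c0 cy] ->; exists c => //.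
    by rewrite !ger0_norm.
  have [c] := MVT_segment (ltW y0) (fun y _ => dh y) (continuous_subspaceT ch).
  rewrite in_itv/= h0 !sub0r mulrN => /andP[yc c0] /oppr_inj ->; exists c => //.
  by rewrite !ler0_norm ?lerN2// ltW.
rewrite normrM exprSr mulrA; apply: ler_wpM2r => //.
by rewrite (le_trans (hM c))// ler_wpM2l// lerXn2r ?nnegrE.
Qed.

End antiderivative.

(** * Bounded functions and convolutions of probabilities *)

Section bounded_integrals.
Context d (T : measurableType d) (R : realType) (P : probability T R).

Lemma bounded_integrable (f : T -> R) C :
  measurable_fun setT f -> (forall x, `|f x| <= C) ->
  P.-integrable setT (EFin \o f).
Proof.
move=> mf fC; apply: (le_integrable measurableT _ _
    (finite_measure_integrable_cst P C measurableT)).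
  exact/measurable_EFinP.
by move=> x _ /=; rewrite lee_fin (le_trans (fC x))// ler_norm.
Qed.

Lemma Rintegral_cst_prob (c : R) : \int[P]_x c = c.
Proof. by rewrite Rintegral_cst//= probability_setT mulr1. Qed.

Lemma Rintegral_dist_le (f g : T -> R) (e : R) :
  P.-integrable setT (EFin \o f) -> P.-integrable setT (EFin \o g) ->
  (forall x, `|f x - g x| <= e) ->
  `|\int[P]_x f x - \int[P]_x g x| <= e.
Proof.
move=> fi gi fg; rewrite -RintegralB//.
have fgi : P.-integrable setT (EFin \o (fun x => f x - g x)).
  exact: (integrableB measurableT fi gi).
apply: (le_trans (le_normr_Rintegral measurableT fgi)).
rewrite -[leRHS]Rintegral_cst_prob; apply: le_Rintegral => //.
- exact: integrable_norm fgi.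
- exact: finite_measure_integrable_cst.
Qed.

Lemma Rintegral_norm_le (f : T -> R) C : measurable_fun setT f ->
  (forall x, `|f x| <= C) -> `|\int[P]_x f x| <= C.
Proof.
move=> mf fC; have C0 : 0 <= C := le_trans (normr_ge0 _) (fC point).
rewrite -[X in `|X|]subr0 -[X in _ - X](Rintegral_cst_prob 0).
apply: Rintegral_dist_le.
- exact: bounded_integrable fC.
- exact: finite_measure_integrable_cst.
- by move=> x; rewrite subr0.
Qed.

End bounded_integrals.

Section bounded_fubini.
Context d1 d2 (T1 : measurableType d1) (T2 : measurableType d2) (R : realType).
Variables (P : probability T1 R) (Q : probability T2 R).
Variables (g : T1 * T2 -> R) (C : R).
Hypotheses (mg : measurable_fun setT g) (gC : forall z, `|g z| <= C).

Lemma bounded_integrable2 x : Q.-integrable setT (fun y => (g (x, y))%:E).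
Proof.
apply: (@bounded_integrable _ _ _ Q (fun y => g (x, y)) C) => //.
exact: measurableT_comp.
Qed.

Lemma bounded_integrable1 y : P.-integrable setT (fun x => (g (x, y))%:E).
Proof.
apply: (@bounded_integrable _ _ _ P (fun x => g (x, y)) C) => //.
exact: measurableT_comp.
Qed.

Lemma bounded_integrable12 : (P \x Q)%E.-integrable setT (EFin \o g).
Proof. exact: (@bounded_integrable _ _ _ (P \x Q)%E g C). Qed.

Lemma measurable_Rintegral_section :
  measurable_fun setT (fun x => \int[Q]_y g (x, y)).
Proof.
apply/measurable_EFinP.
have mF := @measurable_fubini_F _ _ _ _ _ P Q _ bounded_integrable12.
move: mF; congr (measurable_fun _ _); apply/funext => x /=.
rewrite /Rintegral /fubini_F/= fineK//.
by apply: integrable_fin_num => //; exact: bounded_integrable2.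
Qed.

Lemma Rintegral_prod : \int[(P \x Q)%E]_z g z = \int[P]_x \int[Q]_y g (x, y).
Proof.
rewrite /Rintegral -integral12_prod_meas1; last exact: bounded_integrable12.
congr fine; apply: eq_integral => x _; rewrite fineK//.
by apply: integrable_fin_num => //; exact: bounded_integrable2.
Qed.

Lemma Rintegral_swap :
  \int[P]_x \int[Q]_y g (x, y) = \int[Q]_y \int[P]_x g (x, y).
Proof.
rewrite -Rintegral_prod /Rintegral -integral21_prod_meas1; last first.
  exact: bounded_integrable12.
congr fine; apply: eq_integral => x _; rewrite fineK//.
by apply: integrable_fin_num => //; exact: bounded_integrable1.
Qed.

Lemma Rintegral_section_integrable :
  P.-integrable setT (EFin \o (fun x => \int[Q]_y g (x, y))).
Proof.
apply: (@bounded_integrable _ _ _ P _ C).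
  exact: measurable_Rintegral_section.
move=> x; apply: (@Rintegral_norm_le _ _ _ Q (fun y => g (x, y)) C) => //.
exact: measurableT_comp.
Qed.

End bounded_fubini.

Section convolution.
Variable R : realType.
Local Notation mR := (measurableTypeR R).
Implicit Types P Q : probability mR R.

Definition addp (z : mR * mR) : mR := (z.1 : R) + (z.2 : R).

Lemma measurable_addp : measurable_fun setT addp.
Proof. by apply: measurable_funD; [exact: measurable_fst|exact: measurable_snd]. Qed.

HB.instance Definition _ := isMeasurableFun.Build _ _ _ _ addp measurable_addp.

Definition conv P Q : probability mR R := distribution (P \x Q)%E addp.

Lemma ge0_integral_conv P Q (f : R -> \bar R) :
  measurable_fun setT (f : mR -> _) -> (forall x, 0 <= f x)%E ->
  (\int[conv P Q]_z f z = \int[P]_x \int[Q]_y f (x + y)%R)%E.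
Proof.
move=> mf f0; rewrite ge0_integral_distribution//.
rewrite fubini_tonelli1//=.
exact: measurableT_comp.
Qed.

Lemma integral_conv P Q (f : R -> \bar R) :
  measurable_fun setT (f : mR -> _) -> (conv P Q).-integrable setT f ->
  (\int[conv P Q]_z f z = \int[P]_x \int[Q]_y f (x + y)%R)%E.
Proof.
move=> mf fi.
have fi' : (P \x Q)%E.-integrable setT (f \o addp).
  apply/integrableP; split.
    exact: (measurableT_comp mf (measurable_addp)).
  have /integrableP[_] := fi.
  by rewrite ge0_integral_distribution//; exact: measurableT_comp.
by rewrite integral_distribution// -integral12_prod_meas1.
Qed.

Lemma measurable_shift (f : R -> R) (x : R) :
  measurable_fun setT (f : mR -> mR) ->
  measurable_fun setT ((fun y => f (x + y)) : mR -> mR).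
Proof. by move=> mf; apply: measurableT_comp => //; exact: measurable_funD. Qed.

Lemma measurable_affine (f : R -> R) (x s : R) :
  measurable_fun setT (f : mR -> mR) ->
  measurable_fun setT ((fun y => f (x + s * y)) : mR -> mR).
Proof.
move=> mf; apply: measurableT_comp => //; exact: measurable_funD.
Qed.

Lemma Rintegral_conv P Q (f : R -> R) C :
  measurable_fun setT (f : mR -> mR) -> (forall x, `|f x| <= C) ->
  \int[conv P Q]_z f z = \int[P]_x \int[Q]_y f (x + y).
Proof.
move=> mf fC; rewrite /Rintegral integral_conv//; first last.
- exact: (@bounded_integrable _ mR R (conv P Q) f C).
- exact/measurable_EFinP.
congr fine; apply: eq_integral => x _; rewrite fineK//.
apply: integrable_fin_num => //.
apply: (@bounded_integrable _ _ _ Q (fun y => f (x + y)) C) => //.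
exact: measurable_shift.
Qed.

End convolution.

(** * Lindeberg's central limit theorem *)

Section comparison.
Variable R : realType.
Local Notation mR := (measurableTypeR R).
Implicit Types P Q : probability mR R.

Variable gauss : probability mR R.

Definition moments P (m v : R) :=
  [/\ P.-integrable setT (fun y => (y - m)%:E),
      P.-integrable setT (fun y => ((y - m) ^+ 2)%:E),
      \int[P]_y (y - m) = 0 & \int[P]_y ((y - m) ^+ 2) = v].

Definition third_moment_le P (m t : R) :=
  P.-integrable setT (fun y => (`|y - m| ^+ 3)%:E) /\
  \int[P]_y (`|y - m| ^+ 3) <= t.

(* Unlike a bound at a single point, this is stable under convolution, so that the
   comparison with a Gaussian can be made one summand at a time. *)
Definition close (f : R -> R) P m s e := forall x,
  `|\int[P]_y f (x + y) - \int[gauss]_z f (x + m + s * z)| <= e.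

(** [a] and [b] play the roles of f' and f'' / 2, but only the uniform cubic error is recorded: this
    is all that replacement uses, and it passes at once to affine reparametrizations of [f]. *)
Definition cubic_taylor (f : R -> R) (K : R) := 0 <= K /\ exists a b : R -> R,
  forall x y, `|f (x + y) - (f x + a x * y + b x * y ^+ 2)| <= K * `|y| ^+ 3.

(** Expanding at [x + m] in powers of [y - m] makes the linear term vanish. The approximating value
    depends on [P] only through [m] and [v], so two laws that share them can be compared. *)
Lemma cubic_taylor_integral f C K P m v t :
  measurable_fun setT (f : mR -> mR) -> (forall x, `|f x| <= C) ->
  moments P m v -> third_moment_le P m t ->
  0 <= K -> forall (a b : R -> R),
  (forall x y, `|f (x + y) - (f x + a x * y + b x * y ^+ 2)| <= K * `|y| ^+ 3) ->
  forall x, `|\int[P]_y f (x + y) - (f (x + m) + b (x + m) * v)| <= K * t.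
Proof.
move=> mf fC [i1 i2 e1 e2] [i3 e3] K0 a b ab x.
pose p (y : R) := f (x + m) + a (x + m) * (y - m) + b (x + m) * (y - m) ^+ 2.
have i0 : P.-integrable setT (fun=> (f (x + m))%:E).
  exact: finite_measure_integrable_cst.
have ia : P.-integrable setT (fun y => (a (x + m) * (y - m))%:E).
  exact: (integrableZl measurableT (a (x + m)) i1).
have ib : P.-integrable setT (fun y => (b (x + m) * (y - m) ^+ 2)%:E).
  exact: (integrableZl measurableT (b (x + m)) i2).
have i0a : P.-integrable setT (fun y => (f (x + m) + a (x + m) * (y - m))%:E).
  exact: (integrableD measurableT i0 ia).
have ip : P.-integrable setT (EFin \o p).
  exact: (integrableD measurableT i0a ib).
have -> : f (x + m) + b (x + m) * v = \int[P]_y p y.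
  rewrite /p RintegralD// RintegralD// !RintegralZl// e1 e2.
  by rewrite Rintegral_cst_prob mulr0 addr0.
have iF : P.-integrable setT (EFin \o (fun y => f (x + y))).
  apply: (@bounded_integrable _ _ _ P (fun y => f (x + y)) C) => //.
  exact: measurable_shift.
rewrite -RintegralB//.
have iB : P.-integrable setT (EFin \o (fun y => f (x + y) - p y)).
  exact: (integrableB measurableT iF ip).
apply: (le_trans (le_normr_Rintegral measurableT iB)).
apply: (@le_trans _ _ (\int[P]_y (K * `|y - m| ^+ 3))).
  apply: le_Rintegral => //.
  - exact: (integrable_norm iB).
  - exact: (integrableZl measurableT K i3).
  - move=> y _; have -> : x + y = x + m + (y - m) by ring.
    exact: ab.
by rewrite RintegralZl// ler_wpM2l.
Qed.

(** Besides moments up to order 3, this is what the replacement argument asks of the Gaussian: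
    independent multiples of it add up to a multiple of it. *)
Definition gauss_stable := forall (f : R -> R) C,
  measurable_fun setT (f : mR -> mR) -> (forall x, `|f x| <= C) ->
  forall s t : R, \int[gauss]_y \int[gauss]_z f (s * y + t * z) =
    \int[gauss]_z f (Num.sqrt (s ^+ 2 + t ^+ 2) * z).

(** The two laws are replaced in turn, the other variable only shifting the base point. As [close]
    is uniform in [x], the errors add, and stability merges the two Gaussians. *)
Lemma close_conv f C P Q m m' s s' e e' : gauss_stable ->
  measurable_fun setT (f : mR -> mR) -> (forall x, `|f x| <= C) ->
  close f P m s e -> close f Q m' s' e' ->
  close f (conv P Q) (m + m') (Num.sqrt (s ^+ 2 + s' ^+ 2)) (e + e').
Proof.
move=> stable mf fC cP cQ x.
have mfx y : measurable_fun setT ((fun z => f (y + z)) : mR -> mR).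
  exact: measurable_shift.
have mfpq : measurable_fun setT (fun uv : mR * mR => f (x + uv.1 + uv.2)).
  apply: measurableT_comp => //; apply: measurable_funD => //.
  exact: measurable_funD.
have mfpg : measurable_fun setT (fun uz : mR * mR => f (x + uz.1 + m' + s' * uz.2)).
  apply: measurableT_comp => //; apply: measurable_funD => //; last exact: measurable_funM.
  by apply: measurable_funD => //; exact: measurable_funD.
have mfgg : measurable_fun setT (fun zw : mR * mR => f (x + m' + s' * zw.1 + m + s * zw.2)).
  apply: measurableT_comp => //; apply: measurable_funD => //; last exact: measurable_funM.
  apply: measurable_funD => //; apply: measurable_funD => //; exact: measurable_funM.
have mfgp : measurable_fun setT (fun zu : mR * mR => f (x + m' + s' * zu.1 + zu.2)).
  apply: measurableT_comp => //; apply: measurable_funD => //.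
  by apply: measurable_funD => //; exact: measurable_funM.
rewrite (@Rintegral_conv _ P Q (fun z => f (x + z)) C)//.
pose A := \int[P]_u \int[gauss]_z f (x + u + m' + s' * z).
have leA : `|\int[P]_u \int[Q]_v f (x + (u + v)) - A| <= e'.
  under eq_Rintegral do under eq_Rintegral do rewrite addrA.
  apply: Rintegral_dist_le.
  - exact: (@Rintegral_section_integrable _ _ _ _ _ P Q _ C mfpq).
  - exact: (@Rintegral_section_integrable _ _ _ _ _ P gauss _ C mfpg).
  - by move=> u; exact: cQ.
(* After an exchange of integrals, the Gaussian introduced for [Q] belongs to the base point while
   [P] is replaced. *)
pose B := \int[gauss]_z \int[gauss]_w f (x + m' + s' * z + m + s * w).
have leB : `|A - B| <= e.
  rewrite /A (@Rintegral_swap _ _ _ _ _ P gauss _ C mfpg)//=.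
  have E z u : x + u + m' + s' * z = x + m' + s' * z + u by ring.
  under eq_Rintegral do under eq_Rintegral do rewrite E.
  apply: Rintegral_dist_le.
  - exact: (@Rintegral_section_integrable _ _ _ _ _ gauss P _ C mfgp).
  - exact: (@Rintegral_section_integrable _ _ _ _ _ gauss gauss _ C mfgg).
  - by move=> z; exact: cP.
have <- : B = \int[gauss]_z f (x + (m + m') + Num.sqrt (s ^+ 2 + s' ^+ 2) * z).
  rewrite (addrC (s ^+ 2)).
  have /= <- := stable (fun z => f (x + (m + m') + z)) C (mfx _) (fun z => fC _) s' s.
  apply: eq_Rintegral => z _; apply: eq_Rintegral => w _; congr f; ring.
rewrite -(subrKA A) (le_trans (ler_normD _ _))// addrC lerD//.
Qed.

Lemma moments_ge0 P m v : moments P m v -> 0 <= v.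
Proof. by move=> [_ _ _ <-]; apply: Rintegral_ge0 => y _; exact: sqr_ge0. Qed.

Lemma moments_shift_sq P m v (a : R) : moments P m v ->
  (\int[P]_y ((a + (y - m)) ^+ 2)%:E = (a ^+ 2 + v)%:E)%E.
Proof.
move=> [i1 i2 e1 e2].
have E y : (a + (y - m)) ^+ 2 = a ^+ 2 + (2 * a) * (y - m) + (y - m) ^+ 2 by ring.
under eq_integral do rewrite E.
have i0 : P.-integrable setT (fun=> (a ^+ 2)%:E).
  exact: finite_measure_integrable_cst.
have ia : P.-integrable setT (fun y => ((2 * a) * (y - m))%:E).
  exact: (integrableZl measurableT (2 * a) i1).
have i0a : P.-integrable setT (fun y => (a ^+ 2 + (2 * a) * (y - m))%:E).
  exact: (integrableD measurableT i0 ia).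
have i0a2 : P.-integrable setT (fun y => (a ^+ 2 + (2 * a) * (y - m) + (y - m) ^+ 2)%:E).
  exact: (integrableD measurableT i0a i2).
rewrite -[LHS]fineK; last exact: integrable_fin_num.
congr EFin; rewrite -/(Rintegral _ _ _) RintegralD// RintegralD// RintegralZl// e1 e2.
by rewrite Rintegral_cst_prob mulr0 addr0.
Qed.

Lemma integrable_le_sq P m : measurable_fun setT (fun y : mR => y - m) ->
  P.-integrable setT (fun y => ((y - m) ^+ 2)%:E) ->
  P.-integrable setT (fun y => (y - m)%:E).
Proof.
move=> mm i2; have i0 : P.-integrable setT (fun=> 1%:E).
  exact: finite_measure_integrable_cst.
apply: (le_integrable measurableT _ _ (integrableD measurableT i0 i2)).
  exact/measurable_EFinP.
move=> y _ /=; rewrite lee_fin [leRHS]ger0_norm ?addr_ge0 ?sqr_ge0//.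
rewrite -(real_normK (num_real (y - m))).
by have := sqr_ge0 (`|y - m| - 1); have := normr_ge0 (y - m); nra.
Qed.

Lemma moments_conv P Q m v m' v' : moments P m v -> moments Q m' v' ->
  moments (conv P Q) (m + m') (v + v').
Proof.
move=> mP mQ; have [i1 i2 e1 e2] := mP; have [i1' i2' e1' e2'] := mQ.
have msub a : measurable_fun setT (fun y : mR => y - a).
  exact: measurable_funD.
have E x y : x + y - (m + m') = (x - m) + (y - m') by ring.
have msq : measurable_fun setT (fun y : mR => ((y - (m + m')) ^+ 2)%:E).
  by apply/measurable_EFinP; apply: measurable_funX; exact: msub.
have I2 : (\int[conv P Q]_z ((z - (m + m')) ^+ 2)%:E = (v + v')%:E)%E.
  rewrite ge0_integral_conv//; last by move=> x; rewrite lee_fin sqr_ge0.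
  under eq_integral do under eq_integral do rewrite E.
  under eq_integral do rewrite (moments_shift_sq _ mQ).
  have i0 : P.-integrable setT (fun=> v'%:E).
    exact: finite_measure_integrable_cst.
  have ii : P.-integrable setT (fun y => ((y - m) ^+ 2 + v')%:E).
    exact: (integrableD measurableT i2 i0).
  rewrite -[LHS]fineK; last exact: integrable_fin_num.
  congr EFin; rewrite -/(Rintegral _ _ _) RintegralD// e2.
  by rewrite Rintegral_cst_prob.
have J2 : (conv P Q).-integrable setT (fun y => ((y - (m + m')) ^+ 2)%:E).
  apply/integrableP; split => //.
  under eq_integral => y _ do rewrite gee0_abs ?lee_fin ?sqr_ge0//.
  by rewrite I2 ltry.
have J1 : (conv P Q).-integrable setT (fun y => (y - (m + m'))%:E).
  exact: integrable_le_sq.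
split => //; last by rewrite /Rintegral I2.
rewrite /Rintegral integral_conv//; last exact/measurable_EFinP.
under eq_integral do under eq_integral do rewrite E.
have F x : (\int[Q]_y (x - m + (y - m'))%:E = (x - m)%:E)%E.
  have i0 : Q.-integrable setT (fun=> (x - m)%:E).
    exact: finite_measure_integrable_cst.
  have ii : Q.-integrable setT (fun y => (x - m + (y - m'))%:E).
    exact: (integrableD measurableT i0 i1').
  rewrite -[LHS]fineK; last exact: integrable_fin_num.
  congr EFin; rewrite -/(Rintegral _ _ _) RintegralD// e1'.
  by rewrite Rintegral_cst_prob addr0.
by under eq_integral do rewrite F.
Qed.

End comparison.

(** * Sums of independent variables and their Gaussian comparison *)

Section sums.
Variable R : realType.
Local Notation mR := (measurableTypeR R).
Variables (I : eqType) (P : I -> probability mR R) (m v : I -> R).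
Hypothesis mom : forall i, moments (P i) (m i) (v i).

Definition conv_list (l : seq I) : probability mR R :=
  foldr (fun i Q => conv (P i) Q) (\d_(0 : mR)) l.

Lemma integrable_dirac0 (f : R -> R) : measurable_fun setT (f : mR -> R) ->
  (\d_(0 : mR)).-integrable setT (fun y : mR => (f y)%:E).
Proof.
move=> mf; apply/integrableP; split; first exact/measurable_EFinP.
rewrite integral_dirac//; last first.
  by apply: measurableT_comp => //; exact/measurable_EFinP.
by rewrite diracT mul1e ltry.
Qed.

Lemma Rintegral_dirac0 (f : R -> R) : measurable_fun setT (f : mR -> R) ->
  \int[\d_(0 : mR)]_y f y = f 0.
Proof.
move=> mf; rewrite /Rintegral integral_dirac//; last exact/measurable_EFinP.
by rewrite diracT mul1e.
Qed.

Lemma moments_conv_list l :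
  moments (conv_list l) (\sum_(i <- l) m i) (\sum_(i <- l) v i).
Proof.
elim: l => [|i l IH]; last by rewrite !big_cons; exact: moments_conv.
rewrite !big_nil /=; split.
- apply: (@integrable_dirac0 (fun y => y - 0)).
  exact: measurable_funD.
- apply: (@integrable_dirac0 (fun y => (y - 0) ^+ 2)).
  by apply: measurable_funX; exact: measurable_funD.
- rewrite (@Rintegral_dirac0 (fun y => y - 0)) ?subrr//.
  exact: measurable_funD.
- rewrite (@Rintegral_dirac0 (fun y => (y - 0) ^+ 2)) ?subrr ?expr0n//.
  by apply: measurable_funX; exact: measurable_funD.
Qed.

Variables (gauss : probability mR R) (t0 : R).
Hypotheses (stable : gauss_stable gauss) (gmom : moments gauss 0 1)
  (g3 : third_moment_le gauss 0 t0).

(** The Taylor comparison is made for [P i], and for [gauss] with the test function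
    [h u = f (x + m i + s * u)], whose Taylor constant is [K * s ^+ 3]. Both lead to the same value
    because [gauss] is standardized. *)
Lemma close_smooth f C K i t :
  measurable_fun setT (f : mR -> mR) -> (forall x, `|f x| <= C) ->
  cubic_taylor f K -> third_moment_le (P i) (m i) t ->
  close gauss f (P i) (m i) (Num.sqrt (v i)) (K * (t + Num.sqrt (v i) ^+ 3 * t0)).
Proof.
move=> mf fC [K0 [a [b ab]]] ti x.
have v0 : 0 <= v i := moments_ge0 (mom i).
set s := Num.sqrt (v i).
have s0 : 0 <= s by rewrite sqrtr_ge0.
have s2 : s ^+ 2 = v i by rewrite sqr_sqrtr.
have H1 := cubic_taylor_integral mf fC (mom i) ti K0 ab x.
pose h u := f (x + m i + s * u).
have mh : measurable_fun setT (h : mR -> mR) by exact: measurable_affine.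
have hab u y : `|h (u + y) - (h u + (a (x + m i + s * u) * s) * y
    + (b (x + m i + s * u) * s ^+ 2) * y ^+ 2)| <= K * s ^+ 3 * `|y| ^+ 3.
  have -> : h (u + y) = f (x + m i + s * u + s * y) by rewrite /h mulrDr addrA.
  have -> : h u + (a (x + m i + s * u) * s) * y + (b (x + m i + s * u) * s ^+ 2) * y ^+ 2
    = f (x + m i + s * u) + a (x + m i + s * u) * (s * y)
      + b (x + m i + s * u) * (s * y) ^+ 2 by rewrite /h; ring.
  by rewrite (le_trans (ab _ _))// normrM exprMn (ger0_norm s0) mulrA.
have Ks0 : 0 <= K * s ^+ 3 by rewrite mulr_ge0 ?exprn_ge0.
have H2 := cubic_taylor_integral mh (fun u => fC _) gmom g3 Ks0 hab 0.
move: H2; rewrite {2}/h !addr0 mulr0 addr0 mulr1 s2.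
under eq_Rintegral do rewrite /h add0r.
rewrite distrC => H2.
set A := \int[P i]_y _ in H1 *.
set B := \int[gauss]_y _ in H2 *.
rewrite (_ : A - B = A - (f (x + m i) + b (x + m i) * v i) +
  (f (x + m i) + b (x + m i) * v i - B)); last by rewrite addrA subrK.
rewrite (le_trans (ler_normD _ _))// mulrDr mulrA; exact: lerD.
Qed.

Lemma close_conv_list f C K (t : I -> R) l :
  measurable_fun setT (f : mR -> mR) -> (forall x, `|f x| <= C) ->
  cubic_taylor f K -> (forall i, third_moment_le (P i) (m i) (t i)) ->
  close gauss f (conv_list l) (\sum_(i <- l) m i) (Num.sqrt (\sum_(i <- l) v i))
    (\sum_(i <- l) K * (t i + Num.sqrt (v i) ^+ 3 * t0)).
Proof.
move=> mf fC fK ti; elim: l => [|i l IH].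
  rewrite !big_nil sqrtr0 => x /=.
  rewrite (@Rintegral_dirac0 (fun y => f (x + y))); last exact: measurable_shift.
  under [X in _ - X]eq_Rintegral do rewrite mul0r addr0.
  by rewrite Rintegral_cst_prob subrr normr0.
rewrite !big_cons /=.
have S0 : 0 <= \sum_(i <- l) v i.
  by apply: sumr_ge0 => j _; exact: moments_ge0 (mom j).
rewrite -{1}(sqr_sqrtr (moments_ge0 (mom i))) -{1}(sqr_sqrtr S0).
apply: (close_conv stable mf fC) => //.
exact: close_smooth fC fK (ti i).
Qed.

End sums.

Lemma cubic_taylor_affine (R : realType) (f : R -> R) K M s :
  cubic_taylor f K -> 0 < s -> cubic_taylor (fun u => f ((u - M) / s)) (K / s ^+ 3).
Proof.
move=> [K0 [a [b ab]]] s0; split; first by rewrite divr_ge0// exprn_ge0// ltW.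
exists (fun u => a ((u - M) / s) / s), (fun u => b ((u - M) / s) / s ^+ 2) => x y.
have -> : (x + y - M) / s = (x - M) / s + y / s by rewrite -mulrDl addrAC.
set u := (x - M) / s.
have -> : f u + a u / s * y + b u / s ^+ 2 * y ^+ 2 =
    f u + a u * (y / s) + b u * (y / s) ^+ 2.
  by field; exact: lt0r_neq0.
rewrite (le_trans (ab _ _))// normf_div expr_div_n (gtr0_norm s0).
by rewrite mulrA mulrAC.
Qed.

Section clt.
Variable R : realType.
Local Notation mR := (measurableTypeR R).
Variables (gauss : probability mR R) (t0 c : R).
Hypotheses (stable : gauss_stable gauss) (gmom : moments gauss 0 1)
  (g3 : third_moment_le gauss 0 t0) (c0 : 0 <= c).

(* An error of quadratic growth is enough, since it is applied to variables of
   mean 0 and variance 1; this makes tightness arguments unnecessary. *)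
Definition smoothable (f : R -> R) := forall e, 0 < e -> exists g C K,
  [/\ measurable_fun setT (g : mR -> mR), forall x, `|g x| <= C, cubic_taylor g K &
      forall x, `|f x - g x| <= e * (1 + x ^+ 2)].

(* The third-order Taylor remainders are controlled by sqrt v_i ^ 3, which is at
   most v_i times a small multiple of the total standard deviation. *)
Lemma lindeberg_smooth (f : R -> R) C K e : 0 < e ->
  measurable_fun setT (f : mR -> mR) -> (forall x, `|f x| <= C) -> cubic_taylor f K ->
  exists2 delta, 0 < delta & forall (I : eqType) (P : I -> probability mR R)
    (m v : I -> R) (l : seq I),
  (forall i, moments (P i) (m i) (v i)) ->
  (forall i, third_moment_le (P i) (m i) (c * Num.sqrt (v i) ^+ 3)) ->
  0 < \sum_(i <- l) v i ->
  (forall i, i \in l -> v i <= delta * \sum_(i <- l) v i) ->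
  `|\int[conv_list P l]_y
     f ((y - \sum_(i <- l) m i) / Num.sqrt (\sum_(i <- l) v i))
    - \int[gauss]_z f z| <= e.
Proof.
move=> e0 mf fC fK; have [K0 _] := fK.
have t0_ge0 : 0 <= t0.
  by case: g3 => _; apply: le_trans; apply: Rintegral_ge0 => x _; rewrite exprn_ge0.
have ct0 : 0 <= c + t0 by rewrite addr_ge0.
have D0 : 0 < K * (c + t0) + 1 by rewrite ltr_wpDl// mulr_ge0.
(* With [delta] the square of [d], the hypothesis says that each standard deviation is at most [d]
   times the total one. The [+ 1] keeps the denominator positive when [K] is 0. *)
exists ((e / (K * (c + t0) + 1)) ^+ 2); first by rewrite exprn_gt0// divr_gt0.
set d := e / _; have d0 : 0 < d by rewrite divr_gt0.
move=> I P m v l mom t3 S0 vS.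
set S := \sum_(i <- l) v i in S0 vS *; set M := \sum_(i <- l) m i.
set s := Num.sqrt S; have s0 : 0 < s by rewrite sqrtr_gt0.
have sS : s ^+ 2 = S by rewrite sqr_sqrtr// ltW.
have mf' : measurable_fun setT ((fun u => f ((u - M) / s)) : mR -> mR).
  apply: measurableT_comp => //; apply: measurable_funM => //.
  exact: measurable_funD.
have := close_conv_list mom stable gmom g3 l mf' (fun x => fC _)
  (cubic_taylor_affine M fK s0) t3 0.
rewrite -/M -/S -/s.
under [X in `|X - _|]eq_Rintegral do rewrite add0r.
have E z : (0 + M + s * z - M) / s = z.
  by rewrite add0r addrAC subrr add0r mulrAC divff ?mul1r ?gt_eqF.
under [X in `|_ - X|]eq_Rintegral do rewrite E.
move=> H; apply: (le_trans H).
apply: (@le_trans _ _ (\sum_(i <- l) K * (c + t0) * d * (v i / S))).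
  rewrite big_seq [leRHS]big_seq; apply: ler_sum => i il.
  have vi0 : 0 <= v i := moments_ge0 (mom i).
  have -> : K / s ^+ 3 * (c * Num.sqrt (v i) ^+ 3 + Num.sqrt (v i) ^+ 3 * t0)
    = K * (c + t0) * (Num.sqrt (v i) ^+ 3 / s ^+ 3) by ring.
  rewrite -[leRHS]mulrA; apply: ler_wpM2l; first exact: mulr_ge0.
  rewrite ler_pdivrMr ?exprn_gt0//.
  have -> : d * (v i / S) * s ^+ 3 = v i * (d * s).
    rewrite (exprSr s 2) sS; field; exact: lt0r_neq0.
  rewrite (exprSr _ 2) sqr_sqrtr//; apply: ler_wpM2l => //.
  rewrite -(ler_pXn2r (n := 2)) ?nnegrE ?sqrtr_ge0 ?(mulr_ge0 (ltW d0) (ltW s0))//.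
  by rewrite exprMn sS sqr_sqrtr// vS.
rewrite -mulr_sumr -mulr_suml -/S divff ?gt_eqF// mulr1.
rewrite /d mulrA ler_pdivrMr// mulrC ler_pM2l//.
by rewrite lerDl.
Qed.

(** [delta] comes before the family in the quantifiers, so that one value serves for all rows of a
    triangular array. *)
Lemma lindeberg (f : R -> R) C e : 0 < e -> smoothable f ->
  measurable_fun setT (f : mR -> mR) -> (forall x, `|f x| <= C) ->
  exists2 delta, 0 < delta & forall (I : eqType) (P : I -> probability mR R)
    (m v : I -> R) (l : seq I),
  (forall i, moments (P i) (m i) (v i)) ->
  (forall i, third_moment_le (P i) (m i) (c * Num.sqrt (v i) ^+ 3)) ->
  0 < \sum_(i <- l) v i ->
  (forall i, i \in l -> v i <= delta * \sum_(i <- l) v i) ->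
  `|\int[conv_list P l]_y
     f ((y - \sum_(i <- l) m i) / Num.sqrt (\sum_(i <- l) v i))
    - \int[gauss]_z f z| <= e.
Proof.
(* Five shares: the error [e / 5 * (1 + x ^+ 2)] integrates to two shares against a standardized
   law, once for the sum and once for the Gaussian, and the comparison for the smooth function takes
   one. *)
move=> e0 sf mf fC; have e5 : 0 < e / 5 by rewrite divr_gt0.
have [g [C' [K [mg gC gK fg]]]] := sf _ e5.
have [delta delta0 H] := lindeberg_smooth e5 mg gC gK.
exists delta => // I P m v l mom t3 S0 vS.
have {H} := H _ _ _ _ _ mom t3 S0 vS.
have momL := moments_conv_list mom l.
move: S0 vS momL; set S := \sum_(i <- l) v i => S0 vS momL.
move: momL; set M := \sum_(i <- l) m i => momL.
set L := conv_list P l in momL *.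
have approx (Q : probability mR R) a w : moments Q a w -> 0 < w ->
    `|\int[Q]_y f ((y - a) / Num.sqrt w) - \int[Q]_y g ((y - a) / Num.sqrt w)|
    <= 2 * (e / 5).
  move=> [i1 i2 e1 e2] w0.
  have maff : measurable_fun setT (fun y : mR => (y - a) / Num.sqrt w).
    by apply: measurable_funM => //; exact: measurable_funD.
  have ifx : Q.-integrable setT (fun y => (f ((y - a) / Num.sqrt w))%:E).
    apply: (@bounded_integrable _ _ _ Q (fun y => f ((y - a) / Num.sqrt w)) C) => //.
    exact: measurableT_comp.
  have igx : Q.-integrable setT (fun y => (g ((y - a) / Num.sqrt w))%:E).
    apply: (@bounded_integrable _ _ _ Q (fun y => g ((y - a) / Num.sqrt w)) C') => //.
    exact: measurableT_comp.
  rewrite -RintegralB//.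
  have ifg := integrableB measurableT ifx igx.
  apply: (le_trans (le_normr_Rintegral measurableT ifg)).
  have i0 : Q.-integrable setT (fun=> (e / 5)%:E).
    exact: finite_measure_integrable_cst.
  have i2' : Q.-integrable setT (fun y => (e / 5 / w * (y - a) ^+ 2)%:E).
    exact: (integrableZl measurableT (e / 5 / w) i2).
  apply: (@le_trans _ _ (\int[Q]_y (e / 5 + e / 5 / w * (y - a) ^+ 2))).
    apply: le_Rintegral => //.
    - exact: (integrable_norm ifg).
    - exact: (integrableD measurableT i0 i2').
    - move=> y _; apply: (le_trans (fg _)).
      rewrite expr_div_n sqr_sqrtr ?(ltW w0)// mulrDr mulr1.
      by rewrite mulrA mulrAC.
  rewrite RintegralD// Rintegral_cst_prob RintegralZl// e2.
  by rewrite divfK ?gt_eqF// mulr_natl.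
have H1 := approx _ _ _ momL S0.
have := approx _ _ _ gmom ltr01; rewrite sqrtr1.
under [X in `|X - _|]eq_Rintegral do rewrite subr0 divr1.
under [X in `|_ - X|]eq_Rintegral do rewrite subr0 divr1.
rewrite distrC => H2 H3.
set A := \int[L]_y f _ in H1 *; set B := \int[L]_y g _ in H1 H3.
set D := \int[gauss]_z g _ in H2 H3; set F := \int[gauss]_z f _ in H2 *.
have -> : A - F = (A - B) + (B - D) + (D - F) by ring.
rewrite (le_trans (ler_normD _ _))//.
have := ler_normD (A - B) (B - D); lra.
Qed.

End clt.

(** * Smooth approximation of bounded continuous functions *)

Section smoothing.
Variable R : realType.
Local Notation mR := (measurableTypeR R).
Implicit Types f : R -> R.

Lemma is_derive_quadratic (p q r t : R) :
  is_derive t 1 (fun y : R => p + q * y + r * y ^+ 2) (q + 2 * r * t).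
Proof.
have di : is_derive t 1 (id : R -> R) 1 by exact: is_derive_id.
have d2 : is_derive t 1 (fun y : R => y ^+ 2) (t + t).
  have := is_deriveM di di; rewrite /GRing.scale/= mulr1.
  by congr is_derive; apply/funext => y; rewrite expr2.
have dq : is_derive t 1 (fun y : R => q * y) q.
  by have := is_deriveZ q di; rewrite /GRing.scale/= mulr1.
have dr : is_derive t 1 (fun y : R => r * y ^+ 2) (r * (t + t)).
  exact: is_deriveZ.
have := is_deriveD (is_deriveD (is_derive_cst p t 1) dq) dr.
by congr is_derive; ring.
Qed.

(** The bound on the third derivative [k] is integrated three times with [derive_norm_le], whence
    [K] rather than [K / 6]. *)
Lemma taylor2 (g a b k : R -> R) K :
  (forall x : R, is_derive x 1 g (a x)) -> (forall x : R, is_derive x 1 a (b x)) ->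
  (forall x : R, is_derive x 1 b (k x)) -> (forall x, `|k x| <= K) ->
  forall x y, `|g (x + y) - (g x + a x * y + b x / 2 * y ^+ 2)| <= K * `|y| ^+ 3.
Proof.
move=> dg da db kK x y.
have sh (u u' : R -> R) (t : R) : (forall x : R, is_derive x 1 u (u' x)) ->
    is_derive t 1 (fun y => u (x + y)) (u' (x + t)).
  move=> du; under eq_fun do rewrite addrC.
  by apply: is_derive1_shift; rewrite addrC.
have db0 (t : R) : is_derive t 1 (fun y => b (x + y) - b x) (k (x + t)).
  by rewrite -[k _]subr0; apply: is_deriveB; exact: sh.
have B t : `|b (x + t) - b x| <= K * `|t| ^+ 1.
  by apply: (@derive_norm_le _ (fun y => b (x + y) - b x) _ K 0 t db0); [rewrite addr0 subrr|move=> s; rewrite expr0 mulr1].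
have da0 (t : R) : is_derive t 1 (fun y => a (x + y) - (a x + b x * y)) (b (x + t) - b x).
  have := is_derive_quadratic (a x) (b x) 0 t.
  rewrite mulr0 mul0r addr0 => dq; apply: is_deriveB.
  by move: dq; congr is_derive; apply/funext => y'; rewrite mul0r addr0.
have A t : `|a (x + t) - (a x + b x * t)| <= K * `|t| ^+ 2.
  by apply: (@derive_norm_le _ (fun y => a (x + y) - (a x + b x * y)) _ K 1 t da0); [rewrite mulr0 !addr0 subrr|].
have dg0 (t : R) : is_derive t 1 (fun y => g (x + y) - (g x + a x * y + b x / 2 * y ^+ 2))
    (a (x + t) - (a x + b x * t)).
  apply: is_deriveB.
  have := is_derive_quadratic (g x) (a x) (b x / 2) t.
  by rewrite [2 * _]mulrC divfK ?pnatr_eq0.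
by apply: (@derive_norm_le _ (fun y => g (x + y) - (g x + a x * y + b x / 2 * y ^+ 2)) _ K 2 y dg0); [rewrite expr0n/= !mulr0 !addr0 subrr|].
Qed.

(** Uniform continuity in a one-sided form suited to averages over [[x, x + h]]: [c] may lie beyond
    [b]. Compactness is applied to the property [Q h x], local in [x] and in small positive [h]
    simultaneously. *)
Lemma uniform_near_segment f (a b e : R) : continuous f -> 0 < e ->
  exists2 h, 0 < h & forall x c, a <= x <= b -> x <= c <= x + h -> `|f x - f c| <= e.
Proof.
move=> cf e0.
have /compact_near_coveringP ncov := @segment_compact R a b.
pose Q (h x : R) := forall c, x <= c <= x + h -> `|f x - f c| <= e.
have /ncov : forall x, `[a, b]%classic x -> \forall x' \near x & h \near 0^'+, Q h x'.
  move=> x _; have /cvgrPdist_le/(_ (e / 2)) := cf x.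
  rewrite divr_gt0// => /(_ isT) [d/= d0 Hd].
  have d2 : 0 < d / 2 by rewrite divr_gt0.
  exists (ball x (d / 2), [set h | h < d / 2]) => /=.
    split; first exact: nbhsx_ballx.
    exact: nbhs_right_lt.
  move=> [x' h]/= [bx' hd] c /andP[xc cx].
  rewrite /ball/= in bx'.
  have H1 : `|f x - f x'| <= e / 2.
    by apply: Hd => /=; rewrite (lt_trans bx')// ltr_pdivrMr// ltr_pMr// ltr1n.
  have H2 : `|f x - f c| <= e / 2.
    apply: Hd => /=; rewrite (_ : x - c = (x - x') + (x' - c)); last by ring.
    rewrite (le_lt_trans (ler_normD _ _))// [ltRHS]splitr ltrD//.
    rewrite distrC ger0_norm ?subr_ge0// (le_lt_trans _ hd)//.
    by rewrite lerBlDr addrC.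
  rewrite (_ : f x' - f c = (f x - f c) - (f x - f x')); last by ring.
  by rewrite (le_trans (ler_normB _ _))// [leRHS]splitr lerD.
move=> H; have [h [h0 Hh]] : exists h, 0 < h /\ `[a, b] `<=` Q h.
  near (0 : R)^'+ => h; exists h; split; first by near: h; exact: nbhs_right_gt.
  by near: h; apply: H.
exists h => // x c xab xc; apply: Hh => //.
Unshelve. all: by end_near. Qed.

(** The approximation is a triple average of [f] over windows of length [h]. Its third derivative is
    a third-order difference quotient of [f], bounded in terms of [C] and [h]. On [[- L, L]] uniform
    continuity controls the error, and outside the quadratic term does. *)
Lemma smoothable_bounded_continuous f C :
  continuous f -> (forall x, `|f x| <= C) -> smoothable f.
Proof.
move=> cf fC e e0.
have C0 : 0 <= C := le_trans (normr_ge0 _) (fC 0).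
(* The crude error [2 * C] becomes at most [e * L ^+ 2]; the maximum with 1 ensures
   [L <= L ^+ 2]. *)
pose L : R := Num.max 1 (2 * C / e).
have L1 : 1 <= L by rewrite le_max lexx.
have CL : 2 * C <= e * L ^+ 2.
  rewrite -ler_pdivrMl// mulrC (@le_trans _ _ L) ?le_max ?lexx ?orbT//.
  by rewrite expr2 ler_peMr// (le_trans ler01).
have [h3 h30 H] := uniform_near_segment (- L) L cf e0.
(* Three averages move the evaluation point by up to [3 * h]. *)
pose h := h3 / 3; have h0 : 0 < h by rewrite divr_gt0.
have h3E : h3 = h + h + h by rewrite /h; field.
clearbody h.
have [g1 d1 c1] := box_average cf h0.
have cg1 := is_derive_continuous d1.
have [g2 d2 c2] := box_average cg1 h0.
have cg2 := is_derive_continuous d2.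
have [g d c] := box_average cg2 h0.
have cg := is_derive_continuous d.
have gc x : exists2 y, x <= y <= x + h3 & g x = f y.
  have [y3 /andP[? ?] ->] := c x; have [y2 /andP[? ?] ->] := c2 y3.
  have [y1 /andP[? ?] ->] := c1 y2; exists y1 => //.
  apply/andP; split; first by lra.
  by rewrite h3E; lra.
have gC x : `|g x| <= C by have [y _ ->] := gc x.
pose D u (x : R) := h^-1 * (u (x + h) - u x) : R.
have dD (u u' : R -> R) : (forall x : R, is_derive x 1 u (u' x)) ->
    forall x : R, is_derive x 1 (D u) (D u' x).
  move=> du x; apply: is_deriveZ; apply: is_deriveB.
  exact: is_derive1_shift.
have Db u B : (forall x, `|u x| <= B) -> forall x, `|D u x| <= h^-1 * (B + B).
  move=> uB x; rewrite /D normrM gtr0_norm ?invr_gt0// ler_wpM2l ?invr_ge0 ?(ltW h0)//.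
  by rewrite (le_trans (ler_normB _ _))// lerD.
exists g, C, (h^-1 * (h^-1 * (h^-1 * (C + C) + h^-1 * (C + C)) +
  h^-1 * (h^-1 * (C + C) + h^-1 * (C + C)))); split => //.
- exact: continuous_measurable_fun.
- split; first by rewrite !(mulr_ge0, addr_ge0, invr_ge0, ltW h0).
  exists (D g2), (fun x => D (D g1) x / 2).
  apply: (@taylor2 g (D g2) (D (D g1)) (D (D (D f)))) => //.
  exact: (Db _ _ (Db _ _ (Db _ _ fC))).
- move=> x; have [xL|xL] := leP `|x| L.
    have [y xy ->] := gc x.
    rewrite (le_trans (H x y _ xy)) ?ler_peMr ?(ltW e0)//; first by rewrite -ler_norml.
    by rewrite lerDl sqr_ge0.
  rewrite (le_trans (ler_normB _ _))//.
  have := fC x; have := gC x => ? ?; apply: (@le_trans _ _ (2 * C)); first by lra.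
  rewrite (le_trans CL)// ler_pM2l// -[x ^+ 2]real_normK ?num_real//.
  apply: (@le_trans _ _ (`|x| ^+ 2)); last by rewrite lerDr.
  by rewrite ler_pXn2r ?nnegrE ?(ltW xL)// (le_trans ler01 L1).
Qed.

End smoothing.

(** * Linear changes of variables for the Lebesgue measure on tuples *)

Section tuple_tools.
Variable R : realType.
Local Notation mR := (measurableTypeR R).
Local Notation mu := (@lebesgue_measure R).
Local Open Scope ereal_scope.

Lemma ge0_integral_lebesgue_shift (f : R -> \bar R) (a : R) :
  measurable_fun setT (f : mR -> \bar R) -> (forall x, 0 <= f x) ->
  \int[mu]_x f (a + x)%R = \int[mu]_x f x.
Proof.
move=> mf f0.
have ms : measurable_fun setT (fun x : mR => (a + x)%R : mR).
  exact: measurable_funD.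
pose nu0 : {measure set mR -> \bar R} :=
  pushforward mu (fun x : mR => (a + x)%R : mR).
pose nu := nu0 ms.
transitivity (\int[nu]_x f x).
  by rewrite ge0_integral_pushforward.
apply: eq_measure_integral => A mA _; apply/esym.
apply: lebesgue_measure_unique => // X [[u v] _ <-].
transitivity (mu `](u - a)%R, (v - a)%R]%classic); last first.
  congr (mu _); apply/seteqP; split => x /=; rewrite !in_itv/=.
    by rewrite ltrBlDl lerBrDl.
  by rewrite ltrBlDl lerBrDl.
rewrite !lebesgue_measure_itv/= !lte_fin ltrD2r; case: ifP => // _.
by congr EFin; rewrite opprB addrA subrK.
Qed.

Lemma ge0_integral_lebesgue_tupleS n (f : n.+1.-tuple mR -> \bar R) :
  measurable_fun setT f -> (forall x, 0 <= f x) ->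
  \int[@lebesgue_tuple R n.+1]_t f t =
  \int[mu]_x \int[@lebesgue_tuple R n]_t f [tuple of x :: t].
Proof.
move=> mf f0; have mc := @measurable_tuple_cons R n.
pose nu0 : {measure set (n.+1.-tuple mR) -> \bar R} :=
  pushforward (mu \x @lebesgue_tuple R n) (@tuple_cons R n).
pose nu := nu0 mc.
transitivity (\int[nu]_t f t).
  by apply: eq_measure_integral.
rewrite ge0_integral_pushforward//= fubini_tonelli1//=.
exact: measurableT_comp.
Qed.

Lemma ge0_integral_lebesgue_tuple0 (f : 0.-tuple mR -> \bar R) :
  (forall x, 0 <= f x) ->
  \int[@lebesgue_tuple R 0]_t f t = f [tuple].
Proof.
move=> f0.
have -> : f = cst (f [tuple]) by apply/funext => t; rewrite (tuple0 t).
rewrite integral_cst//= diracE mem_set// mule1 //.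
Qed.

End tuple_tools.
Section tuple_vectors.
Variable R : realType.
Local Notation mR := (measurableTypeR R).
Local Notation mu := (@lebesgue_measure R).

Definition unvec n (v : 'cV[R]_n) : n.-tuple mR := [tuple v i 0 : mR | i < n].

Lemma vecK n : cancel (@vec R n) (@unvec n).
Proof. by move=> t; apply/eq_from_tnth => i; rewrite tnth_mktuple mxE. Qed.

Lemma unvecK n : cancel (@unvec n) (@vec R n).
Proof. by move=> v; apply/colP => i; rewrite mxE tnth_mktuple. Qed.

Lemma measurable_unvec d (T : measurableType d) n (v : T -> 'cV[R]_n) :
  (forall i, measurable_fun setT (fun x => v x i 0)) ->
  measurable_fun setT (fun x => unvec (v x)).
Proof.
move=> mv; apply/measurable_fun_tnthP => i.
rewrite (_ : _ \o _ = fun x => v x i 0); first exact: mv.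
by apply/funext => x /=; rewrite tnth_mktuple.
Qed.

Lemma measurable_vec d (T : measurableType d) n (t : T -> n.-tuple mR) i :
  measurable_fun setT t -> measurable_fun setT (fun x => (vec (t x) i 0 : R)).
Proof.
move=> mt; under eq_fun do rewrite mxE.
exact: (measurableT_comp (@measurable_tnth _ mR n i) mt).
Qed.

Lemma measurable_mulmx_vec d (T : measurableType d) m n (A : 'M[R]_(m, n))
    (t : T -> n.-tuple mR) i : measurable_fun setT t ->
  measurable_fun setT (fun x => ((A *m vec (t x)) i 0 : R)).
Proof.
move=> mt; under eq_fun do rewrite mxE.
apply: measurable_sum => j; apply: measurable_funM => //.
exact: measurable_vec.
Qed.

Definition mxt m n (A : 'M[R]_(m, n)) (t : n.-tuple mR) : m.-tuple mR :=
  unvec (A *m vec t).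

Lemma measurable_mxt m n (A : 'M[R]_(m, n)) : measurable_fun setT (mxt A).
Proof. by apply: measurable_unvec => i; apply: measurable_mulmx_vec. Qed.

Definition addt n (s t : n.-tuple mR) : n.-tuple mR := unvec (vec s + vec t).

Lemma measurable_addt d (T : measurableType d) n (s t : T -> n.-tuple mR) :
  measurable_fun setT s -> measurable_fun setT t ->
  measurable_fun setT (fun x => addt (s x) (t x)).
Proof.
move=> ms mt; apply: measurable_unvec => i; under eq_fun do rewrite mxE.
by apply: measurable_funD; exact: measurable_vec.
Qed.

Lemma addt_cons n (x y : mR) (s t : n.-tuple mR) :
  addt [tuple of x :: s] [tuple of y :: t] =
  [tuple of ((x : R) + (y : R) : mR) :: addt s t].
Proof.
apply/eq_from_tnth => i; case: (unliftP ord0 i) => [j|] ->.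
  by rewrite tnthS !tnth_mktuple !mxE !tnthS.
by rewrite tnth0 tnth_mktuple !mxE !tnth0.
Qed.

Lemma measurable_cons_section n (x : mR) :
  measurable_fun setT (fun t : n.-tuple mR => [tuple of x :: t]).
Proof.
exact: (measurableT_comp (@measurable_tuple_cons R n) (measurable_pair1 x)).
Qed.

Local Open Scope ereal_scope.

Lemma ge0_integral_tuple_shift n (f : n.-tuple mR -> \bar R) a :
  measurable_fun setT f -> (forall x, 0 <= f x) ->
  \int[@lebesgue_tuple R n]_t f (addt a t) = \int[@lebesgue_tuple R n]_t f t.
Proof.
elim: n f a => [|n IH] f a mf f0.
  rewrite !ge0_integral_lebesgue_tuple0//; congr f; exact: tuple0.
have mfa (b : n.+1.-tuple mR) : measurable_fun setT (fun t => f (addt b t)).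
  by apply: measurableT_comp => //; exact: measurable_addt.
rewrite (ge0_integral_lebesgue_tupleS (mfa a) (fun t => f0 _)).
rewrite (ge0_integral_lebesgue_tupleS mf f0).
case/tupleP: a {mfa} => a0 a.
under eq_integral => x _ do under eq_integral => t _ do rewrite addt_cons.
pose g (x : mR) := \int[@lebesgue_tuple R n]_t f [tuple of x :: t].
have mft x : measurable_fun setT (fun t : n.-tuple mR => f [tuple of x :: t]).
  exact: (measurableT_comp mf (measurable_cons_section x)).
transitivity (\int[mu]_x g ((a0 : R) + (x : R))%R).
  apply: eq_integral => x _.
  exact: (IH (fun t => f [tuple of ((a0 : R) + (x : R))%R :: t])).
apply: (ge0_integral_lebesgue_shift (f := g)).
- apply: (@measurable_fun_fubini_tonelli_F _ _ mR (n.-tuple mR) R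
    (@lebesgue_tuple R n) (f \o @tuple_cons R n)).
  + by apply: measurableT_comp => //; exact: measurable_tuple_cons.
  + by move=> x; exact: f0.
- by move=> x; apply: integral_ge0.
Qed.

End tuple_vectors.

Section linear_change_of_variables.
Variable R : realType.
Local Notation mR := (measurableTypeR R).
Local Notation mu := (@lebesgue_measure R).
Local Notation lam n := (@lebesgue_tuple R n).
Local Open Scope ereal_scope.

Definition boxt n (u v : R) : set (n.-tuple mR) :=
  [set t | forall i, (u <= vec t i 0 <= v)%R].

Lemma measurable_boxt n (u v : R) : measurable (@boxt n u v).
Proof.
rewrite (_ : boxt u v = \bigcap_(i in [set: 'I_n])
    ((fun t : n.-tuple mR => vec t i 0%R) @^-1` `[u, v]%classic)).
  apply: fin_bigcap_measurable => // i _.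
  rewrite -[X in measurable X]setTI.
  have mv : measurable_fun setT (fun t : n.-tuple mR => vec t i 0%R).
    by apply: measurable_vec; exact: measurable_id.
  by apply: mv => //; exact: measurable_itv.
apply/seteqP; split => t /= H i; first by move=> _ /=; rewrite in_itv/=.
by have := H i Logic.I; rewrite /= in_itv/=.
Qed.

Lemma lebesgue_tuple_boxt n (u v : R) : (u <= v)%R ->
  lam n (boxt u v) = ((v - u) ^+ n)%:E.
Proof.
move=> uv; elim: n => [|n IH].
  rewrite expr0 /= diracE mem_set// => -[]//.
have mb m : measurable_fun setT (fun t : m.-tuple mR => (\1_(boxt u v) t)%:E : \bar R).
  apply/measurable_EFinP; apply: measurable_indic; exact: measurable_boxt.
have E m : lam m (boxt u v) = \int[lam m]_t (\1_(boxt u v) t)%:E.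
  by rewrite integral_indic ?setIT//; exact: measurable_boxt.
rewrite E ge0_integral_lebesgue_tupleS//.
have F (x : mR) (t : n.-tuple mR) : (\1_(boxt u v) [tuple of x :: t] : R) =
    (\1_`[u, v]%classic (x : R) * \1_(boxt u v) t)%R.
  rewrite !indicE -natrM mulnb; congr ((nat_of_bool _)%:R).
  apply/idP/andP => [|[]].
    rewrite inE => H; split; rewrite inE.
      by have := H ord0; rewrite mxE tnth0 /= in_itv.
    by move=> i; have := H (lift ord0 i); rewrite !mxE tnthS.
  rewrite !inE /= in_itv/= => H1 H2 i.
  by case: (unliftP ord0 i) => [j|] ->; rewrite mxE ?tnthS ?tnth0//; have := H2 j; rewrite mxE.
under eq_integral => x _ do under eq_integral => t _ do rewrite F EFinM.
have G (x : mR) : \int[lam n]_t ((\1_`[u, v]%classic (x : R))%:E * (\1_(boxt u v) t)%:E) =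
    (\1_`[u, v]%classic (x : R))%:E * ((v - u) ^+ n)%:E.
  by rewrite (ge0_integralZl _ _ (mb n)) ?lee_fin// -E IH.
under eq_integral => x _ do rewrite G.
rewrite (@ge0_integralZr _ _ _ mu setT measurableT
  (fun x => (\1_`[u, v]%classic (x : R))%:E)); first last.
- by rewrite lee_fin exprn_ge0// subr_ge0.
- by move=> x _; rewrite lee_fin.
- exact/measurable_EFinP/measurable_indic.
have M : mu `[u, v]%classic = (v - u)%:E.
  rewrite lebesgue_measure_itv/= lte_fin; case: ltP => // vu.
  by have -> : v = u; [apply/eqP; rewrite eq_le vu uv|rewrite subrr].
by rewrite integral_indic// setIT exprS EFinM; congr (_ * _).
Qed.

(* Uniqueness up to a constant of a translation-invariant measure, applied to
   the image of the Lebesgue measure under A^-1: both sides of Fubini's theorem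
   for [f (S x + y) * g (- S x)], with S = A^-1 and g the indicator of a cube. *)
Lemma linear_change_of_variables n (A : 'M[R]_n) : A \in unitmx ->
  exists2 c : R, (0 <= c)%R & forall f : n.-tuple mR -> \bar R,
    measurable_fun setT f -> (forall x, 0 <= f x) ->
    \int[lam n]_t f t = c%:E * \int[lam n]_t f (mxt A t).
Proof.
move=> uA; pose S := mxt (invmx A).
have mS : measurable_fun setT S by exact: measurable_mxt.
pose opt (t : n.-tuple mR) := unvec (- vec t)%R.
have mopt d (T : measurableType d) (s : T -> n.-tuple mR) :
    measurable_fun setT s -> measurable_fun setT (fun x => opt (s x)).
  move=> ms; apply: measurable_unvec => i; under eq_fun do rewrite mxE.
  by apply: measurableT_comp => //; exact: measurable_vec.
pose g (t : n.-tuple mR) : \bar R := (\1_(boxt 0 1) t)%:E.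
have mg : measurable_fun setT g.
  by apply/measurable_EFinP/measurable_indic; exact: measurable_boxt.
have g0 t : 0 <= g t by rewrite lee_fin.
have g1 : \int[lam n]_t g t = 1.
  rewrite integral_indic//; last exact: measurable_boxt.
  rewrite setIT; apply: (etrans (@lebesgue_tuple_boxt n 0 1 ler01)).
  by rewrite subr0 expr1n.
(* The volume of the image under [A] of the cube of sides [[-1, 0]], that is |det A|; only its
   finiteness is established. *)
pose c := \int[lam n]_t g (opt (S t)).
have c0 : 0 <= c by apply: integral_ge0.
have cfin : c \is a fin_num.
  rewrite ge0_fin_numE//.
  (* The image of the cube under [A] lies in the box of half-side [K]. *)
  pose K := (\sum_i \sum_j `|A i j|)%R.
  have K0 : (0 <= K)%R by apply: sumr_ge0 => i _; apply: sumr_ge0.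
  apply: (@le_lt_trans _ _ (lam n (boxt (- K)%R K))); last first.
    have KK : (- K <= K)%R by rewrite (le_trans _ K0)// oppr_le0.
    by rewrite (lebesgue_tuple_boxt n KK) ltry.
  rewrite -[boxt _ _ in leRHS]setIT -integral_indic//; last exact: measurable_boxt.
  apply: ge0_le_integral => //.
  - by apply: measurableT_comp => //; exact: mopt.
  - by apply/measurable_EFinP/measurable_indic; exact: measurable_boxt.
  move=> t _; rewrite /g lee_fin !indicE ler_nat.
  case: (boolP (opt (S t) \in _)) => //; rewrite inE => H.
  suff -> : t \in boxt (- K)%R K by [].
  rewrite inE => i; rewrite -ler_norml.
  have -> : vec t = A *m vec (S t) by rewrite unvecK mulKVmx.
  rewrite mxE (le_trans (ler_norm_sum _ _ _))//.
  apply: (@le_trans _ _ (\sum_j `|A i j|)%R).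
    apply: ler_sum => j _; rewrite normrM ler_piMr//.
    have := H j; rewrite unvecK mxE -normrN => /andP[h0 h1].
    by rewrite ger0_norm.
  by rewrite /K [leRHS](bigD1 i)//= lerDl; apply: sumr_ge0 => k _; apply: sumr_ge0.
exists (fine c); first exact: fine_ge0.
suff key (F : n.-tuple mR -> \bar R) : measurable_fun setT F -> (forall x, 0 <= F x) ->
    \int[lam n]_x F (S x) = c * \int[lam n]_x F x.
  move=> f mf f0; rewrite fineK//.
  have mA : measurable_fun setT (fun t => f (mxt A t)).
    by apply: measurableT_comp => //; exact: measurable_mxt.
  rewrite -(key _ mA (fun=> f0 _)); apply: eq_integral => x _.
  by rewrite /mxt unvecK mulKVmx// vecK.
move=> mF F0.
have mFS : measurable_fun setT (fun x => F (S x)) by exact: measurableT_comp.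
have mgS : measurable_fun setT (fun x => g (opt (S x))).
  by apply: measurableT_comp => //; exact: mopt.
pose H1 (z : n.-tuple mR * n.-tuple mR) := F (S z.1) * g (addt (opt (S z.1)) z.2).
pose H2 (z : n.-tuple mR * n.-tuple mR) := F (addt z.2 (S z.1)) * g (opt (S z.1)).
have mS1 : measurable_fun setT (fun z : n.-tuple mR * n.-tuple mR => S z.1).
  exact: (measurableT_comp mS measurable_fst).
have mH1 : measurable_fun setT H1.
  apply: emeasurable_funM; first exact: (measurableT_comp mF mS1).
  apply: (measurableT_comp mg); apply: measurable_addt; last exact: measurable_snd.
  exact: mopt.
have mH2 : measurable_fun setT H2.
  apply: emeasurable_funM.
    apply: (measurableT_comp mF); apply: measurable_addt => //.
  by apply: (measurableT_comp mg); exact: mopt.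
have H10 z : 0 <= H1 z by exact: mule_ge0.
have H20 z : 0 <= H2 z by exact: mule_ge0.
transitivity (\int[lam n]_x \int[lam n]_y H1 (x, y)).
  apply: eq_integral => x _; rewrite /H1/=.
  have mgx : measurable_fun setT (fun y => g (addt (opt (S x)) y)).
    by apply: (measurableT_comp mg); exact: measurable_addt.
  rewrite (ge0_integralZl _ _ mgx)//.
  by rewrite (ge0_integral_tuple_shift (opt (S x)) mg g0) g1 mule1.
rewrite (fubini_tonelli (m1 := lam n) (m2 := lam n) H1)//.
transitivity (\int[lam n]_y \int[lam n]_x H2 (x, y)).
  apply: eq_integral => y _.
  have mH1y : measurable_fun setT (fun x => H1 (x, y)).
    exact: (measurableT_comp mH1 (measurable_pair2 y)).
  (* Translating [x] by [A y] adds [y] to [S x], which cancels the [y] in the argument of [g] and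
     moves it to that of [F]. *)
  rewrite -(ge0_integral_tuple_shift (mxt A y) mH1y (fun=> H10 _)).
  apply: eq_integral => x _; rewrite /H1 /H2/=.
  have SE : S (addt (mxt A y) x) = addt y (S x).
    by rewrite /S /mxt /addt !unvecK mulmxDr mulKmx.
  rewrite SE; congr (_ * g _).
  by rewrite /addt /opt !unvecK opprD addrAC addNr add0r.
rewrite -(fubini_tonelli (m1 := lam n) (m2 := lam n) H2)//.
rewrite muleC -ge0_integralZl//; last by apply: integral_ge0.
apply: eq_integral => x _; rewrite /H2/=.
have mFx : measurable_fun setT (fun y => F (addt (S x) y)).
  by apply: (measurableT_comp mF); exact: measurable_addt.
have mFx' : measurable_fun setT (fun y => F (addt y (S x))).
  by apply: (measurableT_comp mF); exact: measurable_addt.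
rewrite (ge0_integralZr _ _ mFx')//.
congr (_ * _); rewrite -(ge0_integral_tuple_shift (S x) mF F0).
by apply: eq_integral => y _; rewrite /addt addrC.
Qed.

End linear_change_of_variables.

(** * Integration against a density *)

Section density.
Local Open Scope ereal_scope.
Context d (T : measurableType d) (R : realType).
Variables (mu nu : {measure set T -> \bar R}) (h : T -> R).
Hypotheses (mh : measurable_fun setT h) (h0 : forall x, (0 <= h x)%R).
Hypothesis nuE : forall A, measurable A -> nu A = \int[mu]_(x in A) (h x)%:E.

Import HBNNSimple.

Lemma ge0_integral_density (f : T -> \bar R) :
  measurable_fun setT f -> (forall x, 0 <= f x) ->
  \int[nu]_x f x = \int[mu]_x (f x * (h x)%:E).
Proof.
move=> mf f0; pose f_ := nnsfun_approx measurableT mf.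
have mh' : measurable_fun setT (EFin \o h) by exact/measurable_EFinP.
have mfh n : measurable_fun setT (fun x => (f_ n x)%:E * (h x)%:E).
  by apply: emeasurable_funM => //; exact/measurable_EFinP/measurable_funP.
transitivity (limn (fun n => \int[nu]_x (f_ n x)%:E)).
  rewrite -monotone_convergence//.
  - apply: eq_integral => y _; apply/esym/cvg_lim => //.
    by apply: cvg_nnsfun_approx => // *; exact: f0.
  - by move=> n; exact/measurable_EFinP/measurable_funP.
  - by move=> n y _; rewrite lee_fin.
  - by move=> y _ m n mn; rewrite lee_fin; exact/lefP/nd_nnsfun_approx.
rewrite [X in limn X](_ : _ = fun n => \int[mu]_x ((f_ n x)%:E * (h x)%:E)).
  rewrite -monotone_convergence//.
  - apply: eq_integral => y _; apply/cvg_lim => //.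
    apply: cvgeZr => //.
    by apply: cvg_nnsfun_approx => // *; exact: f0.
  - by move=> n y _; rewrite -EFinM lee_fin mulr_ge0.
  - move=> y _ m n mn; rewrite -!EFinM lee_fin ler_wpM2r//.
    exact/lefP/nd_nnsfun_approx.
apply/funext => n; rewrite integralT_nnsfun sintegralE.
transitivity (\int[mu]_x \sum_(k \in range (f_ n))
    ((k * \1_(f_ n @^-1` [set k]) x)%:E * (h x)%:E)).
  rewrite ge0_integral_fsum//.
  - apply: eq_fsbigr => r _; rewrite nuE//.
    have [r0|r0] := ltP r 0%R.
      rewrite preimage_nnfun0// integral_set0 mule0.
      by rewrite [RHS](integral0_eq)// => x _; rewrite indic0 mulr0 mul0e.
    rewrite integral_mkcond -ge0_integralZl//.
    + apply: eq_integral => x _; rewrite patchE indicE.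
      by case: ifPn => _; rewrite ?mulr1 ?mulr0 ?mule0 ?mul0e.
    + by apply/(measurable_restrictT _ _).1 => //; exact: measurable_funTS.
    + by move=> x _; rewrite patchE; case: ifPn; rewrite lee_fin.
  - move=> r; apply: emeasurable_funM => //; apply/measurable_EFinP.
    exact: measurable_funM.
  - move=> r x _; rewrite mule_ge0 ?lee_fin//.
    by rewrite -lee_fin EFinM nnfun_muleindic_ge0.
apply: eq_integral => x _.
have E : (f_ n x)%:E = \sum_(k \in range (f_ n)) (k * \1_(f_ n @^-1` [set k]) x)%:E.
  by rewrite fsumEFin// -fimfunE.
rewrite E ge0_mule_fsuml// => r.
by rewrite EFinM nnfun_muleindic_ge0.
Qed.

End density.

(** * Standard normal tuples *)

Section gaussian_tuples.
Variable R : realType.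
Local Notation mR := (measurableTypeR R).
Local Notation lam n := (@lebesgue_tuple R n).

HB.instance Definition _ n := isMeasurableFun.Build _ _ _ _
  (@tuple_cons R n) (@measurable_tuple_cons R n).

Definition stdnormal : probability mR R := normal_prob 0 1.

(** Built coordinate by coordinate like [lebesgue_tuple], so that the density of one with respect to
    the other is found by induction. *)
Fixpoint gauss_tuple n : probability (n.-tuple mR) R :=
  if n is n'.+1 then distribution (stdnormal \x gauss_tuple n')%E (@tuple_cons R n')
  else \d_[tuple].

Definition normsq n (t : n.-tuple mR) : R := \sum_i (vec t i 0) ^+ 2.

Lemma normsq_cons n (x : mR) (t : n.-tuple mR) :
  normsq [tuple of x :: t] = (x : R) ^+ 2 + normsq t.
Proof.
rewrite /normsq big_ord_recl mxE tnth0; congr (_ + _).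
by apply: eq_bigr => i _; rewrite !mxE tnthS.
Qed.

Lemma measurable_normsq n : measurable_fun setT (@normsq n).
Proof.
by apply: measurable_sum => i; apply: measurable_funX; exact: measurable_vec.
Qed.

Let peak : R := normal_peak 1.

Let peak_gt0 : 0 < peak. Proof. by rewrite normal_peak_gt0. Qed.

Local Open Scope ereal_scope.

Lemma ge0_integral_stdnormal (f : R -> \bar R) :
  measurable_fun setT (f : mR -> \bar R) -> (forall x, 0 <= f x) ->
  \int[stdnormal]_x f x =
  \int[lebesgue_measure]_x (f x * (peak * expR (- (x ^+ 2 / 2)))%:E).
Proof.
move=> mf f0.
rewrite (@ge0_integral_density _ mR R lebesgue_measure stdnormal (normal_pdf 0 1))//.
- apply: eq_integral => x _; rewrite normal_pdfE ?oner_neq0// /normal_fun subr0.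
  by rewrite expr1n mulNr.
- exact: measurable_normal_pdf.
- by move=> x; exact: normal_pdf_ge0.
Qed.

Lemma ge0_integral_gauss_tupleS n (f : n.+1.-tuple mR -> \bar R) :
  measurable_fun setT f -> (forall x, 0 <= f x) ->
  \int[gauss_tuple n.+1]_t f t =
  \int[stdnormal]_x \int[gauss_tuple n]_t f [tuple of x :: t].
Proof.
move=> mf f0; rewrite ge0_integral_distribution// fubini_tonelli1//=.
by apply: measurableT_comp => //; exact: measurable_tuple_cons.
Qed.

Lemma ge0_integral_gauss_tuple n (f : n.-tuple mR -> \bar R) :
  measurable_fun setT f -> (forall x, 0 <= f x) ->
  \int[gauss_tuple n]_t f t =
  (peak ^+ n)%:E * \int[lam n]_t (f t * (expR (- (normsq t / 2)))%:E).
Proof.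
elim: n f => [|n IH] f mf f0.
  rewrite expr0 mul1e ge0_integral_lebesgue_tuple0; last first.
    by move=> x; rewrite mule_ge0// lee_fin expR_ge0.
  rewrite /normsq big_ord0 mul0r oppr0 expR0 mule1 /=.
  by rewrite integral_dirac// diracE mem_set// mul1e.
have mexp m : measurable_fun setT (fun t : m.-tuple mR => (expR (- (normsq t / 2)))%:E).
  apply/measurable_EFinP; apply: measurableT_comp => //.
  apply: measurableT_comp => //; apply: measurable_funM => //.
  exact: measurable_normsq.
have mfx x : measurable_fun setT (fun t : n.-tuple mR => f [tuple of x :: t]).
  exact: (measurableT_comp mf (measurable_cons_section x)).
rewrite ge0_integral_gauss_tupleS// ge0_integral_lebesgue_tupleS; last 2 first.
- by apply: emeasurable_funM => //; apply: mexp.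
- by move=> t; rewrite mule_ge0// lee_fin expR_ge0.
rewrite ge0_integral_stdnormal; last 2 first.
- apply: (@measurable_fun_fubini_tonelli_F _ _ mR (n.-tuple mR) R
    (gauss_tuple n) (f \o @tuple_cons R n)).
  + by apply: measurableT_comp => //; exact: measurable_tuple_cons.
  + by move=> x; exact: f0.
- by move=> x; apply: integral_ge0.
pose G (x : mR) := \int[lam n]_t (f [tuple of x :: t] * (expR (- (normsq t / 2)))%:E).
have mG : measurable_fun setT G.
  apply: (@measurable_fun_fubini_tonelli_F _ _ mR (n.-tuple mR) R
    (lam n) (fun z => f (tuple_cons z) * (expR (- (normsq z.2 / 2)))%:E)).
  + apply: emeasurable_funM.
      by apply: measurableT_comp => //; exact: measurable_tuple_cons.
    exact: (measurableT_comp (mexp n) measurable_snd).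
  + by move=> x; rewrite mule_ge0// lee_fin expR_ge0.
have G0 x : 0 <= G x.
  by apply: integral_ge0 => t _; rewrite mule_ge0// lee_fin expR_ge0.
transitivity (\int[lebesgue_measure]_x
    ((peak ^+ n.+1)%:E * (G x * (expR (- (x ^+ 2 / 2)))%:E)))%E.
  apply: eq_integral => x _; rewrite IH// -/(G x) EFinM (exprSr peak) EFinM.
  by rewrite muleACA.
rewrite ge0_integralZl//; last 3 first.
- apply: emeasurable_funM => //; apply/measurable_EFinP.
  apply: measurableT_comp => //; apply: measurableT_comp => //.
  by apply: measurable_funM => //; exact: measurable_funX.
- by move=> x _; rewrite mule_ge0// lee_fin expR_ge0.
- by rewrite lee_fin exprn_ge0// ltW.
congr (_ * _); apply: eq_integral => x _.
rewrite -ge0_integralZr//; last 2 first.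
- by apply: emeasurable_funM => //; apply: mexp.
- by move=> t _; rewrite mule_ge0// lee_fin expR_ge0.
apply: eq_integral => t _; rewrite -muleA -EFinM -expRD normsq_cons.
by rewrite mulrDl opprD addrC.
Qed.

(** In the coordinates given by [A] the form [q] is the squared norm, so [A] carries the standard
    Gaussian to the law of density proportional to exp (- q / 2). The factor [c] mixes the Jacobian
    with the Gaussian normalization. *)
Lemma gaussian_linear_image n (A : 'M[R]_n) (q : n.-tuple mR -> R) :
  A \in unitmx -> measurable_fun setT q ->
  (forall t, q (mxt A t) = normsq t) ->
  exists2 c : R, (0 <= c)%R & forall f : n.-tuple mR -> \bar R,
    measurable_fun setT f -> (forall x, 0 <= f x) ->
    \int[lam n]_t (f t * (expR (- (q t / 2)))%:E) =
    c%:E * \int[gauss_tuple n]_t f (mxt A t).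
Proof.
move=> uA mq qA; have [c c0 H] := linear_change_of_variables uA.
exists (c / peak ^+ n)%R; first by rewrite divr_ge0// exprn_ge0// ltW.
move=> f mf f0; rewrite H; last 2 first.
- apply: emeasurable_funM => //; apply/measurable_EFinP.
  apply: measurableT_comp => //; apply: measurableT_comp => //.
  exact: measurable_funM.
- by move=> t; rewrite mule_ge0// lee_fin expR_ge0.
rewrite ge0_integral_gauss_tuple//; last first.
  by apply: measurableT_comp => //; exact: measurable_mxt.
have pE : (c / peak ^+ n * peak ^+ n)%R = c.
  by rewrite divfK// gt_eqF// exprn_gt0.
rewrite muleA -EFinM pE.
by under eq_integral do rewrite qA.
Qed.

(** The density depends on the norm alone, so an orthogonal map changes integrals by a constant
    factor; integrating 1 shows that the factor is 1. *)
Lemma gauss_tuple_orthogonal n (A : 'M[R]_n) (f : n.-tuple mR -> \bar R) :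
  A^T *m A = 1%:M -> measurable_fun setT f -> (forall x, 0 <= f x) ->
  \int[gauss_tuple n]_t f (mxt A t) = \int[gauss_tuple n]_t f t.
Proof.
move=> AA mf f0; have [_ uA] := mulmx1_unit AA.
have qA t : normsq (mxt A t) = normsq t.
  have E (s : n.-tuple mR) : normsq s = ((vec s)^T *m vec s) 0%R 0%R.
    by rewrite mxE; apply: eq_bigr => i _; rewrite [in RHS]mxE expr2.
  by rewrite !E unvecK trmx_mul -mulmxA (mulmxA A^T) AA mul1mx.
have [c c0 H] := gaussian_linear_image uA (@measurable_normsq n) qA.
have E g : measurable_fun setT g -> (forall x, 0 <= g x) ->
    \int[gauss_tuple n]_t g t =
    (peak ^+ n * c)%:E * \int[gauss_tuple n]_t g (mxt A t).
  by move=> mg g0; rewrite ge0_integral_gauss_tuple// H// muleA.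
have : (peak ^+ n * c)%R = 1%R.
  have := E (cst 1) (measurable_cst _) (fun=> lee01).
  rewrite !integral_cst//= probability_setT !mule1 => /esym.
  by move=> [].
by move=> e1; rewrite [RHS](E f mf f0) e1 mul1e.
Qed.

End gaussian_tuples.

(** * Moments and stability of the standard normal law *)

Section integral_of_derivative.
Variable R : realType.
Local Notation mR := (measurableTypeR R).
Local Notation mu := (@lebesgue_measure R).

Lemma integral_derivative_eq0 (H h : R -> R) :
  (forall x : R, is_derive x 1 H (h x)) -> continuous h ->
  mu.-integrable setT (EFin \o h) ->
  (fun n => H n%:R - H (- n%:R)) @ \oo --> (0 : R) ->
  (\int[mu]_x (h x)%:E = 0)%E.
Proof.
move=> dH ch ih H0.
have cH := is_derive_continuous dH.
pose h' : mR -> \bar R := EFin \o h.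
pose f_ n : mR -> \bar R := h' \_ `[- n%:R, n%:R]%classic.
have mh : measurable_fun setT h' := measurable_int mu ih.
have mf_ n : measurable_fun setT (f_ n).
  by apply/(measurable_restrictT _ _).1 => //; exact: measurable_funTS.
have cvf : {ae mu, forall x, setT x -> f_ ^~ x @ \oo --> h' x}.
  apply: aeW => x _; apply: (@cvg_near_cst _ _ _ _ \oo).
  near=> n; rewrite /f_ patchE mem_set// /= in_itv/= -ler_norml.
  by near: n; exact: nbhs_infty_ger.
have dom : {ae mu, forall x n, setT x -> (`|f_ n x| <= (abse \o h') x)%E}.
  apply: aeW => x n _; rewrite /f_ patchE; case: ifPn => _ //=.
  by rewrite normr0 lee_fin.
have iabs : mu.-integrable setT (abse \o h').
  exact: (integrable_norm ih).
have [_ _ cvg1] := dominated_convergence measurableT mf_ mh cvf iabs dom.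
(* The index is shifted because the interval is degenerate at [n = 0]. *)
have E n : (\int[mu]_x f_ n.+1 x)%E = (H n.+1%:R - H (- n.+1%:R))%:E.
  rewrite -integral_mkcond.
  rewrite (@continuous_FTC2 _ h H)//.
  - by rewrite -subr_gt0 opprK addr_gt0.
  - exact: continuous_subspaceT.
  - split.
    + by move=> x _; case: (dH x).
    + exact/cvg_at_right_filter/cH.
    + exact/cvg_at_left_filter/cH.
  - by move=> x _; rewrite derive1E; case: (dH x).
have cvg2 : (fun n => \int[mu]_x f_ n.+1 x)%E @ \oo --> (0 : R)%:E.
  under eq_fun do rewrite E.
  apply: cvg_EFin; first exact: nearW.
  by move: H0; rewrite -cvg_shiftS.
have cvg3 : (fun n => \int[mu]_x f_ n.+1 x)%E @ \oo --> (\int[mu]_x (h x)%:E)%E.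
  by move: cvg1; rewrite -cvg_shiftS.
exact: (cvg_unique _ cvg3 cvg2).
Unshelve. all: by end_near. Qed.

End integral_of_derivative.

Lemma integral_density d (T : measurableType d) (R : realType)
  (mu nu : {measure set T -> \bar R}) (h f : T -> R) :
  measurable_fun setT h -> (forall x, 0 <= h x) ->
  (forall A, measurable A -> nu A = \int[mu]_(x in A) (h x)%:E)%E ->
  nu.-integrable setT (EFin \o f) ->
  mu.-integrable setT (fun x => (f x * h x)%:E) /\
  (\int[nu]_x (f x)%:E = \int[mu]_x (f x * h x)%:E)%E.
Proof.
move=> mh h0 nuE fi; have mf : measurable_fun setT (EFin \o f) := measurable_int nu fi.
have D := ge0_integral_density mh h0 nuE.
have mh' : measurable_fun setT (EFin \o h) by exact/measurable_EFinP.
have I g : measurable_fun setT g -> (forall x, 0 <= g x)%E ->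
    nu.-integrable setT g -> mu.-integrable setT (fun x => g x * (h x)%:E)%E.
  move=> mg g0 /integrableP[_ gi]; apply/integrableP; split.
    exact: emeasurable_funM.
  under eq_integral do rewrite gee0_abs ?mule_ge0 ?lee_fin//.
  rewrite -D//; move: gi; under eq_integral do rewrite gee0_abs//.
  by [].
have mp := measurable_funepos mf; have mn := measurable_funeneg mf.
have ip := I _ mp (fun=> funepos_ge0 _ _) (integrable_funepos measurableT fi).
have im := I _ mn (fun=> funeneg_ge0 _ _) (integrable_funeneg measurableT fi).
have E x : ((f x * h x)%:E = (EFin \o f)^\+ x * (h x)%:E - (EFin \o f)^\- x * (h x)%:E)%E.
  rewrite funeposE funenegE /= -!EFin_max -!EFinM -EFinB -mulrBl.
  congr (_ * _)%:E; rewrite /Order.max.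
  by have [fx0|fx0] := ltP (f x) 0; have [nfx0|nfx0] := ltP (- f x) 0; lra.
split.
  under eq_fun do rewrite E.
  exact: (integrableB measurableT ip im).
under [RHS]eq_integral do rewrite E.
by rewrite integralB// [LHS]integralE !D.
Qed.

Section gaussian_moments.
Variable R : realType.
Local Notation mR := (measurableTypeR R).
Local Notation mu := (@lebesgue_measure R).
Local Notation gam := (stdnormal R).

Let e (x : R) := expR (- (x ^+ 2 / 2)).
Let peak : R := normal_peak 1.
Let peak_gt0 : 0 < peak. Proof. by rewrite normal_peak_gt0. Qed.

Let pdfE : normal_pdf 0 1 = (fun x => peak * e x) :> (R -> R).
Proof.
apply/funext => x; rewrite normal_pdfE ?oner_neq0// /normal_fun subr0.
by rewrite expr1n mulNr.
Qed.

(** A single term of the exponential series at [x ^+ 2 / 4]. *)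
Lemma even_power_le_expR m (x : R) : x ^+ (m.+1).*2 <= 4 ^+ m.+1 * (m.+1)`!%:R * expR (x ^+ 2 / 4).
Proof.
have y0 : 0 <= x ^+ 2 / 4 by rewrite divr_ge0 ?sqr_ge0.
have : (x ^+ 2 / 4) ^+ m.+1 / (m.+1)`!%:R <= expR (x ^+ 2 / 4).
  by apply: le_trans (expR_ge1Dxn m y0); rewrite lerDr.
rewrite ler_pdivrMr ?ltr0n ?fact_gt0// expr_div_n ler_pdivrMr ?exprn_gt0//.
by rewrite -exprM mul2n -mulrA mulrC [X in X * _]mulrC.
Qed.

Lemma power_le_expR k : exists2 C, 0 <= C & forall x : R,
  `|x| ^+ k <= C * expR (x ^+ 2 / 4).
Proof.
pose C : R := 4 ^+ k.+1 * (k.+1)`!%:R.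
exists (1 + C); first by rewrite addr_ge0// mulr_ge0// exprn_ge0.
move=> x; apply: (@le_trans _ _ (1 + x ^+ (k.+1).*2)).
  have xE : x ^+ (k.+1).*2 = `|x| ^+ (k.+1).*2.
    by rewrite -mul2n exprM -[x ^+ 2]real_normK ?num_real// -exprM.
  rewrite xE; have [x1|x1] := leP `|x| 1.
    by rewrite (le_trans (exprn_ile1 _ _ x1))// lerDl exprn_ge0.
  rewrite (@le_trans _ _ (`|x| ^+ (k.+1).*2))// ?lerDr// ler_weXn2l// ?ltW//.
  by rewrite -addnn (leq_trans (leqnSn k))// leq_addr.
rewrite mulrDl mul1r lerD ?even_power_le_expR//.
by rewrite -[leLHS]expR0 ler_expR divr_ge0 ?sqr_ge0.
Qed.

(** Half of the Gaussian decay absorbs the power. The other half is, up to a factor, the normal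
    density of variance 2, whence the integrability of all powers. *)
Lemma power_mul_gauss_le k : exists2 C, 0 <= C & forall x : R,
  `|x| ^+ k * e x <= C * expR (- (x ^+ 2 / 4)).
Proof.
have [C C0 CE] := power_le_expR k; exists C => // x.
have -> : expR (- (x ^+ 2 / 4)) = expR (x ^+ 2 / 4) * e x.
  by rewrite -expRD; congr expR; field.
by rewrite mulrA ler_wpM2r ?expR_ge0.
Qed.

Lemma stdnormal_integrable_power k :
  gam.-integrable setT (fun x => (x ^+ k)%:E).
Proof.
have mX : measurable_fun setT (fun x : mR => x ^+ k).
  by apply: measurable_funX; exact: measurable_id.
have mX' : measurable_fun setT (fun x : mR => (`|x ^+ k|)%:E).
  by apply/measurable_EFinP; exact: measurableT_comp.
apply/integrableP; split; first exact/measurable_EFinP.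
rewrite /= ge0_integral_stdnormal//.
have [C C0 CE] := power_mul_gauss_le k.
have s0 : Num.sqrt 2 != 0 :> R by rewrite gt_eqF// sqrtr_gt0.
pose D := peak * C / normal_peak (Num.sqrt 2) : R.
have p2 : 0 < normal_peak (Num.sqrt 2 : R) by rewrite normal_peak_gt0.
apply: (@le_lt_trans _ _ (\int[mu]_x (D * normal_pdf 0 (Num.sqrt 2) x)%:E)%E).
  apply: ge0_le_integral => //.
  - by move=> x _; rewrite mule_ge0 ?lee_fin// mulr_ge0 ?expR_ge0// ltW.
  - apply: emeasurable_funM => //; apply/measurable_EFinP.
    by have := @measurable_normal_pdf R 0 1; rewrite pdfE.
  - by apply/measurable_EFinP; apply: measurable_funM => //; exact: measurable_normal_pdf.
  - move=> x _; rewrite -EFinM lee_fin normal_pdfE// /normal_fun subr0 sqr_sqrtr//.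
    rewrite /D [leRHS]mulrA divfK ?gt_eqF// mulrCA -mulrA ler_wpM2l ?(ltW peak_gt0)//.
    rewrite normrX (le_trans (CE x))// ler_wpM2l// mulNr.
    by rewrite -mulrnA.
under eq_integral do rewrite EFinM.
rewrite integralZl//; last exact: integrable_normal_pdf.
by rewrite integral_normal_pdf mule1 ltry.
Qed.

Lemma is_derive_power_gauss k (x : R) :
  is_derive x 1 (fun x : R => x ^+ k * e x) ((k%:R * x ^+ k.-1 - x ^+ k.+1) * e x).
Proof.
have di : is_derive x 1 (id : R -> R) 1 by exact: is_derive_id.
have dk : is_derive x 1 (fun y : R => y ^+ k) (k%:R * x ^+ k.-1).
  have := is_deriveX k di; rewrite /GRing.scale/= mulr1.
  by congr is_derive; apply/funext => y; rewrite exprfctE.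
have dq : is_derive x 1 (fun y : R => - (y ^+ 2 / 2)) (- x).
  have := is_deriveN (is_deriveZ 2^-1 (is_deriveM di di)).
  rewrite /GRing.scale/= mulr1 -mulr2n -[x *+ 2]mulr_natl mulKf ?pnatr_eq0//.
  congr is_derive; apply/funext => y; rewrite !fctE.
  by rewrite expr2 [X in - X = _](mulrC 2^-1).
have de : is_derive x 1 e (e x * - x).
  exact: (is_derive1_comp (is_derive_expR _) dq).
have := is_deriveM dk de; rewrite /GRing.scale/=; congr is_derive.
by rewrite exprSr; ring.
Qed.

Lemma power_gauss_cvg0 k (s : nat -> R) : (forall n, `|s n| = n%:R) ->
  (fun n => s n ^+ k * e (s n)) @ \oo --> (0 : R).
Proof.
(* One spare power of |s n|, which is n, gives the rate C / n. *)
move=> sn; have [C C0 CE] := power_mul_gauss_le k.+1.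
have H n : `|s n.+1 ^+ k * e (s n.+1)| <= C * n.+1%:R^-1.
  rewrite normrM normrX (ger0_norm (expR_ge0 _)) ler_pdivlMr ?ltr0n//.
  rewrite mulrAC -(sn n.+1) -exprSr (le_trans (CE _))// ler_piMr//.
  by rewrite -[leRHS]expR0 ler_expR oppr_le0 divr_ge0 ?sqr_ge0.
rewrite -cvg_shiftS; apply/norm_cvg0P.
apply: (squeeze_cvgr (f := fun=> 0) (h := fun n => C * n.+1%:R^-1)).
- by apply: nearW => n; rewrite normr_ge0/= H.
- exact: cvg_cst.
- rewrite -(mulr0 C); apply: cvgMr => //; exact: cvg_harmonic.
Qed.

(** Stein's identity E [f' - x f] = 0 for f = x^k: against the density, the integrand is the
    derivative of a function that vanishes at infinity. At [k = 0] the truncated [k.-1] is harmless,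
    its coefficient being 0. *)
Lemma stdnormal_stein k :
  (\int[gam]_x (k%:R * x ^+ k.-1 - x ^+ k.+1) = 0).
Proof.
have fi : gam.-integrable setT (EFin \o (fun x => k%:R * x ^+ k.-1 - x ^+ k.+1)).
  have i1 : gam.-integrable setT (fun x => (k%:R * x ^+ k.-1)%:E).
    exact: (integrableZl measurableT k%:R (stdnormal_integrable_power k.-1)).
  exact: (integrableB measurableT i1 (stdnormal_integrable_power k.+1)).
have [||| ih D] := @integral_density _ mR R mu gam (normal_pdf 0 1) _ _ _ _ fi.
- exact: measurable_normal_pdf.
- by move=> x; exact: normal_pdf_ge0.
- by [].
rewrite /Rintegral D pdfE.
have -> : (fun x => ((k%:R * x ^+ k.-1 - x ^+ k.+1) * (peak * e x))%:E) =
  (fun x => (peak * ((k%:R * x ^+ k.-1 - x ^+ k.+1) * e x))%:E).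
  by apply/funext => x; congr EFin; ring.
have dH (x : R) : is_derive x 1 (fun x : R => peak * (x ^+ k * e x))
    (peak * ((k%:R * x ^+ k.-1 - x ^+ k.+1) * e x)).
  by apply: is_deriveZ; exact: is_derive_power_gauss.
rewrite (@integral_derivative_eq0 R _ _ dH)//.
- have cP j : continuous (fun x : R => x ^+ j * e x).
    exact: is_derive_continuous (is_derive_power_gauss j).
  have -> : (fun x => peak * ((k%:R * x ^+ k.-1 - x ^+ k.+1) * e x)) =
      (fun x => peak * (k%:R * (x ^+ k.-1 * e x) - x ^+ k.+1 * e x)).
    by apply/funext => x; ring.
  move=> x; apply: cvgM; first exact: cvg_cst.
  apply: (@cvgB _ R^o); last exact: cP.
  by apply: cvgM; [exact: cvg_cst|exact: cP].
- move: ih; rewrite pdfE; congr (_.-integrable _ _).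
  by apply/funext => x /=; congr EFin; ring.
- rewrite -[X in _ --> X](subr0 0) -{1 2}(mulr0 peak); apply: cvgB.
    apply: cvgMr => //; apply: power_gauss_cvg0 => n.
    by rewrite ger0_norm.
  apply: cvgMr => //; apply: power_gauss_cvg0 => n.
  by rewrite normrN ger0_norm.
Qed.

End gaussian_moments.

Section stdnormal_laws.
Variable R : realType.
Local Notation mR := (measurableTypeR R).
Local Notation gam := (stdnormal R).

Lemma ge0_integral_gauss_tuple0 (f : 0.-tuple mR -> \bar R) :
  measurable_fun setT f -> (forall x, 0 <= f x)%E ->
  (\int[gauss_tuple R 0]_t f t = f [tuple])%E.
Proof.
move=> mf f0; rewrite ge0_integral_gauss_tuple// expr0 mul1e.
rewrite ge0_integral_lebesgue_tuple0; last first.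
  by move=> x; rewrite mule_ge0// lee_fin expR_ge0.
by rewrite /normsq big_ord0 mul0r oppr0 expR0 mule1.
Qed.

Let rotation (a b : R) : 'M[R]_2 := \matrix_(i < 2, j < 2)
  if i == 0 then (if j == 0 then a else b) else (if j == 0 then - b else a).

(** [a * x + b * y] is the first coordinate of the pair after a rotation, which preserves the
    Gaussian. *)
Lemma stdnormal_rotation (a b : R) (F : R -> \bar R) : a ^+ 2 + b ^+ 2 = 1 ->
  measurable_fun setT (F : mR -> \bar R) -> (forall x, 0 <= F x)%E ->
  (\int[gam]_x \int[gam]_y F (a * x + b * y)%R = \int[gam]_x F x)%E.
Proof.
move=> ab mF F0.
have rot : (rotation a b)^T *m rotation a b = 1%:M.
  apply/matrixP => i j; rewrite !mxE big_ord_recl big_ord1 !mxE/=.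
  by case: (unliftP ord0 i) => [i'|] ->; case: (unliftP ord0 j) => [j'|] ->;
    rewrite ?ord1/= -?ab; ring.
pose G (t : 2.-tuple mR) := F (vec t 0 0).
have mG : measurable_fun setT G.
  by apply: (measurableT_comp mF); apply: measurable_vec; exact: measurable_id.
have twice (H : 2.-tuple mR -> \bar R) : measurable_fun setT H ->
    (forall x, 0 <= H x)%E -> (\int[gauss_tuple R 2]_t H t =
      \int[gam]_x \int[gam]_y H [tuple of x :: [tuple of y :: [tuple]]])%E.
  move=> mH H0; rewrite ge0_integral_gauss_tupleS//; apply: eq_integral => x _.
  have mHx : measurable_fun setT (fun t : 1.-tuple mR => H [tuple of x :: t]).
    exact: (measurableT_comp mH (measurable_cons_section x)).
  rewrite ge0_integral_gauss_tupleS//; apply: eq_integral => y _.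
  rewrite ge0_integral_gauss_tuple0//.
  exact: (measurableT_comp mHx (measurable_cons_section y)).
have := gauss_tuple_orthogonal rot mG (fun=> F0 _).
have mGA : measurable_fun setT (fun t => G (mxt (rotation a b) t)).
  by apply: (measurableT_comp mG); exact: measurable_mxt.
rewrite (twice _ mGA (fun=> F0 _)) (twice _ mG (fun=> F0 _)).
have E1 (x y : mR) : vec [tuple of x :: [tuple of y :: [tuple]]] 0 0 = x by rewrite mxE tnth0.
have E2 (x y : mR) : vec (mxt (rotation a b) [tuple of x :: [tuple of y :: [tuple]]]) 0 0
    = a * (x : R) + b * (y : R).
  by rewrite unvecK mxE big_ord_recl big_ord1 !mxE/= tnth0 tnthS tnth0.
under eq_integral do under eq_integral do rewrite /G E2.
move=> ->; apply: eq_integral => x _.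
under eq_integral do rewrite /G E1.
by rewrite integral_cst//= probability_setT mule1.
Qed.

(** Divided by [r], the coefficients become a cosine and a sine, and rotation invariance applies. As
    [f] may change sign whereas the rotation lemma is for nonnegative functions, the two image
    measures are first shown to agree on sets. *)
Lemma stdnormal_stable : gauss_stable gam.
Proof.
move=> f C mf fC s t.
set r := Num.sqrt _.
have [r0|r0] := eqVneq (s ^+ 2 + t ^+ 2) 0.
  have /andP[/eqP s0 /eqP t0] : (s == 0) && (t == 0).
    by move/eqP: r0; rewrite paddr_eq0 ?sqr_ge0// !expf_eq0.
  rewrite /r s0 t0 expr0n addr0 sqrtr0.
  under eq_Rintegral do under eq_Rintegral do rewrite !mul0r addr0.
  under [RHS]eq_Rintegral do rewrite mul0r.
  by rewrite !Rintegral_cst_prob.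
have rgt0 : 0 < r.
  by rewrite sqrtr_gt0 lt_neqAle eq_sym r0 addr_ge0 ?sqr_ge0.
have rr : r ^+ 2 = s ^+ 2 + t ^+ 2 by rewrite sqr_sqrtr// addr_ge0 ?sqr_ge0.
have ab : (s / r) ^+ 2 + (t / r) ^+ 2 = 1.
  by rewrite !expr_div_n -mulrDl rr divff.
pose l (z : mR * mR) : mR := s * (z.1 : R) + t * (z.2 : R).
have ml : measurable_fun setT l.
  by apply: measurable_funD; apply: measurable_funM.
pose rm (z : mR) : mR := r * (z : R).
have mrm : measurable_fun setT rm by exact: measurable_funM.
have mfl : measurable_fun setT (f \o l) by exact: measurableT_comp.
have mfr : measurable_fun setT (f \o rm) by exact: measurableT_comp.
have := @Rintegral_prod _ _ _ _ _ gam gam (f \o l) C mfl (fun=> fC _).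
move=> /= <-; rewrite /Rintegral; congr fine.
have il : (gam \x gam)%E.-integrable setT (EFin \o f \o l).
  exact: (@bounded_integrable _ _ _ (gam \x gam)%E (f \o l) C mfl (fun=> fC _)).
have ir : gam.-integrable setT (EFin \o f \o rm).
  exact: (@bounded_integrable _ _ _ gam (f \o rm) C mfr (fun=> fC _)).
have mEf : measurable_fun setT (EFin \o f : mR -> _) by exact/measurable_EFinP.
pose nu1 : {measure set mR -> \bar R} := pushforward (gam \x gam)%E l.
pose nu2 : {measure set mR -> \bar R} := pushforward gam rm.
transitivity (\int[nu1 ml]_x (f x)%:E)%E.
  by rewrite (integral_pushforward ml mEf il).
transitivity (\int[nu2 mrm]_x (f x)%:E)%E; last first.
  by rewrite (integral_pushforward mrm mEf ir).
apply: eq_measure_integral => A mA _.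
have mI : measurable_fun setT ((fun x => (\1_A x)%:E) : mR -> \bar R).
  by apply/measurable_EFinP; exact: measurable_indic.
have mIr : measurable_fun setT ((fun x => (\1_A (r * x))%:E) : mR -> \bar R).
  exact: (measurableT_comp mI mrm).
have Ige0 (x : R) : (0 <= (\1_A x)%:E :> \bar R)%E by rewrite lee_fin.
have := stdnormal_rotation ab mIr (fun=> Ige0 _).
have E x y : r * (s / r * x + t / r * y) = s * x + t * y.
  by field; exact: lt0r_neq0.
under eq_integral do under eq_integral do rewrite E.
rewrite -(fubini_tonelli1 (m1 := gam) (m2 := gam) (fun z => (\1_A (l z))%:E))//; last first.
  exact: (measurableT_comp mI ml).
have pre d (T : measurableType d) (P : probability T R) (h : T -> mR) :
    measurable_fun setT h -> (\int[P]_x (\1_A (h x))%:E)%E = P (h @^-1` A).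
  move=> mh; rewrite -[h @^-1` A]setIT -integral_indic//.
  by rewrite -[X in measurable X]setTI; exact: mh.
by rewrite (pre _ _ _ _ ml) (pre _ _ _ _ mrm).
Qed.

Lemma stdnormal_moments : moments gam 0 1.
Proof.
have i1 := stdnormal_integrable_power R 1; have i2 := stdnormal_integrable_power R 2.
have M0 : \int[gam]_x (x ^+ 0) = 1.
  by under eq_Rintegral do rewrite expr0; rewrite Rintegral_cst_prob.
have M1 : \int[gam]_x (x ^+ 1) = 0.
  have := stdnormal_stein R 0.
  under eq_Rintegral do rewrite mul0r sub0r -mulN1r.
  by rewrite RintegralZl// mulN1r => /eqP; rewrite oppr_eq0 => /eqP.
have M2 : \int[gam]_x (x ^+ 2) = 1.
  have := stdnormal_stein R 1.
  under eq_Rintegral do rewrite mul1r.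
  rewrite RintegralB//; last exact: stdnormal_integrable_power.
  by rewrite M0 => /eqP; rewrite subr_eq0 => /eqP.
split.
- by under eq_fun do rewrite subr0; exact: i1.
- by under eq_fun do rewrite subr0; exact: i2.
- by under eq_Rintegral do rewrite subr0; exact: M1.
- by under eq_Rintegral do rewrite subr0; exact: M2.
Qed.

Lemma stdnormal_third_moment :
  third_moment_le gam 0 (\int[gam]_x (`|x| ^+ 3)).
Proof.
have i3 : gam.-integrable setT (fun x => (`|x| ^+ 3)%:E).
  have := integrable_norm (stdnormal_integrable_power R 3).
  by congr (_.-integrable _ _); apply/funext => x /=; rewrite normrX.
split; first by under eq_fun do rewrite subr0; exact: i3.
by under eq_Rintegral do rewrite subr0; exact: lexx.
Qed.

Definition gmoment k : R := \int[gam]_x (x ^+ k).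

Lemma gmoment_stein k : gmoment k.+2 = k.+1%:R * gmoment k.
Proof.
have := stdnormal_stein R k.+1.
rewrite RintegralB//; last 2 first.
- exact: (integrableZl measurableT k.+1%:R (stdnormal_integrable_power R k)).
- exact: stdnormal_integrable_power.
rewrite RintegralZl//; last exact: (stdnormal_integrable_power R k).
by move=> /eqP; rewrite subr_eq0 => /eqP.
Qed.

Lemma gmoment0 : gmoment 0 = 1.
Proof.
by rewrite /gmoment; under eq_Rintegral do rewrite expr0; rewrite Rintegral_cst_prob.
Qed.

Lemma gmoment1 : gmoment 1 = 0.
Proof.
have [_ _ + _] := stdnormal_moments.
by under eq_Rintegral do rewrite subr0.
Qed.

Lemma monomial_stdnormal2 i j :
  (gam \x gam)%E.-integrable setT (fun z => (z.1 ^+ i * z.2 ^+ j)%:E) /\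
  \int[(gam \x gam)%E]_z (z.1 ^+ i * z.2 ^+ j) = gmoment i * gmoment j.
Proof.
have ip k := stdnormal_integrable_power R k.
have mf : measurable_fun setT (fun z : mR * mR => (z.1 ^+ i * z.2 ^+ j)%:E).
  apply/measurable_EFinP; apply: measurable_funM; apply: measurable_funX.
    exact: measurable_fst.
  exact: measurable_snd.
have nE k : gam.-integrable setT (fun x => (`|x ^+ k|)%:E).
  exact: (integrable_norm (ip k)).
have int : (gam \x gam)%E.-integrable setT (fun z => (z.1 ^+ i * z.2 ^+ j)%:E).
  apply/(integrable12ltyP gam gam mf).
  have -> : (\int[gam]_x \int[gam]_y `|(x ^+ i * y ^+ j)%:E| =
      \int[gam]_x ((`|x ^+ i|)%:E * \int[gam]_y (`|y ^+ j|)%:E))%E.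
    apply: eq_integral => x _; rewrite -integralZl//.
    by apply: eq_integral => y _; rewrite -EFinM -normrM.
  have K : (\int[gam]_y (`|y ^+ j|)%:E)%E \is a fin_num by exact: integrable_fin_num.
  rewrite -(fineK K); under eq_integral do rewrite muleC.
  rewrite integralZl// ltey_eq fin_numM//.
  exact: integrable_fin_num.
split => //; rewrite /Rintegral -integral12_prod_meas1//.
rewrite /fubini_F/=.
have -> : (\int[gam]_x \int[gam]_y (x ^+ i * y ^+ j)%:E =
    \int[gam]_x (gmoment j * x ^+ i)%:E)%E.
  apply: eq_integral => x _; under eq_integral do rewrite EFinM.
  rewrite integralZl// EFinM muleC; congr (_ * _)%E.
  by rewrite /gmoment /Rintegral fineK//; exact: integrable_fin_num.
rewrite [RHS]mulrC.
exact: (RintegralZl (gmoment j) measurableT (ip i)).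
Qed.

(** A polynomial is a list of monomials (coefficient and two exponents), so that integrability and
    expectation follow by linearity for all polynomials at once and concrete moments reduce to
    [ring]. *)
Definition poly2_eval (p : seq (R * nat * nat)) (z : R * R) : R :=
  \sum_(m <- p) m.1.1 * (z.1 ^+ m.1.2 * z.2 ^+ m.2).

Lemma poly2_stdnormal p :
  (gam \x gam)%E.-integrable setT (fun z => (poly2_eval p z)%:E) /\
  \int[(gam \x gam)%E]_z poly2_eval p z =
    \sum_(m <- p) m.1.1 * (gmoment m.1.2 * gmoment m.2).
Proof.
rewrite /poly2_eval; elim: p => [|[[c i] j] p [IH1 IH2]].
  under eq_fun do rewrite big_nil.
  under eq_Rintegral do rewrite big_nil.
  rewrite big_nil Rintegral_cst_prob; split => //.
  exact: integrable0.
have [m1 m2] := monomial_stdnormal2 i j.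
under eq_fun do rewrite big_cons/=.
under eq_Rintegral do rewrite big_cons/=.
have m1c : (gam \x gam)%E.-integrable setT (fun z => (c * (z.1 ^+ i * z.2 ^+ j))%:E).
  exact: (integrableZl measurableT c m1).
split; first exact: (integrableD measurableT m1c IH1).
rewrite RintegralD// big_cons/= IH2 RintegralZl// m2.
by [].
Qed.

End stdnormal_laws.

(** * Quadratic forms in two standard normal variables *)

Lemma distribution_integral d d' (T : measurableType d) (T' : measurableType d')
    (R : realType) (P : probability T R) (X : {mfun T >-> T'}) (f : T' -> R) :
  measurable_fun setT f -> P.-integrable setT (EFin \o (f \o X)) ->
  (distribution P X).-integrable setT (EFin \o f) /\
  \int[distribution P X]_y f y = \int[P]_x f (X x).
Proof.
move=> mf fi.
have mEf : measurable_fun setT (EFin \o f) by exact/measurable_EFinP.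
split; last by rewrite /Rintegral integral_distribution.
apply/integrableP; split => //.
rewrite ge0_integral_distribution//; last exact: measurableT_comp.
by have /integrableP[] := fi.
Qed.

Section quadratic_laws.
Variable R : realType.
Local Notation mR := (measurableTypeR R).
Local Notation gam := (stdnormal R).
Local Notation gam2 := (gam \x gam)%E.
Implicit Types c : R * R * R.

Definition quad c (z : mR * mR) : mR :=
  c.1.1 * (z.1 : R) ^+ 2 + c.1.2 * (z.2 : R) ^+ 2 + c.2 * ((z.1 : R) * (z.2 : R)).

Definition qmean c : R := c.1.1 + c.1.2.
Definition qvar c : R := 2 * c.1.1 ^+ 2 + 2 * c.1.2 ^+ 2 + c.2 ^+ 2.

Lemma measurable_quad c : measurable_fun setT (quad c).
Proof.
apply: measurable_funD; last by apply: measurable_funM => //; exact: measurable_funM.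
by apply: measurable_funD; apply: measurable_funM => //; exact: measurable_funX.
Qed.

HB.instance Definition _ c := isMeasurableFun.Build _ _ _ _ (quad c) (measurable_quad c).

Definition qlaw c : probability mR R := distribution gam2 (quad c).

Let gm2 : gmoment R 2 = 1. Proof. by rewrite gmoment_stein gmoment0 mulr1. Qed.
Let gm3 : gmoment R 3 = 0. Proof. by rewrite gmoment_stein gmoment1 mulr0. Qed.
Let gm4 : gmoment R 4 = 3. Proof. by rewrite gmoment_stein gm2 mulr1. Qed.

Let qpoly1 c : seq (R * nat * nat) :=
  [:: (c.1.1, 2%N, 0%N); (c.1.2, 0%N, 2%N); (c.2, 1%N, 1%N); (- qmean c, 0%N, 0%N)].

Let qpoly1E c z : quad c z - qmean c = poly2_eval (qpoly1 c) z.
Proof.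
rewrite /poly2_eval /qpoly1 !big_cons big_nil /= /quad !expr0 !expr1; ring.
Qed.

(** The monomials of (a (x^2 - 1) + g (y^2 - 1) + k x y)^2, like terms not being collected. *)
Let qpoly2 c : seq (R * nat * nat) :=
  let: (a, g, k) := c in
  [:: (a ^+ 2, 4%N, 0%N); (- 2 * a ^+ 2, 2%N, 0%N); (a ^+ 2, 0%N, 0%N);
      (g ^+ 2, 0%N, 4%N); (- 2 * g ^+ 2, 0%N, 2%N); (g ^+ 2, 0%N, 0%N);
      (k ^+ 2, 2%N, 2%N);
      (2 * a * g, 2%N, 2%N); (- 2 * a * g, 2%N, 0%N); (- 2 * a * g, 0%N, 2%N); (2 * a * g, 0%N, 0%N);
      (2 * a * k, 3%N, 1%N); (- 2 * a * k, 1%N, 1%N);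
      (2 * g * k, 1%N, 3%N); (- 2 * g * k, 1%N, 1%N)].

Let qpoly2E c z : (quad c z - qmean c) ^+ 2 = poly2_eval (qpoly2 c) z.
Proof.
case: c => [[a g] k]; rewrite /poly2_eval /qpoly2 !big_cons big_nil /=.
rewrite /quad /qmean/= !expr0 !expr1; ring.
Qed.

(** For independent standard normal x and y, the squares have variance 2, the product has variance
    1, and the three are uncorrelated. *)
Lemma moments_qlaw c : moments (qlaw c) (qmean c) (qvar c).
Proof.
have [i1 e1] := poly2_stdnormal (qpoly1 c).
have [i2 e2] := poly2_stdnormal (qpoly2 c).
have m1 : measurable_fun setT (fun y : mR => (y : R) - qmean c).
  exact: measurable_funD.
have m2 : measurable_fun setT (fun y : mR => ((y : R) - qmean c) ^+ 2).
  exact: measurable_funX.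
have [|j1 f1] := @distribution_integral _ _ _ _ _ gam2 (quad c) _ m1.
  by move: i1; congr (_.-integrable _ _); apply/funext => z /=; rewrite -qpoly1E.
have [|j2 f2] := @distribution_integral _ _ _ _ _ gam2 (quad c) _ m2.
  by move: i2; congr (_.-integrable _ _); apply/funext => z /=; rewrite -qpoly2E.
split => //.
- rewrite f1; under eq_Rintegral do rewrite qpoly1E.
  rewrite e1 /qpoly1 !big_cons big_nil/= gm2 gmoment0 gmoment1 /qmean; ring.
- rewrite f2; under eq_Rintegral do rewrite qpoly2E.
  rewrite e2; case: c {m1 m2 i1 e1 i2 e2 j1 f1 j2 f2} => [[a g] k].
  rewrite /qpoly2 !big_cons big_nil/= gm4 gm3 gm2 gmoment0 gmoment1 /qvar/=; ring.
Qed.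

Let cube_poly : seq (R * nat * nat) :=
  [:: (1, 0%N, 0%N); (3, 2%N, 0%N); (3, 0%N, 2%N); (3, 4%N, 0%N); (6, 2%N, 2%N); (3, 0%N, 4%N);
      (1, 6%N, 0%N); (3, 4%N, 2%N); (3, 2%N, 4%N); (1, 0%N, 6%N)].

Let cube_polyE z : (1 + z.1 ^+ 2 + z.2 ^+ 2) ^+ 3 = poly2_eval cube_poly z.
Proof. by rewrite /poly2_eval /cube_poly !big_cons big_nil /= !expr0; ring. Qed.

(** The sum of the absolute coefficients bounds the centred form, and by Cauchy-Schwarz its square
    is at most three times the sum of their squares, itself at most [qvar c]. *)
Lemma quad_center_le c z : `|quad c z - qmean c| <=
  Num.sqrt (3 * qvar c) * (1 + z.1 ^+ 2 + z.2 ^+ 2).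
Proof.
case: c => [[a g] k]; case: z => [s t]; rewrite /quad /qmean /qvar/=.
apply: (@le_trans _ _ ((`|a| + `|g| + `|k|) * (1 + s ^+ 2 + t ^+ 2))).
  have -> : a * s ^+ 2 + g * t ^+ 2 + k * (s * t) - (a + g) =
    a * (s ^+ 2 - 1) + g * (t ^+ 2 - 1) + k * (s * t) by ring.
  rewrite (le_trans (ler_normD _ _))// [leRHS]mulrDl.
  have H (u : R) : `|u ^+ 2 - 1| <= 1 + u ^+ 2.
    by rewrite (le_trans (ler_normB _ _))// normr1 normrX real_normK ?num_real// addrC.
  apply: lerD.
    rewrite (le_trans (ler_normD _ _))// mulrDl !normrM lerD// ler_wpM2l//.
      by rewrite (le_trans (H s))// lerDl sqr_ge0.
    by rewrite (le_trans (H t))// lerD2r lerDl sqr_ge0.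
  rewrite !normrM ler_wpM2l//.
  have := sqr_ge0 (`|s| - `|t|); rewrite -(real_normK (num_real s)) -(real_normK (num_real t)).
  have := normr_ge0 s; have := normr_ge0 t; nra.
apply: ler_wpM2r; first by rewrite !addr_ge0 ?sqr_ge0.
rewrite -(ler_pXn2r (n := 2)) ?nnegrE ?sqrtr_ge0 ?addr_ge0//.
rewrite sqr_sqrtr; last first.
  by have := sqr_ge0 a; have := sqr_ge0 g; have := sqr_ge0 k; lra.
rewrite -(real_normK (num_real a)) -(real_normK (num_real g)) -(real_normK (num_real k)).
have := sqr_ge0 (`|a| - `|g|); have := sqr_ge0 (`|a| - `|k|).
have := sqr_ge0 (`|g| - `|k|); have := sqr_ge0 `|a|; have := sqr_ge0 `|g|; nra.
Qed.

(** [C] is uniform in [c] because the bound of [quad_center_le] is the standard deviation times a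
    fixed polynomial. This uniformity leaves the time step free in the limit theorem. *)
Lemma third_moment_qlaw : exists2 C, 0 <= C & forall c,
  third_moment_le (qlaw c) (qmean c) (C * Num.sqrt (qvar c) ^+ 3).
Proof.
have [i3 e3] := poly2_stdnormal cube_poly.
pose I := \int[gam2]_z poly2_eval cube_poly z.
exists (Num.sqrt 3 ^+ 3 * I).
  rewrite mulr_ge0 ?exprn_ge0//; apply: Rintegral_ge0 => z _.
  by rewrite -cube_polyE exprn_ge0// !addr_ge0 ?sqr_ge0.
move=> c; set A := Num.sqrt (3 * qvar c).
have AE : A ^+ 3 = Num.sqrt 3 ^+ 3 * Num.sqrt (qvar c) ^+ 3.
  by rewrite /A sqrtrM// exprMn.
have mq : measurable_fun setT (fun z => `|quad c z - qmean c| ^+ 3).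
  apply: measurable_funX; apply: measurableT_comp => //.
  by apply: measurable_funD => //; exact: measurable_quad.
have iA : gam2.-integrable setT (fun z => (A ^+ 3 * poly2_eval cube_poly z)%:E).
  exact: (integrableZl measurableT (A ^+ 3) i3).
have le3 z : `|quad c z - qmean c| ^+ 3 <= A ^+ 3 * poly2_eval cube_poly z.
  rewrite -cube_polyE -exprMn lerXn2r ?nnegrE ?mulr_ge0 ?sqrtr_ge0 ?quad_center_le//.
  by rewrite !addr_ge0 ?sqr_ge0.
have iq : gam2.-integrable setT (fun z => (`|quad c z - qmean c| ^+ 3)%:E).
  apply: (le_integrable measurableT _ _ iA); first exact/measurable_EFinP.
  by move=> z _ /=; rewrite lee_fin ger0_norm ?exprn_ge0// (le_trans (le3 z))// ler_norm.
have m3 : measurable_fun setT (fun y : mR => `|(y : R) - qmean c| ^+ 3).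
  by apply: measurable_funX; apply: measurableT_comp => //; exact: measurable_funD.
have [j3 f3] := @distribution_integral _ _ _ _ _ gam2 (quad c) _ m3 iq.
split => //; rewrite f3 mulrAC -AE -RintegralZl//.
apply: le_Rintegral => // z _; exact: le3.
Qed.

End quadratic_laws.

Section law_of_quadratic_sum.
Variable R : realType.
Local Notation mR := (measurableTypeR R).
Local Notation gam := (stdnormal R).
Local Notation gt n := (gauss_tuple R n).

Definition quad_sum n (c : 'I_n -> R * R * R) (xi eta : n.-tuple mR) : R :=
  \sum_(i < n) quad (c i) (vec xi i 0, vec eta i 0).

Lemma measurable_quad_sum d (T : measurableType d) n (c : 'I_n -> R * R * R)
    (xi eta : T -> n.-tuple mR) :
  measurable_fun setT xi -> measurable_fun setT eta ->
  measurable_fun setT (fun x => quad_sum c (xi x) (eta x)).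
Proof.
move=> mxi meta; apply: measurable_sum => i.
apply: (measurableT_comp (measurable_quad (c i))).
by apply/measurable_fun_pairP; split; exact: measurable_vec.
Qed.

(** The list consists of coefficients and not of mode indices, so that the single family [qlaw]
    serves for all [n] and all time steps. *)
Definition quad_laws n (c : 'I_n -> R * R * R) : probability mR R :=
  conv_list (@qlaw R) [seq c i | i <- enum 'I_n].

Lemma quad_sum_cons n (c : 'I_n.+1 -> R * R * R) (s t : mR) (xi eta : n.-tuple mR) :
  quad_sum c [tuple of s :: xi] [tuple of t :: eta] =
  quad (c ord0) (s, t) + quad_sum (fun i => c (lift ord0 i)) xi eta.
Proof.
rewrite /quad_sum big_ord_recl !mxE !tnth0; congr (_ + _).
by apply: eq_bigr => i _; rewrite !mxE !tnthS.
Qed.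

Local Open Scope ereal_scope.

(** By induction on the number of modes: the first coordinates of [xi] and [eta] carry one
    independent quadratic form. The work is to bring their two scalar integrals outside the tuple
    integrals. *)
Lemma ge0_integral_quad_sum n (c : 'I_n -> R * R * R) (F : R -> \bar R) :
  measurable_fun setT (F : mR -> \bar R) -> (forall x, 0 <= F x) ->
  \int[gt n]_xi \int[gt n]_eta F (quad_sum c xi eta) = \int[quad_laws c]_y F y.
Proof.
elim: n c F => [|n IH] c F mF F0.
  rewrite /quad_laws (_ : enum 'I_0 = [::]); last by apply: size0nil; rewrite size_enum_ord.
  have E xi eta : quad_sum c xi eta = 0%R by rewrite /quad_sum big_ord0.
  under eq_integral do under eq_integral do rewrite E.
  have C d (T : measurableType d) (P : probability T R) k : \int[P]_x k = k.
    by rewrite integral_cst//= probability_setT mule1.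
  rewrite !C.
  by rewrite integral_dirac// diracT mul1e.
pose c' i := c (lift ord0 i).
pose G (x : mR * mR * (n.-tuple mR * n.-tuple mR)) :=
  F (quad (c ord0) x.1 + quad_sum c' x.2.1 x.2.2)%R.
have G0 x : 0 <= G x by exact: F0.
have mq : measurable_fun setT (fun x : mR * mR * (n.-tuple mR * n.-tuple mR) =>
    (quad (c ord0) x.1 + quad_sum c' x.2.1 x.2.2)%R).
  apply: measurable_funD.
    exact: (measurableT_comp (measurable_quad (c ord0)) measurable_fst).
  apply: measurable_quad_sum.
    exact: (measurableT_comp measurable_fst measurable_snd).
  exact: (measurableT_comp measurable_snd measurable_snd).
have mG : measurable_fun setT G by exact: (measurableT_comp mF mq).
transitivity (\int[gam]_s \int[gam]_t \int[gt n]_xi \int[gt n]_eta G (s, t, (xi, eta))).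
  have mFq : measurable_fun setT (fun z : n.+1.-tuple mR * n.+1.-tuple mR =>
      F (quad_sum c z.1 z.2)).
    by apply: (measurableT_comp mF); apply: measurable_quad_sum;
      [exact: measurable_fst|exact: measurable_snd].
  rewrite (@ge0_integral_gauss_tupleS _ _ (fun xi => \int[gt n.+1]_eta F (quad_sum c xi eta))); last 2 first.
  - apply: (@measurable_fun_fubini_tonelli_F _ _ _ _ _ (gt n.+1)
      (fun z => F (quad_sum c z.1 z.2))); [exact: mFq|move=> z; exact: F0].
  - by move=> xi; apply: integral_ge0.
  apply: eq_integral => s _.
  transitivity (\int[gt n]_xi \int[gam]_t \int[gt n]_eta G (s, t, (xi, eta))).
    apply: eq_integral => xi _.
    rewrite ge0_integral_gauss_tupleS//; last first.
      exact: (measurableT_comp mFq (measurable_pair1 _)).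
    apply: eq_integral => t _; apply: eq_integral => eta _.
    by rewrite /G quad_sum_cons.
  pose G' (z : n.-tuple mR * mR) := \int[gt n]_eta G (s, z.2, (z.1, eta)).
  have mG' : measurable_fun setT G'.
    apply: (@measurable_fun_fubini_tonelli_F _ _ (n.-tuple mR * mR)%type _ _ (gt n)
      (fun w => G (s, w.1.2, (w.1.1, w.2)))); last by move=> w.
    apply: (measurableT_comp mG).
    apply/measurable_fun_pairP; split => /=.
      apply/measurable_fun_pairP; split => /=; first exact: measurable_cst.
      exact: (measurableT_comp measurable_snd measurable_fst).
    apply/measurable_fun_pairP; split => /=; last exact: measurable_snd.
    exact: (measurableT_comp measurable_fst measurable_fst).
  apply: (@fubini_tonelli _ _ _ _ _ (gt n) gam G') => //.
  by move=> z; apply: integral_ge0.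
pose L := quad_laws c'.
have -> : quad_laws c = conv (qlaw (c ord0)) L.
  by rewrite /quad_laws enum_ordSl/= -map_comp.
rewrite ge0_integral_conv//.
have mFL : measurable_fun setT (fun x : mR => \int[L]_y F (x + y)%R).
  apply: (@measurable_fun_fubini_tonelli_F _ _ mR mR _ L (F \o @addp R)).
    exact: (measurableT_comp mF (@measurable_addp R)).
  by move=> z; exact: F0.
have L0 x : 0 <= \int[L]_y F (x + y)%R by apply: integral_ge0.
pose H (z : mR * mR) := \int[L]_y F (quad (c ord0) z + y)%R.
have mH : measurable_fun setT H := measurableT_comp mFL (measurable_quad (c ord0)).
rewrite [RHS](_ : _ = \int[(gam \x gam)%E]_z H z); last first.
  exact: (ge0_integral_distribution (quad (c ord0)) mFL L0).
rewrite (fubini_tonelli1 (m1 := gam) (m2 := gam) H mH (fun=> L0 _)).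
apply: eq_integral => s _; apply: eq_integral => t _.
apply: (IH c' (fun y => F (quad (c ord0) (s, t) + y)%R)) => //.
have ms : measurable_fun setT (fun y : mR => (quad (c ord0) (s, t) + y)%R : mR).
  exact: measurable_funD.
exact: (measurableT_comp mF ms).
Qed.

End law_of_quadratic_sum.

(** * The canonical distribution in normal coordinates *)

Section canonical_law.
Variable R : realType.
Local Notation mR := (measurableTypeR R).
Local Notation gt n := (gauss_tuple R n).
Local Notation lam n := (@lebesgue_tuple R n).

Lemma measurable_center N : measurable_fun setT (@Defs.center R N).
Proof.
apply/measurable_fun_tnthP => i.
rewrite (_ : _ \o _ = fun q => (tnth q i : R) - (\sum_(j < N) (tnth q j : R)) / N%:R).
  apply: measurable_funB; first exact: measurable_tnth.
  apply: measurable_funM => //; apply: measurable_sum => j.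
  exact: measurable_tnth.
by apply/funext => q; rewrite /= tnth_mktuple.
Qed.

Lemma measurable_zero_sum n : measurable_fun setT (@zero_sum R n.+1).
Proof.
apply/measurable_fun_tnthP => i; have [i_n|n_i] := ltnP i n.
  rewrite (_ : _ \o _ = fun r : n.-tuple mR => tnth r (Ordinal i_n)).
    exact: measurable_tnth.
  by apply/funext => r; rewrite /= tnth_mktuple /= i_n (tnth_nth 0).
rewrite (_ : _ \o _ = fun r : n.-tuple mR => - \sum_(j < n) (tnth r j : R)).
  apply: measurableT_comp => //; apply: measurable_sum => j.
  exact: measurable_tnth.
by apply/funext => r; rewrite /= tnth_mktuple /= ltnNge n_i.
Qed.

Local Open Scope ereal_scope.

(** Momentum and position decouple in the Hamiltonian, so each has its own normalizing matrix. The
    canonical law and the image of the Gaussian are first shown to be proportional on sets. *)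
Lemma canonical_law n nu b d (T : measurableType d) (P : probability T R)
    (X : {RV P >-> (n.+1.-tuple mR * n.+1.-tuple mR)%type})
    (A : 'M[R]_n.+1) (B : 'M[R]_n) (qp : n.+1.-tuple mR -> R) (qr : n.-tuple mR -> R) :
  A \in unitmx -> B \in unitmx ->
  measurable_fun setT qp -> measurable_fun setT qr ->
  (forall t, qp (mxt A t) = normsq t) -> (forall t, qr (mxt B t) = normsq t) ->
  (forall p r, b * hamiltonian nu (state (p, @zero_sum R n.+1 r)) = qp p / 2 + qr r / 2)%R ->
  canonically_distributed nu b X ->
  forall G : n.+1.-tuple mR * n.+1.-tuple mR -> \bar R,
  measurable_fun setT G -> (forall x, 0 <= G x) ->
  \int[P]_w G ((X w).1, Defs.center (X w).2) =
  \int[gt n.+1]_xi \int[gt n]_eta G (mxt A xi, @zero_sum R n.+1 (mxt B eta)).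
Proof.
move=> uA uB mqp mqr qpA qrB Hq [c muE] G mG G0.
pose X' w := ((X w).1, Defs.center (X w).2).
have mX : measurable_fun setT X by exact: measurable_funP.
have mX' : measurable_fun setT X'.
  apply/measurable_fun_pairP; split.
    exact: (measurableT_comp measurable_fst mX).
  exact: (measurableT_comp (@measurable_center n.+1) (measurableT_comp measurable_snd mX)).
pose Psi (z : n.+1.-tuple mR * n.-tuple mR) := (mxt A z.1, @zero_sum R n.+1 (mxt B z.2)).
have mPsi : measurable_fun setT Psi.
  apply/measurable_fun_pairP; split.
    exact: (measurableT_comp (measurable_mxt A) measurable_fst).
  exact: (measurableT_comp (@measurable_zero_sum n)
    (measurableT_comp (measurable_mxt B) measurable_snd)).
pose Z (z : n.+1.-tuple mR * n.-tuple mR) := (z.1, @zero_sum R n.+1 z.2).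
have mZ : measurable_fun setT Z.
  apply/measurable_fun_pairP; split; first exact: measurable_fst.
  exact: (measurableT_comp (@measurable_zero_sum n) measurable_snd).
have [cA cA0 HA] := gaussian_linear_image uA mqp qpA.
have [cB cB0 HB] := gaussian_linear_image uB mqr qrB.
pose gg := (gt n.+1 \x gt n)%E.
have mexp m (q : m.-tuple mR -> R) : measurable_fun setT q ->
    measurable_fun setT (fun t => (expR (- (q t / 2)))%:E).
  move=> mq; apply/measurable_EFinP; apply: measurableT_comp => //.
  by apply: measurableT_comp => //; exact: measurable_funM.
have key S : measurable S -> P (X' @^-1` S) = (c * (cA * cB))%:E * gg (Psi @^-1` S).
  move=> mS; rewrite [LHS](muE S mS) EFinM -muleA; congr (_ * _).
  pose I (z : n.+1.-tuple mR * n.+1.-tuple mR) : \bar R := (\1_S z)%:E.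
  have mI : measurable_fun setT I by apply/measurable_EFinP; exact: measurable_indic.
  have I0 z : 0 <= I z by rewrite lee_fin.
  have mIZ : measurable_fun setT (I \o Z) by exact: measurableT_comp.
  pose F z := I (Z z) * (expR (- (qr z.2 / 2)))%:E * (expR (- (qp z.1 / 2)))%:E.
  have mF : measurable_fun setT F.
    apply: emeasurable_funM; last exact: (measurableT_comp (mexp _ _ mqp) measurable_fst).
    apply: emeasurable_funM => //.
    exact: (measurableT_comp (mexp _ _ mqr) measurable_snd).
  have F0 z : 0 <= F z by rewrite !mule_ge0// lee_fin expR_ge0.
  transitivity (\int[lam n.+1 \x lam n]_z F z).
    rewrite integral_mkcond; apply: eq_integral => z _; rewrite patchE /F /I indicE.
    have -> : (z \in [set x | S (x.1, @zero_sum R n.+1 x.2)]) = (Z z \in S).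
      by apply/idP/idP; rewrite !inE.
    case: ifPn => _; last by rewrite !mul0e.
    by rewrite mul1e -EFinM -expRD Hq opprD addrC.
  rewrite (fubini_tonelli1 (m1 := lam n.+1) (m2 := lam n) F mF F0).
  pose K (x : n.+1.-tuple mR) := \int[gt n]_y I (x, @zero_sum R n.+1 (mxt B y)).
  have mIK : measurable_fun setT (fun z : n.+1.-tuple mR * n.-tuple mR =>
      I (z.1, @zero_sum R n.+1 (mxt B z.2))).
    apply: (measurableT_comp mI); apply/measurable_fun_pairP; split.
      exact: measurable_fst.
    exact: (measurableT_comp (@measurable_zero_sum n)
      (measurableT_comp (measurable_mxt B) measurable_snd)).
  have mK : measurable_fun setT K.
    apply: (@measurable_fun_fubini_tonelli_F _ _ _ _ _ (gt n)
      (fun z => I (z.1, @zero_sum R n.+1 (mxt B z.2)))); [exact: mIK|by move=> z].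
  have K0 x : 0 <= K x by apply: integral_ge0.
  transitivity (\int[lam n.+1]_x (cB%:E * (K x * (expR (- (qp x / 2)))%:E))).
    apply: eq_integral => x _; rewrite /fubini_F /F/=.
    have mIx : measurable_fun setT (fun r : n.-tuple mR => I (x, @zero_sum R n.+1 r)).
      exact: (measurableT_comp mIZ (measurable_pair1 x)).
    have mIe := emeasurable_funM mIx (mexp _ _ mqr).
    rewrite (ge0_integralZr _ _ mIe) ?lee_fin ?expR_ge0//; last first.
      by move=> r _; rewrite mule_ge0// lee_fin expR_ge0.
    by rewrite (HB _ mIx)// muleA.
  have mKe := emeasurable_funM mK (mexp _ _ mqp).
  rewrite (ge0_integralZl _ _ mKe)//; last first.
    by move=> x _; rewrite mule_ge0// lee_fin expR_ge0.
  rewrite (HA _ mK K0) muleA -EFinM mulrC; congr (_ * _).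
  have mPS : measurable (Psi @^-1` S).
    by rewrite -[X in measurable X]setTI; exact: mPsi.
  have mIP : measurable_fun setT (fun z => (\1_(Psi @^-1` S) z)%:E : \bar R).
    by apply/measurable_EFinP; exact: measurable_indic.
  transitivity (\int[(gt n.+1 \x gt n)%E]_z (\1_(Psi @^-1` S) z)%:E); last first.
    by rewrite integral_indic// setIT.
  have IP0 z : 0 <= (\1_(Psi @^-1` S) z)%:E :> \bar R by rewrite lee_fin.
  rewrite (fubini_tonelli1 (m1 := gt n.+1) (m2 := gt n) _ mIP IP0).
  apply: eq_integral => x _; apply: eq_integral => y _.
  by rewrite /I !indicE.
(* Evaluated on the whole space, where both measures have mass 1, the product of the partition
   constant and the two Jacobian factors is identified. *)
have cst1 : (c * (cA * cB) = 1)%R.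
  have g1 : gg setT = 1 by exact: (probability_setT (gt n.+1 \x gt n)%E).
  have := key setT measurableT.
  by rewrite !preimage_setT (probability_setT P) g1 mule1 => -[].
pose nu0 : {measure set _ -> \bar R} := pushforward P X'.
pose ga0 : {measure set _ -> \bar R} := pushforward gg Psi.
transitivity (\int[nu0 mX']_z G z).
  by rewrite (ge0_integral_pushforward mX' P measurableT mG) // => z _.
transitivity (\int[ga0 mPsi]_z G z).
  by apply: eq_measure_integral => S mS _; rewrite /= [LHS](key S mS) cst1 mul1e.
rewrite (ge0_integral_pushforward mPsi gg measurableT mG)//.
have mGP : measurable_fun setT (G \o Psi) by exact: measurableT_comp.
by rewrite preimage_setT (fubini_tonelli1 (m1 := gt n.+1) (m2 := gt n) (G \o Psi) mGP (fun=> G0 _)).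
Qed.

End canonical_law.

(** * Normal modes of the chain *)

Section neumann_modes.
Variables (R : realType) (n : nat).
Local Notation N := n.+1.
Implicit Types (j : 'I_N) (k l : nat).

Definition angle (k : nat) : R := k%:R * pi / (2 * N%:R).
Definition eigenvalue (k : nat) : R := 4 * N%:R ^+ 2 * sin (angle k) ^+ 2.
(** The cosine is sampled half a step off the lattice, so that the sines in its gradient vanish at
    both ends of the chain. *)
Definition mode (k : nat) : 'cV[R]_N := \col_j cos ((2 * j + 1)%:R * angle k).

Let N0 : 0 < N%:R :> R. Proof. by rewrite ltr0n. Qed.

Lemma angle0 : angle 0 = 0. Proof. by rewrite /angle mul0r mul0r. Qed.

Lemma angle_ge0 k : 0 <= angle k.
Proof. by rewrite divr_ge0 ?mulr_ge0 ?pi_ge0// ltW. Qed.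

Lemma angle_lt_pihalf k : (k < N)%N -> angle k < pi / 2.
Proof.
move=> kN; rewrite /angle ltr_pdivrMr ?mulr_gt0//.
have -> : pi / 2 * (2 * N%:R) = N%:R * pi :> R by field.
by rewrite ltr_pM2r ?pi_gt0// ltr_nat.
Qed.

Lemma eigenvalue0 : eigenvalue 0 = 0.
Proof. by rewrite /eigenvalue angle0 sin0 expr0n mulr0. Qed.

Lemma eigenvalue_ge0 k : 0 <= eigenvalue k.
Proof. by apply: mulr_ge0; [apply: mulr_ge0 => //; exact: sqr_ge0|exact: sqr_ge0]. Qed.

Lemma sin_angle_ge0 k : (k < N)%N -> 0 <= sin (angle k).
Proof.
move=> kN; apply: sin_ge0_pi; rewrite angle_ge0/=.
by rewrite (le_trans (ltW (angle_lt_pihalf kN)))// ler_pdivrMr// ler_peMr ?pi_ge0// ler1n.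
Qed.

Lemma eigenvalue_lt (k l : nat) : (k < l < N)%N -> eigenvalue k < eigenvalue l.
Proof.
move=> /andP[kl lN]; have kN := ltn_trans kl lN.
have b m : (m < N)%N -> angle m \in `[- (pi / 2), pi / 2].
  move=> mN; rewrite in_itv/= (ltW (angle_lt_pihalf mN)) andbT.
  by rewrite (le_trans _ (angle_ge0 m))// oppr_le0 divr_ge0// pi_ge0.
have akl : angle k < angle l.
  by rewrite /angle ltr_pM2r ?invr_gt0 ?mulr_gt0// ltr_pM2r ?pi_gt0// ltr_nat.
rewrite /eigenvalue ltr_pM2l ?mulr_gt0 ?exprn_gt0//.
rewrite ltr_pXn2r ?nnegrE ?sin_angle_ge0//.
by rewrite ltr_sin ?b.
Qed.

Lemma eigenvalue_gt0 k : (0 < k < N)%N -> 0 < eigenvalue k.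
Proof. by rewrite -eigenvalue0; exact: eigenvalue_lt. Qed.

Lemma eigenvalue_inj (k l : 'I_N) : eigenvalue k = eigenvalue l -> k = l.
Proof.
move=> kl; apply/val_inj => /=; have [kl'|lk'|//] := ltngtP k l.
  by have := @eigenvalue_lt k l; rewrite kl' ltn_ord kl ltxx => /(_ isT).
by have := @eigenvalue_lt l k; rewrite lk' ltn_ord kl ltxx => /(_ isT).
Qed.

Lemma gradient_mode (k : nat) (i : 'I_n) :
  (discrete_gradient R N *m mode k) i 0 =
  - 2 * N%:R * sin (angle k) * sin ((2 * i.+1)%:R * angle k).
Proof.
have E : forall j : 'I_N, discrete_gradient R N i j * mode k j 0 =
    N%:R * ((j == lift ord0 i)%:R * mode k j 0 - (j == widen_ord (leqnSn n) i)%:R * mode k j 0).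
  by move=> j; rewrite mxE -mulrA mulrBl; congr (_ * (_ * _ - _ * _)).
rewrite mxE (eq_bigr _ (fun j _ => E j)) -mulr_sumr sumrB.
rewrite (bigD1 (lift ord0 i))//= [X in _ + X - _]big1; last first.
  by move=> j /negPf ->; rewrite mul0r.
rewrite (bigD1 (widen_ord (leqnSn n) i))//= [X in _ - (_ + X)]big1; last first.
  by move=> j /negPf ->; rewrite mul0r.
rewrite !eqxx !mul1r !addr0 !mxE.
have -> : ((2 * lift ord0 i + 1)%:R * angle k) = (2 * i.+1)%:R * angle k + angle k.
  by rewrite /= /bump/= add1n natrD mulrDl mul1r.
have -> : ((2 * widen_ord (leqnSn n) i + 1)%:R * angle k) = (2 * i.+1)%:R * angle k - angle k.
  rewrite /= mulnS !natrD; ring.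
rewrite cosD cosB; ring.
Qed.

(** At an end of the chain one of the two gradient terms is missing. The sine [s] that would stand
    there is 0 at index 0 and at index N, so the interior formula holds at every site. *)
Lemma laplacian_mode (k : 'I_N) : discrete_laplacian R N *m mode k = - eigenvalue k *: mode k.
Proof.
rewrite /discrete_laplacian mulNmx scaleNr; congr (- _).
rewrite -mulmxA; apply/colP => j; rewrite mxE.
pose c := - 2 * N%:R * sin (angle k).
pose s (m : nat) := sin ((2 * m)%:R * angle k).
have s0 : s 0%N = 0 by rewrite /s muln0 mul0r sin0.
have sN : s N = 0.
  rewrite /s /angle natrM mulrC divfK ?mulf_neq0 ?pnatr_eq0//.
  elim: (nat_of_ord k) => [|m IH]; first by rewrite mul0r sin0.
  by rewrite -natr1 mulrDl mul1r sinDpi IH oppr0.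
have E : forall i : 'I_n, (discrete_gradient R N)^T j i * (discrete_gradient R N *m mode k) i 0 =
    N%:R * c * ((j == i.+1 :> nat)%:R * s i.+1 - (j == i :> nat)%:R * s i.+1).
  move=> i; rewrite gradient_mode mxE mxE /c /s; ring.
rewrite (eq_bigr _ (fun i _ => E i)) -mulr_sumr sumrB.
have -> : \sum_(i < n) (j == i.+1 :> nat)%:R * s i.+1 = s j.
  have [j'|] := unliftP ord0 j; last first.
    by move=> ->; rewrite s0 big1// => i _; rewrite mul0r.
  move=> ->; rewrite (bigD1 j')//= /bump/= add1n eqxx mul1r big1 ?addr0// => i ij.
  by rewrite eqSS eq_sym (val_eqE i j') (negPf ij) mul0r.
have -> : \sum_(i < n) (j == i :> nat)%:R * s i.+1 = s j.+1.
  have [jn|nj] := ltnP j n.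
    rewrite (bigD1 (Ordinal jn))//= eqxx mul1r big1 ?addr0// => i.
    by rewrite -val_eqE/= eq_sym => /negPf ->; rewrite mul0r.
  have -> : j = n :> nat by apply/eqP; rewrite eqn_leq nj -ltnS ltn_ord.
  by rewrite sN big1// => i _; rewrite gtn_eqF ?mul0r.
rewrite /s /c /eigenvalue !mxE.
have -> : (2 * j)%:R * angle k = (2 * j + 1)%:R * angle k - angle k.
  by rewrite natrD; ring.
have -> : (2 * j.+1)%:R * angle k = (2 * j + 1)%:R * angle k + angle k.
  by rewrite mulnS !natrD; ring.
rewrite sinB sinD; ring.
Qed.

(** Eigenvectors of a symmetric matrix for distinct eigenvalues; no trigonometric sum is
    evaluated. *)
Lemma mode_orthogonal (k l : 'I_N) : k != l -> (mode k)^T *m mode l = 0.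
Proof.
move=> kl; pose L := discrete_laplacian R N.
have LT : L^T = L by rewrite /L /discrete_laplacian linearN/= trmx_mul trmxK.
have E1 : (mode k)^T *m (L *m mode l) = - eigenvalue l *: ((mode k)^T *m mode l).
  by rewrite laplacian_mode -scalemxAr.
have E2 : (mode k)^T *m (L *m mode l) = - eigenvalue k *: ((mode k)^T *m mode l).
  by rewrite mulmxA -{1}LT -trmx_mul laplacian_mode linearZ/= -scalemxAl.
move: E1; rewrite E2 => /eqP; rewrite -subr_eq0 -scalerBl scaler_eq0.
case/orP => [|/eqP//]; rewrite opprK addrC subr_eq0 => /eqP /eigenvalue_inj lk.
by rewrite lk eqxx in kl.
Qed.

Definition mode_norm2 (k : nat) : R := ((mode k)^T *m mode k) 0 0.

(** The first entry is the cosine of an angle below pi / 2. Normalizing the modes uses positivity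
    and not the actual value of the norm. *)
Lemma mode_norm2_gt0 (k : 'I_N) : 0 < mode_norm2 k.
Proof.
rewrite /mode_norm2 mxE (bigD1 ord0)//= ltr_pwDl//.
  rewrite !mxE muln0 add0n mul1r -expr2 exprn_gt0// cos_gt0_pihalf//.
  rewrite angle_lt_pihalf// andbT (lt_le_trans _ (angle_ge0 k))//.
  by rewrite oppr_lt0 divr_gt0 ?pi_gt0.
by apply: sumr_ge0 => j _; rewrite !mxE -expr2 sqr_ge0.
Qed.

Definition modes : 'M[R]_N := \matrix_(k, j) (mode k j 0 / Num.sqrt (mode_norm2 k)).

Lemma modes_orthogonal : modes *m modes^T = 1%:M.
Proof.
apply/matrixP => k l; rewrite !mxE.
transitivity (((mode k)^T *m mode l) 0 0 /
    (Num.sqrt (mode_norm2 k) * Num.sqrt (mode_norm2 l))).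
  rewrite mxE mulr_suml; apply: eq_bigr => j _.
  by rewrite !mxE invfM mulrACA.
have [<-|kl] := eqVneq k l; last by rewrite mode_orthogonal// mxE mul0r.
by rewrite -expr2 sqr_sqrtr ?(ltW (mode_norm2_gt0 k))// divff// gt_eqF// mode_norm2_gt0.
Qed.

Lemma modes_orthogonalC : modes^T *m modes = 1%:M.
Proof. exact: mulmx1C modes_orthogonal. Qed.

Lemma modes_laplacian (v : 'cV[R]_N) (k : 'I_N) :
  (modes *m (discrete_laplacian R N *m v)) k 0 = - eigenvalue k * (modes *m v) k 0.
Proof.
have row_modes : row k modes = (Num.sqrt (mode_norm2 k))^-1 *: (mode k)^T.
  by apply/rowP => j; rewrite !mxE mulrC.
have LT : (discrete_laplacian R N)^T = discrete_laplacian R N.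
  by rewrite /discrete_laplacian linearN/= trmx_mul trmxK.
have E (w : 'cV[R]_N) : (modes *m w) k 0 = (row k modes *m w) 0 0.
  by rewrite -row_mul [RHS]mxE.
rewrite !E row_modes -!scalemxAl mulmxA -{1}LT -trmx_mul laplacian_mode.
rewrite linearZ/= -!scalemxAl !mxE; ring.
Qed.

End neumann_modes.

Section energy_in_modes.
Variables (R : realType) (n : nat) (nu h : R).
Local Notation N := n.+1.
Local Notation V := (modes R n).
Local Notation lam k := (eigenvalue R n k).
Local Notation L := (discrete_laplacian R N).
Local Notation M := (mass_matrix nu N).
Implicit Types (p q v : 'cV[R]_N) (k : 'I_N).

Definition mode_mass (k : nat) : R := 1 + nu ^+ 2 * lam k.

Lemma mode_mass_gt0 (k : nat) : 0 < mode_mass k.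
Proof. by rewrite ltr_wpDr// mulr_ge0 ?sqr_ge0 ?eigenvalue_ge0. Qed.

Lemma modes_mass v k : (V *m (M *m v)) k 0 = mode_mass k * (V *m v) k 0.
Proof.
rewrite /mass_matrix mulmxBl mul1mx mulmxBr -scalemxAl -scalemxAr.
rewrite mxE [X in _ + X]mxE [X in _ - X]mxE modes_laplacian /mode_mass; ring.
Qed.

Lemma modesK v : V^T *m (V *m v) = v.
Proof. by rewrite mulmxA modes_orthogonalC mul1mx. Qed.

Lemma parseval p q : (p^T *m q) 0 0 = \sum_k (V *m p) k 0 * (V *m q) k 0.
Proof.
rewrite -{1}(modesK q) mulmxA -[p^T *m _]trmxK trmx_mul !trmxK mxE.
by apply: eq_bigr => k _; rewrite mxE.
Qed.

Lemma mass_unit : M \in unitmx.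
Proof.
pose W := V^T *m diag_mx (\row_k (mode_mass k)^-1) *m V.
have VM : V *m M = diag_mx (\row_k mode_mass k) *m V.
  apply/matrixP => k j; rewrite mul_diag_mx !mxE.
  have := modes_mass (delta_mx j 0) k.
  by rewrite mulmxA -!colE !mxE.
suff /mulmx1_unit[] : W *m M = 1%:M by [].
rewrite -mulmxA VM mulmxA -(mulmxA V^T) mulmx_diag.
rewrite (_ : diag_mx _ = 1%:M) ?mulmx1 ?modes_orthogonalC//.
rewrite -diag_const_mx; congr diag_mx; apply/rowP => k; rewrite !mxE mulVf//.
by rewrite gt_eqF// mode_mass_gt0.
Qed.

Lemma modes_invmass v k :
  (V *m (invmx M *m v)) k 0 = (V *m v) k 0 / mode_mass k.
Proof.
rewrite -[in RHS](mulKVmx mass_unit v) modes_mass mulrC mulKf//.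
by rewrite gt_eqF// mode_mass_gt0.
Qed.

Lemma hamiltonian_modes p q : hamiltonian nu (p, q) =
  \sum_k ((V *m p) k 0 ^+ 2 / mode_mass k + lam k * (V *m q) k 0 ^+ 2) / 2.
Proof.
rewrite /hamiltonian/= -mulmxA parseval.
have -> : \sum_(i < n) v_int ((discrete_gradient R N *m q) i 0) =
    2^-1 * (q^T *m (- L *m q)) 0 0.
  rewrite /discrete_laplacian opprK -mulmxA mulmxA -trmx_mul mxE mulr_sumr.
  by apply: eq_bigr => i _; rewrite [in RHS]mxE /v_int expr2 mulrC.
rewrite parseval !mulr_sumr -big_split/=; apply: eq_bigr => k _.
have neg (v : 'cV[R]_N) : (- v) k 0 = - v k 0 by rewrite mxE.
rewrite modes_invmass mulNmx mulmxN neg modes_laplacian; ring.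
Qed.

Definition mode_energy (l m P Q : R) : R := (P ^+ 2 / m + l * Q ^+ 2) / 2.

Definition mode_variation (l m P Q : R) : R :=
  let P1 := P - h / 2 * l * Q in
  let Q1 := Q + h * (P1 / m) in
  let P2 := P1 - h / 2 * l * Q1 in
  mode_energy l m P2 Q1 - mode_energy l m P Q.

Lemma energy_variation_modes p q : energy_variation nu h (p, q) =
  \sum_(k < N) mode_variation (lam k) (mode_mass k) ((V *m p) k 0) ((V *m q) k 0).
Proof.
rewrite /energy_variation /leapfrog !hamiltonian_modes -sumrB.
apply: eq_bigr => k _; rewrite /mode_variation /mode_energy.
have lin (u v : 'cV[R]_N) (c : R) :
    (V *m (u + c *: v)) k 0 = (V *m u) k 0 + c * (V *m v) k 0.
  by rewrite mulmxDr -scalemxAr mxE [X in _ + X]mxE.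
rewrite !(lin, modes_laplacian, modes_invmass); congr (_ - _).
by rewrite !mulNr !mulrN !mulrA.
Qed.

(** With no force, the translation mode is a free particle, whose momentum and energy leapfrog
    preserves exactly. *)
Lemma mode_variation0 m P Q : m != 0 -> mode_variation 0 m P Q = 0.
Proof. by move=> m0; rewrite /mode_variation /mode_energy; field. Qed.

(* Coefficients, in the sense of [quad], of the energy variation of an oscillator
   whose canonical law is normalized to a pair of independent standard normal
   variables; a is the time step times the frequency. *)
Definition leapfrog_coef (a : R) : R * R * R :=
  (a ^+ 4 / 8, - a ^+ 4 / 8 + a ^+ 6 / 32, (1 - a ^+ 2 / 2) * a ^+ 3 / 4).

Lemma qmean_leapfrog a : qmean (leapfrog_coef a) = a ^+ 6 / 32.
Proof. by rewrite /qmean /leapfrog_coef/=; field. Qed.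

(** With coefficients (u, v, w), conservation of area reads (1 + 2 u) (1 + 2 v) - w^2 = 1.
    Substituting w^2 in 2 u^2 + 2 v^2 + w^2 gives 2 t^2 + 2 t, where t = u + v is the mean. *)
Lemma qvar_leapfrog a :
  qvar (leapfrog_coef a) = 2 * (a ^+ 6 / 32 + (a ^+ 6 / 32) ^+ 2).
Proof. by rewrite /qvar /leapfrog_coef/=; field. Qed.

Lemma mode_variation_quad (b l m x y : R) : 0 < b -> 0 < l -> 0 < m ->
  b * mode_variation l m (Num.sqrt (m / b) * x) (y / Num.sqrt (b * l)) =
  quad (leapfrog_coef (h * Num.sqrt (l / m))) (x, y).
Proof.
move=> b0 l0 m0.
(* Square roots of the parameters become the variables, turning the claim into an identity of
   rational functions. *)
have [sb sb0 ->] : exists2 s, 0 < s & b = s ^+ 2.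
  by exists (Num.sqrt b); rewrite ?sqrtr_gt0// sqr_sqrtr// ltW.
have [sl sl0 ->] : exists2 s, 0 < s & l = s ^+ 2.
  by exists (Num.sqrt l); rewrite ?sqrtr_gt0// sqr_sqrtr// ltW.
have [sm sm0 ->] : exists2 s, 0 < s & m = s ^+ 2.
  by exists (Num.sqrt m); rewrite ?sqrtr_gt0// sqr_sqrtr// ltW.
rewrite -!expr_div_n -exprMn !sqrtr_sqr !gtr0_norm ?divr_gt0 ?mulr_gt0//.
rewrite /mode_variation /mode_energy /quad /leapfrog_coef/=.
by field; rewrite !gt_eqF.
Qed.

End energy_in_modes.

(** * Law of the energy variation *)

Section law_of_energy_variation.
Variables (R : realType) (n : nat) (nu h b : R).
Hypothesis b0 : 0 < b.
Local Notation mR := (measurableTypeR R).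
Local Notation N := n.+1.
Local Notation V := (modes R n).
Local Notation lam k := (eigenvalue R n k).
Local Notation mass k := (mode_mass n nu k).
Local Notation gt n := (gauss_tuple R n).

Definition momentum_modes : 'M[R]_N :=
  V^T *m diag_mx (\row_(k < N) Num.sqrt (mass k / b)).

(** The row index omits the last site, which [zero_sum] restores, and the column index omits mode 0,
    absent from zero-sum vectors. The divisor is the inverse standard deviation of a mode under the
    canonical law. *)
Definition position_modes : 'M[R]_n := \matrix_(j < n, k < n)
  (V (lift ord0 k) (widen_ord (leqnSn n) j) / Num.sqrt (b * lam k.+1)).

Let mass_b_gt0 k : 0 < mass k / b. Proof. by rewrite divr_gt0// mode_mass_gt0. Qed.

Let b_lam_gt0 (k : 'I_n) : 0 < b * lam k.+1.
Proof. by rewrite mulr_gt0// eigenvalue_gt0//= ltnS. Qed.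

Lemma momentum_modesE (t : N.-tuple mR) k :
  (V *m vec (mxt momentum_modes t)) k 0 = Num.sqrt (mass k / b) * vec t k 0.
Proof.
rewrite unvecK /momentum_modes -mulmxA mulmxA modes_orthogonal mul1mx.
by rewrite mul_diag_mx !mxE.
Qed.

Lemma momentum_modes_unit : momentum_modes \in unitmx.
Proof.
pose D := diag_mx (\row_(k < N) (Num.sqrt (mass k / b))^-1).
suff /mulmx1_unit[] : (D *m V) *m momentum_modes = 1%:M by [].
rewrite /momentum_modes -mulmxA (mulmxA V) modes_orthogonal mul1mx mulmx_diag.
rewrite -diag_const_mx; congr diag_mx; apply/rowP => k; rewrite !mxE mulVf//.
by rewrite gt_eqF// sqrtr_gt0.
Qed.

(** Mode 0 is constant, so a zero sum is orthogonality to it. *)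
Lemma modes_sum0 (k : 'I_n) : \sum_j V (lift ord0 k) j = 0.
Proof.
pose c : R := (Num.sqrt (mode_norm2 R n 0))^-1.
have Vc j : V ord0 j = c by rewrite !mxE angle0 mulr0 cos0 mul1r.
have : (V *m V^T) (lift ord0 k) ord0 = 0 by rewrite modes_orthogonal mxE.
rewrite mxE; under eq_bigr => j _ do rewrite [X in _ * X]mxE Vc.
rewrite -mulr_suml => /eqP; rewrite mulf_eq0 invr_eq0 sqrtr_eq0 => /orP[/eqP//|].
by rewrite leNgt (mode_norm2_gt0 R (@ord0 n)).
Qed.

(** The coordinate restored by [zero_sum] follows the same formula as the others because each
    nonzero mode sums to 0. *)
Lemma vec_zero_sum_position_modes (t : n.-tuple mR) i :
  vec (@zero_sum R N (mxt position_modes t)) i 0 =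
  \sum_k V (lift ord0 k) i * (vec t k 0 / Num.sqrt (b * lam k.+1)).
Proof.
have E (j : 'I_n) : vec (mxt position_modes t) j 0 =
    \sum_k V (lift ord0 k) (widen_ord (leqnSn n) j) * (vec t k 0 / Num.sqrt (b * lam k.+1)).
  by rewrite unvecK mxE; apply: eq_bigr => k _; rewrite mxE mulrAC mulrA.
rewrite mxE tnth_mktuple; case: ifPn => /= [i_n|].
  rewrite (_ : nth 0 _ i = vec (mxt position_modes t) (Ordinal i_n) 0); last first.
    by rewrite [RHS]mxE (tnth_nth 0).
  rewrite E; apply: eq_bigr => k _; congr (V _ _ * _); exact/val_inj.
rewrite -leqNgt => n_i; have -> : i = ord_max.
  by apply/val_inj/eqP; rewrite /= eqn_leq n_i -ltnS ltn_ord.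
transitivity (- \sum_(j < n) vec (mxt position_modes t) j 0).
  by congr (- _); apply: eq_bigr => j _; rewrite mxE.
rewrite (eq_bigr _ (fun j _ => E j)) exchange_big/= -sumrN; apply: eq_bigr => k _.
rewrite -mulr_suml -mulNr; congr (_ * _); apply/eqP.
rewrite eq_sym -addr_eq0 addrC.
have := modes_sum0 k; rewrite big_ord_recr/= => S0.
apply/eqP; rewrite -[RHS]S0; congr (_ + _); apply: eq_bigr => j _.
Qed.

Lemma position_modesE (t : n.-tuple mR) (k : 'I_n) :
  (V *m vec (@zero_sum R N (mxt position_modes t))) (lift ord0 k) 0 =
  vec t k 0 / Num.sqrt (b * lam k.+1).
Proof.
rewrite mxE; under eq_bigr do rewrite vec_zero_sum_position_modes mulr_sumr.
rewrite exchange_big (bigD1 k)//= [X in _ + X]big1 ?addr0 => [|l lk].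
  under eq_bigr do rewrite mulrA; rewrite -mulr_suml.
  have : (V *m V^T) (lift ord0 k) (lift ord0 k) = 1 by rewrite modes_orthogonal mxE eqxx.
  by rewrite mxE; under eq_bigr do rewrite [X in _ * X]mxE; move=> ->; rewrite mul1r.
under eq_bigr do rewrite mulrA; rewrite -mulr_suml.
have : (V *m V^T) (lift ord0 k) (lift ord0 l) = 0.
  by rewrite modes_orthogonal mxE (inj_eq lift_inj) eq_sym (negPf lk).
by rewrite mxE; under eq_bigr do rewrite [X in _ * X]mxE; move=> ->; rewrite mul0r.
Qed.

Lemma modes_center (q : N.-tuple mR) (k : 'I_n) :
  (V *m vec (Defs.center q)) (lift ord0 k) 0 = (V *m vec q) (lift ord0 k) 0.
Proof.
rewrite [LHS]mxE [RHS]mxE; pose c := (\sum_j (tnth q j : R)) / N%:R.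
transitivity (\sum_j (V (lift ord0 k) j * vec q j 0 - V (lift ord0 k) j * c)).
  apply: eq_bigr => j _; rewrite -mulrBr; congr (_ * _).
  by rewrite !mxE tnth_mktuple.
by rewrite sumrB -mulr_suml modes_sum0 mul0r subr0.
Qed.

Definition zero_sum_mx : 'M[R]_(N, n) :=
  \matrix_(i, j) (if (i < n)%N then (i == j :> nat)%:R else - 1).

Lemma vec_zero_sum (r : n.-tuple mR) : vec (@zero_sum R N r) = zero_sum_mx *m vec r.
Proof.
apply/colP => i; rewrite !mxE tnth_mktuple /=; case: ifPn => i_n.
  rewrite (bigD1 (Ordinal i_n))//= big1 ?addr0; last first.
    move=> j ji; rewrite mxE i_n (_ : (i == j :> nat) = false) ?mul0r//.
    by apply/negbTE; rewrite eq_sym.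
  by rewrite !mxE i_n eqxx mul1r (tnth_nth 0).
rewrite -sumrN; apply: eq_bigr => j _.
by rewrite !mxE (negPf i_n) mulN1r.
Qed.

(** A left inverse is exhibited: restore the last site, read the nonzero modes, rescale. *)
Lemma position_modes_unit : position_modes \in unitmx.
Proof.
pose D : 'M[R]_(n, N) := \matrix_(k < n, j < N) (Num.sqrt (b * lam k.+1) * V (lift ord0 k) j).
suff /mulmx1_unit[] : (D *m zero_sum_mx) *m position_modes = 1%:M by [].
apply/matrixP => i j.
pose t : n.-tuple mR := unvec (delta_mx j 0).
have -> : (D *m zero_sum_mx *m position_modes) i j =
    (D *m (vec (@zero_sum R N (mxt position_modes t)))) i 0.
  by rewrite vec_zero_sum !unvecK !mulmxA -colE [RHS]mxE.
transitivity (Num.sqrt (b * lam i.+1) *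
    (V *m vec (@zero_sum R N (mxt position_modes t))) (lift ord0 i) 0).
  rewrite [LHS]mxE [X in _ * X]mxE mulr_sumr; apply: eq_bigr => k _.
  by rewrite [D _ _]mxE -[LHS]mulrA.
rewrite position_modesE unvecK mulrC divfK ?gt_eqF ?sqrtr_gt0//.
by rewrite !mxE eqxx andbT.
Qed.

Lemma measurable_modes_vec d (T : measurableType d) (t : T -> N.-tuple mR) k :
  measurable_fun setT t -> measurable_fun setT (fun x => (V *m vec (t x)) k 0).
Proof. exact: measurable_mulmx_vec. Qed.

Lemma measurable_energy_variation d (T : measurableType d)
    (X : T -> (N.-tuple mR * N.-tuple mR)%type) : measurable_fun setT X ->
  measurable_fun setT (fun w => energy_variation nu h (state (X w))).
Proof.
move=> mX; under eq_fun do rewrite energy_variation_modes.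
apply: measurable_sum => k.
have mP := measurable_modes_vec k (measurableT_comp measurable_fst mX).
have mQ := measurable_modes_vec k (measurableT_comp measurable_snd mX).
rewrite /mode_variation /mode_energy /=.
have mP1 : measurable_fun setT (fun w => (V *m vec (X w).1) k 0 -
    h / 2 * lam k * (V *m vec (X w).2) k 0).
  by apply: measurable_funB => //; exact: measurable_funM.
have mQ1 : measurable_fun setT (fun w => (V *m vec (X w).2) k 0 + h *
    (((V *m vec (X w).1) k 0 - h / 2 * lam k * (V *m vec (X w).2) k 0) / mass k)).
  apply: measurable_funD => //; apply: measurable_funM => //; exact: measurable_funM.
have mE (P Q : T -> R) : measurable_fun setT P -> measurable_fun setT Q ->
    measurable_fun setT (fun w : T => (P w ^+ 2 / mass k + lam k * Q w ^+ 2) / 2).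
  move=> mP' mQ'; apply: measurable_funM => //; apply: measurable_funD.
    by apply: measurable_funM => //; exact: measurable_funX.
  by apply: measurable_funM => //; exact: measurable_funX.
apply: measurable_funB; last exact: mE.
apply: mE => //; apply: measurable_funB => //; exact: measurable_funM.
Qed.

Definition variation_coef (k : 'I_n) : R * R * R :=
  leapfrog_coef (h * Num.sqrt (lam k.+1 / mass k.+1)).

Lemma energy_variation_center (p q : N.-tuple mR) :
  energy_variation nu h (state (p, Defs.center q)) = energy_variation nu h (state (p, q)).
Proof.
rewrite !energy_variation_modes; apply: eq_bigr => k _ /=.
case: (unliftP ord0 k) => [k'|] ->; first by rewrite modes_center.
by rewrite /= eigenvalue0 !mode_variation0// gt_eqF// mode_mass_gt0.
Qed.

(** The normal variable [x] of the translation momentum is absent from the right-hand side, since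
    mode 0 conserves its energy; the other n momenta pair with the n positions. *)
Lemma energy_variation_quad (xi : n.-tuple mR) (x : mR) (eta : n.-tuple mR) :
  b * energy_variation nu h (state (mxt momentum_modes [tuple of x :: xi],
    @zero_sum R N (mxt position_modes eta))) = quad_sum variation_coef xi eta.
Proof.
rewrite energy_variation_modes big_ord_recl /= eigenvalue0 mode_variation0 ?add0r; last first.
  by rewrite gt_eqF// mode_mass_gt0.
rewrite mulr_sumr /quad_sum; apply: eq_bigr => k _.
rewrite /bump/= add1n momentum_modesE position_modesE.
rewrite mode_variation_quad//; last 2 first.
- by rewrite eigenvalue_gt0//= ltnS.
- exact: mode_mass_gt0.
by congr (quad _ (_, _)); rewrite !mxE tnthS.
Qed.

Local Open Scope ereal_scope.

Lemma law_energy_variation d (T : measurableType d) (P : probability T R)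
    (X : {RV P >-> (N.-tuple mR * N.-tuple mR)%type}) (F : R -> \bar R) :
  canonically_distributed nu b X ->
  measurable_fun setT (F : mR -> \bar R) -> (forall x, 0 <= F x) ->
  \int[P]_w F (b * energy_variation nu h (state (X w)))%R =
  \int[quad_laws variation_coef]_y F y.
Proof.
move=> Xcan mF F0.
pose G (z : N.-tuple mR * N.-tuple mR) := F (b * energy_variation nu h (state z))%R.
have mbE : measurable_fun setT (fun z : N.-tuple mR * N.-tuple mR =>
    (b * energy_variation nu h (state z))%R).
  have mid : measurable_fun setT (fun z : N.-tuple mR * N.-tuple mR => z).
    exact: measurable_id.
  exact: (measurable_funM (measurable_cst b) (measurable_energy_variation mid)).
have mG : measurable_fun setT G by exact: (measurableT_comp mF mbE).
transitivity (\int[P]_w G ((X w).1, Defs.center (X w).2)).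
  apply: eq_integral => w _; rewrite /G energy_variation_center.
  by case: (X w).
(* [qp] and [qr] are [2 * b] times the kinetic and the potential energy. *)
pose qp (p : N.-tuple mR) := (b * \sum_(k < N) (V *m vec p) k 0 ^+ 2 / mass k)%R.
pose qr (r : n.-tuple mR) :=
  (b * \sum_(k < N) lam k * (V *m vec (@zero_sum R N r)) k 0 ^+ 2)%R.
have mqp : measurable_fun setT qp.
  apply: measurable_funM => //; apply: measurable_sum => k.
  apply: measurable_funM => //; apply: measurable_funX.
  by apply: measurable_modes_vec; exact: measurable_id.
have mqr : measurable_fun setT qr.
  apply: measurable_funM => //; apply: measurable_sum => k.
  apply: measurable_funM => //; apply: measurable_funX.
  by apply: measurable_modes_vec; exact: measurable_zero_sum.
have qpE t : qp (mxt momentum_modes t) = normsq t.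
  rewrite /qp mulr_sumr; apply: eq_bigr => k _; rewrite momentum_modesE exprMn.
  rewrite sqr_sqrtr ?(ltW (mass_b_gt0 _))//; field.
  by rewrite !gt_eqF// mode_mass_gt0.
have qrE t : qr (mxt position_modes t) = normsq t.
  rewrite /qr big_ord_recl /= eigenvalue0 mul0r add0r mulr_sumr.
  apply: eq_bigr => k _; rewrite /bump/= add1n position_modesE expr_div_n.
  rewrite sqr_sqrtr ?(ltW (b_lam_gt0 _))//.
  have := b_lam_gt0 k; rewrite pmulr_rgt0// => l0; field.
  by rewrite !gt_eqF.
have HE p r : (b * hamiltonian nu (state (p, @zero_sum R N r)) = qp p / 2 + qr r / 2)%R.
  rewrite hamiltonian_modes /qp /qr/= -mulrDl -mulrDr -big_split/= -mulr_suml.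
  by rewrite mulrA.
rewrite (canonical_law momentum_modes_unit position_modes_unit mqp mqr qpE qrE HE Xcan mG (fun=> F0 _)).
have mH : measurable_fun setT (fun z : N.-tuple mR * n.-tuple mR =>
    G (mxt momentum_modes z.1, @zero_sum R N (mxt position_modes z.2))).
  apply: (measurableT_comp mG); apply/measurable_fun_pairP; split.
    exact: (measurableT_comp (measurable_mxt _) measurable_fst).
  exact: (measurableT_comp (@measurable_zero_sum R n)
    (measurableT_comp (measurable_mxt _) measurable_snd)).
rewrite (@ge0_integral_gauss_tupleS _ _ (fun xi => \int[gt n]_eta
  G (mxt momentum_modes xi, @zero_sum R N (mxt position_modes eta)))); last 2 first.
- apply: (@measurable_fun_fubini_tonelli_F _ _ _ _ _ (gt n)
    (fun z => G (mxt momentum_modes z.1, @zero_sum R N (mxt position_modes z.2)))).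
    exact: mH.
  by move=> z; exact: F0.
- by move=> xi; apply: integral_ge0 => eta _; exact: F0.
transitivity (\int[stdnormal R]_x \int[gt n]_xi \int[gt n]_eta F (quad_sum variation_coef xi eta)).
  apply: eq_integral => x _; apply: eq_integral => xi _; apply: eq_integral => eta _.
  by rewrite /G energy_variation_quad.
rewrite integral_cst//= probability_setT mule1.
exact: ge0_integral_quad_sum.
Qed.

End law_of_energy_variation.

(** * From equality in law to expectation and variance *)

Section equality_in_law.
Context d (T : measurableType d) (R : realType) (P : probability T R).
Local Notation mR := (measurableTypeR R).
Variables (Y : T -> R) (L : probability mR R).
Hypothesis mY : measurable_fun setT Y.
Hypothesis law : forall F : R -> \bar R, measurable_fun setT (F : mR -> \bar R) ->
  (forall x, 0 <= F x)%E -> (\int[P]_w F (Y w) = \int[L]_y F y)%E.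

Lemma law_integral (f : R -> R) : measurable_fun setT (f : mR -> R) ->
  L.-integrable setT (fun y : mR => (f y)%:E) ->
  P.-integrable setT (fun w => (f (Y w))%:E) /\
  (\int[P]_w (f (Y w))%:E = \int[L]_y (f y)%:E)%E.
Proof.
move=> mf fi.
have mEf : measurable_fun setT ((fun y => (f y)%:E) : mR -> \bar R) by exact/measurable_EFinP.
have mabs : measurable_fun setT ((fun y => (`|f y|)%:E) : mR -> \bar R).
  by apply/measurable_EFinP; exact: measurableT_comp.
split.
  apply/integrableP; split.
    by apply/measurable_EFinP; exact: (measurableT_comp mf mY).
  rewrite /= (law mabs) ?lee_fin//.
  by have /integrableP[] := fi.
rewrite [LHS]integralE [RHS]integralE.
have mp := measurable_funepos mEf; have mn := measurable_funeneg mEf.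
congr (_ - _)%E.
  rewrite -(law mp)//.
  by apply: eq_integral => w _; rewrite !funeposE.
rewrite -(law mn)//.
by apply: eq_integral => w _; rewrite !funenegE.
Qed.

Lemma law_moments m v : moments L m v ->
  ('E_P[Y] = m%:E)%E /\ ('V_P[Y] = v%:E)%E.
Proof.
move=> [i1 i2 e1 e2].
have m1 : measurable_fun setT (fun y : mR => (y : R) - m) by exact: measurable_funD.
have m2 : measurable_fun setT (fun y : mR => ((y : R) - m) ^+ 2) by exact: measurable_funX.
have [j1 f1] := law_integral m1 i1.
have [j2 f2] := law_integral m2 i2.
have EY : ('E_P[Y] = m%:E)%E.
  rewrite unlock.
  have i0 : P.-integrable setT (fun=> m%:E) by exact: finite_measure_integrable_cst.
  transitivity (\int[P]_w ((Y w - m)%:E + m%:E))%E.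
    by apply: eq_integral => w _; rewrite -EFinD subrK.
  rewrite integralD// f1 integral_cst//= probability_setT mule1.
  rewrite -[X in (X + _)%E]fineK; last exact: integrable_fin_num.
  by rewrite -/(Rintegral _ _ _) e1 add0e.
split => //; rewrite /variance unlock EY/=.
rewrite unlock/= -e2 /Rintegral fineK; last exact: integrable_fin_num.
by rewrite -f2; apply: eq_integral => w _; rewrite expr2.
Qed.

End equality_in_law.

(** * Means and variances of the modes *)

Section energy_variation_statistics.
Variable R : realType.
Local Notation mR := (measurableTypeR R).
Implicit Types (n : nat) (nu h : R).

Definition frequency2 n nu (k : nat) : R := eigenvalue R n k / mode_mass n nu k.

(** The a^6 / 32 of [qmean_leapfrog], written through a^2 to avoid the square root in the
    frequency. *)
Definition mode_mean n nu h (k : nat) : R := (h ^+ 2 * frequency2 n nu k) ^+ 3 / 32.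

Lemma frequency2_ge0 n nu k : 0 <= frequency2 n nu k.
Proof. by rewrite divr_ge0 ?eigenvalue_ge0// ltW// mode_mass_gt0. Qed.

Lemma mode_mean_ge0 n nu h k : 0 <= mode_mean n nu h k.
Proof. by rewrite divr_ge0// exprn_ge0// mulr_ge0 ?sqr_ge0 ?frequency2_ge0. Qed.

Lemma variation_coef_power n nu h (k : 'I_n) :
  (h * Num.sqrt (frequency2 n nu k.+1)) ^+ 6 / 32 = mode_mean n nu h k.+1.
Proof.
rewrite /mode_mean -[6%N]/(2 * 3)%N exprM; congr (_ ^+ 3 / 32).
by rewrite [LHS]exprMn sqr_sqrtr// frequency2_ge0.
Qed.

Definition mean_sum n nu h : R := \sum_(k < n) mode_mean n nu h k.+1.
Definition var_sum n nu h : R :=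
  \sum_(k < n) 2 * (mode_mean n nu h k.+1 + mode_mean n nu h k.+1 ^+ 2).

Lemma qmean_variation n nu h (k : 'I_n) :
  qmean (variation_coef nu h k) = mode_mean n nu h k.+1.
Proof. by rewrite qmean_leapfrog variation_coef_power. Qed.

Lemma qvar_variation n nu h (k : 'I_n) : qvar (variation_coef nu h k) =
  2 * (mode_mean n nu h k.+1 + mode_mean n nu h k.+1 ^+ 2).
Proof. by rewrite qvar_leapfrog variation_coef_power. Qed.

Lemma sum_qmean n nu h :
  \sum_(c <- [seq variation_coef nu h k | k <- enum 'I_n]) qmean c = mean_sum n nu h.
Proof. by rewrite big_map big_enum; apply: eq_bigr => k _; rewrite qmean_variation. Qed.

Lemma sum_qvar n nu h :
  \sum_(c <- [seq variation_coef nu h k | k <- enum 'I_n]) qvar c = var_sum n nu h.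
Proof. by rewrite big_map big_enum; apply: eq_bigr => k _; rewrite qvar_variation. Qed.

(** Here [angle R n j] is at least pi / 4, so its squared sine is at least 1 / 2 and
    [eigenvalue R n k] is at most twice that of [j]. Passing to l / (1 + nu^2 l) preserves a ratio
    of at most 2. *)
Lemma frequency2_half n nu (j k : nat) : (k < n.+1)%N -> (j < n.+1)%N -> (n < 2 * j)%N ->
  frequency2 n nu k <= 2 * frequency2 n nu j.
Proof.
move=> kn jn nj.
set y := eigenvalue R n k; set x := eigenvalue R n j.
have x0 : 0 <= x by exact: eigenvalue_ge0.
have y0 : 0 <= y by exact: eigenvalue_ge0.
have yx : y <= 2 * x.
  have s1 : sin (angle R n k) ^+ 2 <= 1 by rewrite sin2cos2 gerBl sqr_ge0.
  have s2 : 1 <= 2 * sin (angle R n j) ^+ 2.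
    have := cos_mulr2n (angle R n j); rewrite cos2sin2 => C.
    have : cos (angle R n j *+ 2) <= 0.
      have pi0 := pi_gt0 R.
      rewrite -[angle R n j *+ 2](subrK (pi / 2)) cosDpihalf oppr_le0.
      apply: sin_ge0_pi.
      have aE : angle R n j *+ 2 = j%:R * pi / n.+1%:R.
        by rewrite /angle -mulr_natl; field.
      rewrite aE subr_ge0 lerBlDr; apply/andP; split.
        rewrite ler_pdivlMr ?ltr0n// mulrAC ler_pdivrMr// mulrC mulrAC ler_pM2r//.
        by rewrite -natrM ler_nat mulnC.
      rewrite ler_pdivrMr ?ltr0n//.
      apply: (@le_trans _ _ (pi * n.+1%:R)).
        by rewrite mulrC ler_pM2l// ler_nat ltnW.
      by rewrite ler_pM2r ?ltr0n// lerDl divr_ge0// ltW.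
    by rewrite C -mulr_natr; lra.
  rewrite /y /x /eigenvalue [leRHS]mulrCA ler_pM2l; last by rewrite mulr_gt0// exprn_gt0// ltr0n.
  exact: le_trans s1 s2.
have nu2 : 0 <= nu ^+ 2 by rewrite sqr_ge0.
rewrite /frequency2 -/x -/y /mode_mass -/x -/y mulrA.
rewrite ler_pdivrMr; last by rewrite ltr_wpDr// mulr_ge0.
rewrite mulrAC ler_pdivlMr; last by rewrite ltr_wpDr// mulr_ge0.
have := mulr_ge0 nu2 (mulr_ge0 x0 y0); nra.
Qed.

Lemma mode_mean_half n nu h (j k : nat) : (k < n.+1)%N -> (j < n.+1)%N -> (n < 2 * j)%N ->
  mode_mean n nu h k <= 8 * mode_mean n nu h j.
Proof.
move=> kn jn nj; rewrite /mode_mean mulrA ler_pM2r ?invr_gt0//.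
have -> : 8 * (h ^+ 2 * frequency2 n nu j) ^+ 3 = (h ^+ 2 * (2 * frequency2 n nu j)) ^+ 3 by ring.
have h0 : 0 <= h ^+ 2 by exact: sqr_ge0.
have H := ler_wpM2l h0 (frequency2_half nu kn jn nj).
apply: lerXn2r => //; rewrite nnegrE mulr_ge0 ?frequency2_ge0//.
by rewrite mulr_ge0 ?frequency2_ge0.
Qed.

(* The modes j > n / 2 have a squared frequency within a factor 2 of the largest
   one, so there are at least n / 2 modes of comparable variance. *)
Lemma variance_negligible n nu h (k : 'I_n) :
  2 * (mode_mean n nu h k.+1 + mode_mean n nu h k.+1 ^+ 2) <= 128 / n%:R * var_sum n nu h.
Proof.
have n0 : 0 < n%:R :> R by rewrite ltr0n (leq_ltn_trans _ (ltn_ord k)).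
pose v (j : nat) := 2 * (mode_mean n nu h j.+1 + mode_mean n nu h j.+1 ^+ 2).
have v0 j : 0 <= v j by rewrite mulr_ge0// addr_ge0 ?sqr_ge0 ?mode_mean_ge0.
(* A factor 8 between means becomes 8^2 on their squares. At least half of the indices qualify,
   whence 128 in the statement. *)
have vk j : (n./2 <= j < n)%N -> v k <= 64 * v j.
  move=> /andP[nj jn].
  have nj' : (n < 2 * j.+1)%N by clear -nj; lia.
  have H : mode_mean n nu h k.+1 <= 8 * mode_mean n nu h j.+1.
    by apply: mode_mean_half => //; rewrite ltnS ltn_ord.
  have t0 := mode_mean_ge0 n nu h k.+1; have s0 := mode_mean_ge0 n nu h j.+1.
  rewrite /v; nra.
have S : (n - n./2)%:R * (v k / 64) <= var_sum n nu h.
  rewrite /var_sum -(big_mkord xpredT v) (big_cat_nat (n := n./2))//=; last by lia.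
  rewrite -[leLHS]add0r lerD ?sumr_ge0//.
  rewrite mulr_natl -sumr_const_nat; apply: ler_sum_nat => j jn.
  by rewrite ler_pdivrMr// mulrC vk.
have half : n%:R / 2 <= (n - n./2)%:R :> R.
  by rewrite ler_pdivrMr// -natrM ler_nat; clear; lia.
rewrite mulrAC ler_pdivlMr// -/(v k).
have : n%:R / 2 * (v k / 64) <= var_sum n nu h.
  by apply: le_trans S; rewrite ler_wpM2r// divr_ge0.
lra.
Qed.

Lemma var_sum_gt0 n nu h : (0 < n)%N -> 0 < h -> 0 < var_sum n nu h.
Proof.
move=> n0 h0; have tgt0 (k : 'I_n) : 0 < mode_mean n nu h k.+1.
  rewrite divr_gt0// exprn_gt0// mulr_gt0 ?exprn_gt0// divr_gt0 ?mode_mass_gt0//.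
  by rewrite eigenvalue_gt0//= ltnS.
rewrite /var_sum (bigD1 (Ordinal n0))//= ltr_pwDl//.
  by rewrite mulr_gt0// addr_gt0 ?exprn_gt0//; exact: (tgt0 (Ordinal n0)).
by apply: sumr_ge0 => k _; rewrite mulr_ge0// addr_ge0 ?sqr_ge0// mode_mean_ge0.
Qed.

End energy_variation_statistics.

Section one_energy_variation.
Variables (R : realType) (n : nat) (nu h b : R).
Hypothesis b0 : 0 < b.
Local Notation mR := (measurableTypeR R).
Context d (T : measurableType d) (P : probability T R).
Variable X : {RV P >-> (n.+1.-tuple mR * n.+1.-tuple mR)%type}.
Hypothesis X_canonical : canonically_distributed nu b X.
Let Y w := b * energy_variation nu h (state (X w)).
Let L := quad_laws (@variation_coef R n nu h).

Lemma measurable_scaled_energy_variation : measurable_fun setT (Y : T -> R).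
Proof. by apply: measurable_funM => //; exact: measurable_energy_variation. Qed.

Let law (F : R -> \bar R) : measurable_fun setT (F : mR -> \bar R) ->
  (forall x, 0 <= F x)%E -> (\int[P]_w F (Y w) = \int[L]_y F y)%E.
Proof. exact: law_energy_variation. Qed.

Lemma energy_variation_mean_variance :
  ('E_P[Y] = (mean_sum n nu h)%:E)%E /\ ('V_P[Y] = (var_sum n nu h)%:E)%E.
Proof.
apply: (law_moments measurable_scaled_energy_variation law).
rewrite -sum_qmean -sum_qvar; apply: moments_conv_list => c; exact: moments_qlaw.
Qed.

Lemma energy_variation_expectation (f : R -> R) (C m s : R) :
  measurable_fun setT (f : mR -> R) -> (forall x, `|f x| <= C) ->
  ('E_P[(f \o (fun w => (Y w - m) / s))%R] = (\int[L]_y f ((y - m) / s))%:E)%E.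
Proof.
move=> mf fC; pose g (y : R) := f ((y - m) / s).
have mg : measurable_fun setT (g : mR -> R).
  apply: (measurableT_comp mf); apply: measurable_funM => //.
  exact: measurable_funD.
have gi : L.-integrable setT (fun y : mR => (g y)%:E).
  by apply: (@bounded_integrable _ _ _ L g C) => // x; exact: fC.
have [_ E] := law_integral measurable_scaled_energy_variation law mg gi.
rewrite unlock /Rintegral fineK; last exact: integrable_fin_num.
by rewrite -E.
Qed.

End one_energy_variation.

(** * Convergence in law of the normalized energy variation *)

Section normal_approximation.
Variable R : realType.
Local Notation mR := (measurableTypeR R).

(** [n0] is chosen before [nu] and [h]: no mode carries more than a share 128 / n of the variance,
    whatever the time step. *)
Lemma normal_approximation (f : R -> R) (C e : R) : 0 < e -> continuous f ->
  (forall x, `|f x| <= C) ->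
  exists n0 : nat, forall n (nu h : R), (n0 <= n)%N -> 0 < h ->
    `|\int[quad_laws (@variation_coef R n nu h)]_y
        f ((y - mean_sum n nu h) / Num.sqrt (var_sum n nu h))
      - \int[normal_prob 0 1]_z f z| <= e.
Proof.
move=> e0 cf fC; have [c c0 qc] := third_moment_qlaw R.
have mf : measurable_fun setT (f : mR -> mR) by exact: continuous_measurable_fun.
have [delta delta0 H] := lindeberg (@stdnormal_stable R) (@stdnormal_moments R)
  (@stdnormal_third_moment R) c0 e0 (smoothable_bounded_continuous cf fC) mf fC.
exists (Num.truncn (128 / delta)).+1 => n nu h n0 h0.
have n1 : (0 < n)%N by exact: leq_ltn_trans n0.
have := H _ (@qlaw R) (@qmean R) (@qvar R)
  [seq variation_coef nu h k | k <- enum 'I_n] (@moments_qlaw R) qc.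
rewrite sum_qmean sum_qvar; apply; first exact: var_sum_gt0.
move=> _ /mapP[k _ ->]; rewrite qvar_variation.
apply: le_trans (variance_negligible nu h k) _.
rewrite ler_pM2r ?var_sum_gt0// ler_pdivrMr ?ltr0n// mulrC -ler_pdivrMr//.
apply: le_trans (ltW (truncnS_gt _)) _; by rewrite ler_nat.
Qed.

End normal_approximation.

Section convergence.
Context (R : realType) (beta nu : R) (dt : nat -> R) (d : nat -> measure_display)
  (T : forall N, measurableType (d N)) (P : forall N, probability (T N) R)
  (X : forall N, {RV (P N) >->
      (N.-tuple (measurableTypeR R) * N.-tuple (measurableTypeR R))%type}).
Hypotheses (beta_gt0 : 0 < beta) (dt_gt0 : forall N, 0 < dt N).
Hypothesis X_canonical : forall N, (1 < N)%N ->
  canonically_distributed nu (beta / N%:R) (X N).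
Let Y N w := beta / N%:R * energy_variation nu (dt N) (state (X N w)).

Lemma scaled_energy_variation_mean_variance N : (1 < N)%N ->
  ('E_(P N)[@Y N] = (mean_sum N.-1 nu (dt N))%:E)%E /\
  ('V_(P N)[@Y N] = (var_sum N.-1 nu (dt N))%:E)%E.
Proof.
rewrite /Y; move: (X N) (@X_canonical N); case: N => // n XN XNc n1.
by apply: energy_variation_mean_variance; [rewrite divr_gt0// ltr0n|exact: XNc].
Qed.

Lemma energy_variation_converges_in_law : converges_in_law P
  (fun N w => (@Y N w - fine 'E_(P N)[@Y N]%E) / Num.sqrt (fine 'V_(P N)[@Y N]%E))
  (normal_prob 0 1).
Proof.
move=> f cf [C fC].
have mf : measurable_fun setT (f : measurableTypeR R -> R) by exact: continuous_measurable_fun.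
have fi : (normal_prob 0 1).-integrable setT (EFin \o f).
  exact: (@bounded_integrable _ _ _ (normal_prob 0 1) f C).
rewrite -[X in _ --> X]fineK; last exact: integrable_fin_num.
pose u N := \int[quad_laws (@variation_coef R N.-1 nu (dt N))]_y
   f ((y - mean_sum N.-1 nu (dt N)) / Num.sqrt (var_sum N.-1 nu (dt N))).
have EN N : (1 < N)%N ->
  ('E_(P N)[(f \o (fun w => (@Y N w - fine 'E_(P N)[@Y N]%E) / Num.sqrt (fine 'V_(P N)[@Y N]%E)))%R]
  = (u N)%:E)%E.
  move=> N1; have [-> ->] := scaled_energy_variation_mean_variance N1 => /=.
  rewrite /Y /u; move: (X N) (@X_canonical N) N1; case: N => // n XN XNc n1.
  by apply: (@energy_variation_expectation _ _ _ _ _ _ _ _ _ _ _ _ C) => //;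
   [rewrite divr_gt0// ltr0n|exact: XNc].
apply: (@cvg_trans _ ((fun N => (u N)%:E) @ \oo)).
  apply: near_eq_cvg; near=> N; rewrite EN//.
  by near: N; exact: nbhs_infty_gt.
apply/fine_cvgP; split; first by apply: nearW => N.
apply/cvgrPdist_le => e e0.
have [n0 H] := normal_approximation e0 cf fC.
near=> N; rewrite /= distrC; apply: H => //.
rewrite -ltnS prednK.
  by near: N; exact: nbhs_infty_gt.
by near: N; exact: nbhs_infty_gt.
Unshelve. all: by end_near.
Qed.

End convergence.

(** * Sums over the spectrum *)

(** With y = x / 2, sin x = 2 cos y sin y and sin y is at least y cos y. Moreover 2 (cos y)^2 is at
    least 1, since cos x is nonnegative. *)
Lemma sin_ge_half (R : realType) (x : R) : 0 <= x <= pi / 2 -> x / 2 <= sin x.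
Proof.
move=> /andP[]; rewrite le_eqVlt => /predU1P[<- _|x0 x2]; first by rewrite mul0r sin0.
have pi0 := pi_gt0 R; pose y := x / 2.
have y0 : 0 < y by rewrite divr_gt0.
have ypi : y <= pi / 2 by rewrite /y; lra.
have [c /[!in_itv]/= /andP[c0 cy] E] : exists2 c, c \in `]0, y[ & sin y - sin 0 = cos c * (y - 0).
  by apply: MVT => //; apply: continuous_subspaceT => z; exact: continuous_sin.
have cosy0 : 0 <= cos y by apply: cos_ge0_pihalf; apply/andP; split => //; lra.
have cosyc : cos y <= cos c.
  by apply/ltW; rewrite ltr_cos// in_itv/=; apply/andP; split; lra.
have xE : x = y *+ 2 by rewrite /y -mulr_natr; field.
have cosx0 : 0 <= cos x by apply: cos_ge0_pihalf; apply/andP; split; lra.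
have : 1 <= 2 * cos y ^+ 2.
  by move: cosx0; rewrite xE cos_mulr2n -mulr_natr; lra.
have -> : sin x = 2 * (cos y * sin y) by rewrite xE sin_mulr2n -mulr_natl.
move: E; rewrite sin0 !subr0 -/y => -> D.
have H : cos y * y <= cos c * y by rewrite ler_pM2r.
have := ler_wpM2l cosy0 H; nra.
Qed.

(** The induction proves the telescoping bound 2 - 1 / n, which holds at [n = 0] too because the
    inverse of 0 is 0. *)
Lemma sum_inv_sqr (R : realType) n : \sum_(k < n) (k.+1%:R ^+ 2)^-1 <= 2 :> R.
Proof.
suff : \sum_(k < n) (k.+1%:R ^+ 2)^-1 <= 2 - n%:R^-1 :> R.
  by move=> /le_trans; apply; rewrite gerBl invr_ge0.
elim: n => [|[|n] IH]; first by rewrite big_ord0 invr0 subr0.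
  by rewrite big_ord_recr big_ord0 /= add0r expr1n invr1; lra.
rewrite big_ord_recr /=; apply: le_trans (lerD IH (lexx _)) _.
rewrite -addrA lerD2l -lerBrDl opprK addrC.
have a0 : 0 < n.+1%:R :> R by rewrite ltr0n.
have -> : n.+2%:R = n.+1%:R + 1 :> R by rewrite -natr1.
set a := n.+1%:R : R; rewrite -/a in a0.
have -> : a^-1 - (a + 1)^-1 = (a * (a + 1))^-1 by field; apply/andP; split; lra.
rewrite lef_pV2 ?posrE; [nra|nra|]. by rewrite mulr_gt0//; lra.
Qed.

Section spectral_sums.
Variables (R : realType) (n : nat) (nu h : R).
Local Notation N := n.+1.

(** The square root of the eigenvalue is 2 N sin (angle k), at least k pi / 2. The bound is
    independent of N and summable once inverted. *)
Lemma eigenvalue_ge_sqr k : (k < N)%N -> k%:R ^+ 2 <= eigenvalue R n k.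
Proof.
move=> kN; have N0 : 0 < N%:R :> R by rewrite ltr0n.
have s : k%:R <= 2 * N%:R * sin (angle R n k).
  apply: (@le_trans _ _ (2 * N%:R * (angle R n k / 2))); last first.
    rewrite ler_pM2l ?mulr_gt0// sin_ge_half// angle_ge0 ltW//.
    exact: angle_lt_pihalf.
  have -> : 2 * N%:R * (angle R n k / 2) = k%:R * (pi / 2) :> R.
    by rewrite /angle; field; lra.
  by rewrite ler_peMr// pihalf_ge1.
have -> : eigenvalue R n k = (2 * N%:R * sin (angle R n k)) ^+ 2.
  by rewrite /eigenvalue; ring.
apply: lerXn2r => //; rewrite nnegrE//; exact: le_trans s.
Qed.

Lemma mean_sum_ge0 : 0 <= mean_sum n nu h.
Proof. by apply: sumr_ge0 => k _; exact: mode_mean_ge0. Qed.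

(** Each variance 2 (t + t^2) lies between 2 t and 2 (1 + tau) t, so the variance asymptotics follow
    from those of the mean once [tau] tends to 0. *)
Lemma var_sum_bounds tau : (forall k, (k < N)%N -> mode_mean n nu h k <= tau) ->
  2 * mean_sum n nu h <= var_sum n nu h <= 2 * (1 + tau) * mean_sum n nu h.
Proof.
move=> ht; rewrite /mean_sum !mulr_sumr; apply/andP; split; apply: ler_sum => k _.
  by rewrite ler_pM2l// lerDl sqr_ge0.
have := mode_mean_ge0 n nu h k.+1; have := ht k.+1; rewrite ltnS ltn_ord => /(_ isT).
nra.
Qed.

Section penalized.
Hypothesis nu0 : 0 < nu.
(** The limit of a mode mean for an infinite eigenvalue, where [x k] tends to 1. *)
Let c := h ^+ 6 / (32 * nu ^+ 6).
Let x k := nu ^+ 2 * frequency2 n nu k.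

Let c0 : 0 <= c.
Proof.
rewrite divr_ge0//; last by rewrite mulr_ge0// exprn_ge0// ltW.
by rewrite -[6%N]/(2 * 3)%N exprM exprn_ge0// sqr_ge0.
Qed.

Let x01 k : 0 <= x k <= 1.
Proof.
rewrite mulr_ge0 ?sqr_ge0 ?frequency2_ge0//= /x mulrA ler_pdivrMr ?mode_mass_gt0//.
by rewrite mul1r lerDr.
Qed.

Let mode_meanE k : mode_mean n nu h k = c * x k ^+ 3.
Proof. by rewrite /mode_mean /c /x; field; rewrite gt_eqF. Qed.

Lemma mode_mean_penalized_le k : mode_mean n nu h k <= c.
Proof.
have /andP[x0 x1] := x01 k.
by rewrite mode_meanE ler_piMr// exprn_ile1.
Qed.

(** The deficit stays bounded in units of [c]. The 1 accounts for mode 0, counted in N and absent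
    from the sum. For the others 1 - x^3 is at most 3 (1 - x), 1 - x is the inverse mass, at most 1
    / (nu^2 k^2), and the sum of inverse squares is at most 2. *)
Lemma mean_sum_penalized :
  0 <= N%:R * c - mean_sum n nu h <= (1 + 6 / nu ^+ 2) * c.
Proof.
have nu20 : 0 < nu ^+ 2 by rewrite exprn_gt0.
have -> : N%:R * c - mean_sum n nu h = (1 + \sum_(k < n) (1 - x k.+1 ^+ 3)) * c.
  rewrite mulrDl mul1r mulr_suml -natr1 mulrDl mul1r [_ + c]addrC -addrA; congr (_ + _).
  have -> : n%:R * c = \sum_(k < n) c by rewrite sumr_const card_ord mulr_natl.
  by rewrite /mean_sum -sumrB; apply: eq_bigr => k _; rewrite mode_meanE; ring.
have d (k : 'I_n) : 0 <= 1 - x k.+1 ^+ 3 <= 3 / nu ^+ 2 * (k.+1%:R ^+ 2)^-1.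
  have /andP[x0 x1] := x01 k.+1.
  rewrite subr_ge0 exprn_ile1//=; apply: (@le_trans _ _ (3 * (1 - x k.+1))).
    rewrite -subr_ge0.
    have -> : 3 * (1 - x k.+1) - (1 - x k.+1 ^+ 3) = (1 - x k.+1) ^+ 2 * (2 + x k.+1) by ring.
    by rewrite mulr_ge0 ?sqr_ge0// addr_ge0.
  rewrite -mulrA ler_pM2l// -invfM.
  have m0 := mode_mass_gt0 n nu k.+1.
  have -> : 1 - x k.+1 = (mode_mass n nu k.+1)^-1.
    by rewrite /x /frequency2 /mode_mass in m0 *; field; rewrite gt_eqF.
  rewrite lef_pV2 ?posrE//; last by rewrite mulr_gt0// exprn_gt0// ltr0n.
  apply: (@le_trans _ _ (nu ^+ 2 * eigenvalue R n k.+1)); last by rewrite /mode_mass lerDr.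
  by rewrite ler_pM2l// eigenvalue_ge_sqr// ltnS.
apply/andP; split.
  by rewrite mulr_ge0// addr_ge0// sumr_ge0// => k _; have /andP[] := d k.
apply: ler_wpM2r => //; rewrite lerD2l.
apply: (@le_trans _ _ (\sum_(k < n) 3 / nu ^+ 2 * (k.+1%:R ^+ 2)^-1)).
  by apply: ler_sum => k _; have /andP[] := d k.
rewrite -mulr_sumr; have -> : 6 / nu ^+ 2 = 3 / nu ^+ 2 * 2 by ring.
by rewrite ler_pM2l ?divr_gt0// sum_inv_sqr.
Qed.

End penalized.

Lemma mode_mean_exact_le k : mode_mean n 0 h k <= 2 * (N%:R * h) ^+ 6.
Proof.
have s0 := sqr_ge0 (sin (angle R n k)).
have s1 : sin (angle R n k) ^+ 2 <= 1 by rewrite sin2cos2 gerBl sqr_ge0.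
have -> : mode_mean n 0 h k = 2 * (N%:R * h) ^+ 6 * (sin (angle R n k) ^+ 2) ^+ 3.
  by rewrite /mode_mean /frequency2 /mode_mass expr0n/= mul0r addr0 divr1 /eigenvalue; field.
have s3 : (sin (angle R n k) ^+ 2) ^+ 3 <= 1 by exact: exprn_ile1.
rewrite ler_piMr// mulr_ge0// -[6%N]/(2 * 3)%N exprM exprn_ge0//.
exact: sqr_ge0.
Qed.

Lemma sum_cos (phi : R) (m : nat) : sin (phi / 2) != 0 ->
  \sum_(k < m) cos (k%:R * phi) = (sin (m%:R * phi - phi / 2) / sin (phi / 2) + 1) / 2.
Proof.
move=> s0; elim: m => [|m IH].
  by rewrite big_ord0 mul0r sub0r sinN mulNr divff// addNr mul0r.
rewrite big_ord_recr /= IH -[m.+1%:R]natr1.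
have -> : (m%:R + 1) * phi - phi / 2 = m%:R * phi + phi / 2 by field.
by rewrite sinB sinD; field.
Qed.

(* 32 sin^6 x = 10 - 15 cos 2x + 6 cos 4x - cos 6x, and the sums of cosines
   telescope. *)
Lemma mean_sum_exact : (0 < n)%N ->
  mean_sum n 0 h = (5 / 8 * N%:R ^+ 7 - N%:R ^+ 6) * h ^+ 6.
Proof.
move=> n0; have pi0 := pi_gt0 R; have N0 : 0 < N%:R :> R by rewrite ltr0n.
pose th : R := pi / N%:R.
(* The denominators of [sum_cos] at the three frequencies. As N is at least 2, the arguments do not
   exceed 3 pi / 4; for N = 1 the case [m = 2] would fail. *)
have s (m : nat) : (0 < m < 4)%N -> sin (m%:R * th / 2) != 0.
  move=> m4; rewrite gt_eqF// sin_gt0_pi//.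
  have N2 : 2 <= N%:R :> R by rewrite ler_nat.
  have th2 : th <= pi / 2 by rewrite /th ler_pM2l// lef_pV2 ?posrE.
  have th0 : 0 < th by rewrite divr_gt0.
  have m0 : 1 <= m%:R :> R by rewrite ler1n; lia.
  have m3 : m%:R <= 3 :> R by rewrite (ler_nat _ m 3); lia.
  by apply/andP; split; nra.
have Nth (m : nat) : N%:R * (m%:R * th) = m%:R * pi by rewrite /th; field; lra.
have C1 : \sum_(k < N) cos (k%:R * (1%:R * th)) = 1.
  rewrite sum_cos ?s// Nth sinB mul1r sinpi cospi mul0r sub0r mulN1r opprK.
  by rewrite divff ?s//; field.
have C2 : \sum_(k < N) cos (k%:R * (2%:R * th)) = 0.
  rewrite sum_cos ?s// Nth sinB mulr_natl sin2pi cos2pi mul0r sub0r mul1r mulNr.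
  by rewrite divff ?s// addNr mul0r.
have C3 : \sum_(k < N) cos (k%:R * (3%:R * th)) = 1.
  rewrite sum_cos ?s// Nth sinB mulr_natl mulrS [pi + _]addrC sinDpi cosDpi sin2pi cos2pi.
  by rewrite oppr0 mul0r sub0r mulN1r opprK divff ?s//; field.
have sin6 (k : nat) : mode_mean n 0 h k = (N%:R * h) ^+ 6 / 16 *
   (10 - 15 * cos (k%:R * (1%:R * th)) + 6 * cos (k%:R * (2%:R * th))
    - cos (k%:R * (3%:R * th))).
  pose x := angle R n k.
  have e (m : nat) : k%:R * (m%:R * th) = m%:R * (2 * x).
    by rewrite /x /angle /th; field; rewrite gt_eqF.
  have e1 : k%:R * (1%:R * th) = x *+ 2 by rewrite e; ring.
  have e2 : k%:R * (2%:R * th) = x *+ 2 *+ 2 by rewrite e; ring.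
  have e3 : k%:R * (3%:R * th) = x *+ 2 *+ 2 + x *+ 2 by rewrite e; ring.
  rewrite e3 e2 e1 (cosD (x *+ 2 *+ 2) (x *+ 2)).
  rewrite (cos_mulr2n (x *+ 2)) (sin_mulr2n (x *+ 2)) (cos_mulr2n x) (sin_mulr2n x).
  rewrite /mode_mean /frequency2 /mode_mass expr0n/= mul0r addr0 divr1 /eigenvalue -/x.
  have S := sin2cos2 x. 
  have -> : (cos x ^+ 2 *+ 2 - 1) * (cos x * sin x *+ 2) *+ 2 * (cos x * sin x *+ 2) =
    (cos x ^+ 2 *+ 2 - 1) *+ 8 * (cos x ^+ 2 * sin x ^+ 2) by ring.
  by rewrite S; field.
have -> : mean_sum n 0 h = \sum_(k < N) mode_mean n 0 h k.
  rewrite big_ord_recl /= [X in X + _](_ : _ = 0) ?add0r//.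
  by rewrite /mode_mean /frequency2 eigenvalue0 mul0r mulr0 expr0n/= mul0r.
(* The bracket sums to 10 N - 15 + 0 - 1 = 10 N - 16, with the factor (N h)^6 / 16 in front. *)
under eq_bigr => k _ do rewrite sin6.
rewrite -mulr_sumr sumrB big_split /= sumrB -!mulr_sumr C1 C2 C3 sumr_const card_ord.
by rewrite -mulr_natr; field.
Qed.

End spectral_sums.

(** * Asymptotic equivalents *)

Section equivalents.
Variable R : realType.

Lemma equivalent_of_relative_error (f g : nat -> R^o) (eps : nat -> R) :
  eps @ \oo --> 0 -> (\forall N \near \oo, `|f N - g N| <= eps N * `|g N|) ->
  f ~_\oo g.
Proof.
move=> eps0 fg; apply/eqaddoP => e e0; near=> N => /=.
apply: (@le_trans _ _ (eps N * `|g N|)); first by near: N.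
rewrite ler_wpM2r//.
apply: le_trans (ler_norm _) _; near: N; move: e e0.
exact/cvgr0Pnorm_le.
Unshelve. all: by end_near. Qed.

(** The common end of both regimes: the mean has relative error of order 1 / N, and the variance
    adds a relative error [tau]. *)
Lemma mean_variance_equivalents (M S g : nat -> R^o) (tau : nat -> R) (C : R) :
  tau @ \oo --> 0 ->
  (\forall N \near \oo, [/\ 0 <= M N, 0 <= g N - M N <= C / N%:R * g N &
     2 * M N <= S N <= 2 * (1 + tau N) * M N]) ->
  M ~_\oo g /\ S ~_\oo (fun N => 2 * g N).
Proof.
move=> tau0 H.
have C0 : (fun N => C / N%:R) @ \oo --> (0 : R).
  rewrite -(mulr0 C); apply: cvgMr => //.
  rewrite -cvg_shiftS; exact: cvg_harmonic.
split.
  apply: (equivalent_of_relative_error C0).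
  near=> N; have [M0 /andP[gM gMC] _] : [/\ 0 <= M N, 0 <= g N - M N <= C / N%:R * g N &
    2 * M N <= S N <= 2 * (1 + tau N) * M N] by near: N.
  by rewrite distrC ger0_norm// (le_trans gMC)// [`|g N|]ger0_norm//; lra.
apply: (@equivalent_of_relative_error _ _ (fun N => C / N%:R + `|tau N|)).
  rewrite -[0 : R](addr0 0); apply: cvgD => //.
  by rewrite -[0 : R](normr0 R); exact: cvg_norm.
near=> N; have [M0 /andP[gM gMC] /andP[MS SM]] : [/\ 0 <= M N,
    0 <= g N - M N <= C / N%:R * g N &
    2 * M N <= S N <= 2 * (1 + tau N) * M N] by near: N.
have g0 : 0 <= g N by lra.
have t0 := ler_norm (tau N); have t1 := normr_ge0 (tau N).
rewrite [`|2 * g N|]ger0_norm ?mulr_ge0// ler_norml; apply/andP; split; nra.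
Unshelve. all: by end_near. Qed.

End equivalents.

Theorem proposition7p3 (R : realType) (beta nu : R) (dt : nat -> R^o)
    (d : nat -> measure_display) (T : forall N, measurableType (d N))
    (P : forall N, probability (T N) R)
    (X : forall N, {RV (P N) >->
      (N.-tuple (measurableTypeR R) * N.-tuple (measurableTypeR R))%type})
    (beta_gt0 : 0 < beta) (nu_ge0 : 0 <= nu)
    (dt_gt0 : forall N, 0 < dt N)
    (X_canonical : forall N, (1 < N)%N ->
      canonically_distributed nu (beta / N%:R) (X N)) :
  let Y N w := beta / N%:R * energy_variation nu (dt N) (state (X N w)) in
  let m N : R^o := fine ('E_(P N)[Y N])%E in
  let sigma2 N : R^o := fine ('V_(P N)[Y N])%E in
  [/\ converges_in_law P
        (fun N w => (Y N w - m N) / Num.sqrt (sigma2 N)) (normal_prob 0 1),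
      0 < nu -> dt =o_\oo (fun=> 1 : R^o) ->
        m ~_\oo (fun N => N%:R * dt N ^+ 6 / (32 * nu ^+ 6)) /\
        sigma2 ~_\oo (fun N => N%:R * dt N ^+ 6 / (16 * nu ^+ 6)) &
      nu = 0 -> dt =o_\oo (fun N => N%:R^-1 : R^o) ->
        m ~_\oo (fun N => 5 / 8 * N%:R ^+ 7 * dt N ^+ 6) /\
        sigma2 ~_\oo (fun N => 5 / 4 * N%:R ^+ 7 * dt N ^+ 6)].
Proof.
move=> Y m sigma2.
have mE N : (1 < N)%N -> m N = mean_sum N.-1 nu (dt N).
  move=> N1; rewrite /m.
  by have [-> _] := scaled_energy_variation_mean_variance dt beta_gt0 X_canonical N1.
have sE N : (1 < N)%N -> sigma2 N = var_sum N.-1 nu (dt N).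
  move=> N1; rewrite /sigma2.
  by have [_ ->] := scaled_energy_variation_mean_variance dt beta_gt0 X_canonical N1.
split.
- exact: energy_variation_converges_in_law.
- move=> nu0 dt0; pose g N : R^o := N%:R * dt N ^+ 6 / (32 * nu ^+ 6).
  (* [tau] dominates the mean of every mode; its convergence to 0 is what the assumption on the time
     step provides. *)
  pose tau N : R := dt N ^+ 6 / (32 * nu ^+ 6).
  have tau0 : tau @ \oo --> 0.
    rewrite /tau -(mul0r (32 * nu ^+ 6)^-1); apply: cvgMl => //.
    have dtc : dt @ \oo --> (0 : R^o) by apply/eqolim0P.
    rewrite -[0 : R](expr0n R 6); exact: (cvg_comp _ _ dtc (@exprn_continuous R 6 0)).
  have [|mg sg] := @mean_variance_equivalents R m sigma2 g tau (1 + 6 / nu ^+ 2) tau0.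
    near=> N; have N1 : (1 < N)%N by near: N; exact: nbhs_infty_gt.
    have N0 : 0 < N%:R :> R by rewrite ltr0n ltnW.
    have NE : N.-1.+1 = N by rewrite prednK// ltnW.
    rewrite mE// sE//; split; first exact: mean_sum_ge0.
      have := mean_sum_penalized N.-1 (dt N) nu0; rewrite NE.
      have -> : g N = N%:R * (dt N ^+ 6 / (32 * nu ^+ 6)) by rewrite /g mulrA.
      by rewrite [(1 + 6 / nu ^+ 2) / N%:R * _]mulrA divfK// gt_eqF.
    by apply: var_sum_bounds => k _; exact: mode_mean_penalized_le.
  split=> //; rewrite [X in _ ~_\oo X](_ : _ = fun N => 2 * g N)//.
  by apply/funext => N; rewrite /g; field; rewrite gt_eqF.
- move=> nu0 dt0; pose g N : R^o := 5 / 8 * N%:R ^+ 7 * dt N ^+ 6.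
  (* Here the top frequency grows like N, so the bound on the mode means tends to 0 when N times the
     time step does. *)
  pose tau N : R := 2 * (N%:R * dt N) ^+ 6.
  have tau0 : tau @ \oo --> 0.
    rewrite /tau -(mulr0 2); apply: cvgMr => //.
    have dtc : (fun N => N%:R * dt N) @ \oo --> (0 : R).
      apply/cvgr0Pnorm_le => e e0; near=> N.
      have N0 : 0 < N%:R :> R by rewrite ltr0n; near: N; exact: nbhs_infty_gt.
      rewrite normrM gtr0_norm// mulrC -ler_pdivlMr//.
      rewrite -[N%:R^-1]gtr0_norm ?invr_gt0//; near: N.
      by move/eqoP : dt0; apply.
    rewrite -[0 : R](expr0n R 6); exact: (cvg_comp _ _ dtc (@exprn_continuous R 6 0)).
  (* 8 / 5 is the ratio of the correction N^6 to the leading term 5/8 N^7, multiplied by N. *)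
  have [|mg sg] := @mean_variance_equivalents R m sigma2 g tau (8 / 5) tau0.
    near=> N; have N1 : (1 < N)%N by near: N; exact: nbhs_infty_gt.
    have N0 : 0 < N%:R :> R by rewrite ltr0n ltnW.
    have NE : N.-1.+1 = N by rewrite prednK// ltnW.
    rewrite mE// sE// nu0; split; first exact: mean_sum_ge0.
      have n0 : (0 < N.-1)%N by rewrite -ltnS NE.
      rewrite mean_sum_exact// NE.
      have -> : 8 / 5 / N%:R * g N = N%:R ^+ 6 * dt N ^+ 6.
        by rewrite /g; field; rewrite gt_eqF.
      have -> : g N - (5 / 8 * N%:R ^+ 7 - N%:R ^+ 6) * dt N ^+ 6 = N%:R ^+ 6 * dt N ^+ 6.
        by rewrite /g; ring.
      by rewrite lexx andbT mulr_ge0// exprn_ge0// ltW.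
    apply: var_sum_bounds => k _; rewrite /tau.
    by have := mode_mean_exact_le N.-1 (dt N) k; rewrite NE.
  split=> //; rewrite [X in _ ~_\oo X](_ : _ = fun N => 2 * g N)//.
  by apply/funext => N; rewrite /g; field.
Unshelve. all: by end_near. Qed.
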